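(* There exists a constant $\beta_6>0$, independent of $h$, such that for any $\varphi_h\in S_h^{k-2}$, $$\sup_{\boldsymbol 0\ne\boldsymbol d_h\in\boldsymbol D_h^{k-1}}\frac{\int_{\Omega_h}\varphi_h\operatorname{div}\boldsymbol d_h\,\mathrm d\boldsymbol x}{\|\boldsymbol d_h\|_{\boldsymbol H(\operatorname{div},\Omega_h)}}\ge\beta_6\|\varphi_h\|_{L^2(\Omega_h)}.$$
   Context: $k\ge2$ is a fixed integer. $\Omega\subset\mathbb R^3$ is a bounded Lipschitz domain with possibly curved, piecewise $C^{k+1}$ boundary. $\widehat{\mathcal T}_h$ is a conforming, shape-regular and quasi-uniform straight-edged tetrahedral mesh (approximating $\Omega$), $\widehat\Omega_h$ the polyhedral domain it occupies, $h=\max_{\hat K}\operatorname{diam}\hat K$. $\boldsymbol M_h$ is a continuous piecewise polynomial map of degree $k$ on $\widehat{\mathcal T}_h$ and $\Omega_h=\boldsymbol M_h(\widehat\Omega_h)$. With $\mathbb J$ denoting Jacobian matrices, $\mathbb I$ the identity matrix, and norms of Jacobians understood element by element, it is assumed ($h$ being sufficiently small) that $\boldsymbol M_h$ is bijective and, with constants independent of $h$, $\|\mathbb J_{\boldsymbol M_h}\|_{W^{k,\infty}(\widehat\Omega_h)}\le C$, $\|\mathbb J_{\boldsymbol M_h^{-1}}\|_{W^{k,\infty}(\Omega_h)}\le C$, $\|\mathbb J_{\boldsymbol M_h}-\mathbb I\|_{L^\infty(\widehat\Omega_h)}\le Ch$, $\det\mathbb J_{\boldsymbol M_h}\ge\delta>0$.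 Spaces: $\widehat{\boldsymbol D}_h^{k-1}=\{\hat{\boldsymbol d}\in\boldsymbol H(\operatorname{div},\widehat\Omega_h):\hat{\boldsymbol d}|_{\hat K}\in (P_{k-1}(\hat K))^3\ \forall\hat K\in\widehat{\mathcal T}_h\}$, $\widehat S_h^{k-2}=\{\hat\varphi\in L^2(\widehat\Omega_h):\hat\varphi|_{\hat K}\in P_{k-2}(\hat K)\ \forall\hat K\in\widehat{\mathcal T}_h\}$, where $P_m$ denotes polynomials of degree $\le m$; $\boldsymbol D_h^{k-1}=\{(\tfrac1{\det\mathbb J_{\boldsymbol M_h}}\mathbb J_{\boldsymbol M_h}\hat{\boldsymbol d})\circ\boldsymbol M_h^{-1}:\hat{\boldsymbol d}\in\widehat{\boldsymbol D}_h^{k-1}\}$ (Piola transformation), $S_h^{k-2}=\{\hat\varphi\circ\boldsymbol M_h^{-1}:\hat\varphi\in\widehat S_h^{k-2}\}$. $\|\boldsymbol d\|_{\boldsymbol H(\operatorname{div})}^2=\|\boldsymbol d\|_{\boldsymbol L^2}^2+\|\operatorname{div}\boldsymbol d\|_{L^2}^2$. Known fact on the straight mesh (taken as given): there is $\beta_4>0$, independent of $h$, with $\sup_{\boldsymbol 0\ne\hat{\boldsymbol d}\in\widehat{\boldsymbol D}_h^{k-1}}\int_{\widehat\Omega_h}\hat\varphi\,\widehat{\operatorname{div}}\,\hat{\boldsymbol d}/\|\hat{\boldsymbol d}\|_{\boldsymbol H(\operatorname{div},\widehat\Omega_h)}\ge\beta_4\|\hat\varphi\|_{L^2(\widehat\Omega_h)}$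 for all $\hat\varphi\in\widehat S_h^{k-2}$. *)

(* Defs.v *)
From HB Require Import structures.
From mathcomp Require Import all_boot all_order all_algebra.
From mathcomp Require Import -(notations) mpoly.
From mathcomp Require Import all_classical all_reals all_analysis.
Import Order.TTheory GRing.Theory Num.Theory.
Import numFieldNormedType.Exports.

Set Implicit Arguments.
Unset Strict Implicit.
Unset Printing Implicit Defensive.

Local Open Scope classical_set_scope.
Local Open Scope ring_scope.

(* Points and vectors of R^3 are row vectors
   'rV[R]_3. As the library has no Lebesgue measure on that type, integrals over
   subsets of 'rV[R]_3 are pulled back to R * R * R along [pt3]. *)

Section Space.
Context {R : realType}.
Local Notation E := 'rV[R]_3.

Definition lam3 :=
  ((@lebesgue_measure R \x @lebesgue_measure R) \x @lebesgue_measure R)%E.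

Definition pt3 (p : measurableTypeR R * measurableTypeR R * measurableTypeR R) : E :=
  \row_(j < 3) [:: p.1.1; p.1.2; p.2]`_j.

Definition integral3 (A : set E) (f : E -> R) : R :=
  \int[lam3]_(p in pt3 @^-1` A) f (pt3 p).

Definition measurable_on (A : set E) (f : E -> R) : Prop :=
  measurable_fun (pt3 @^-1` A) (f \o pt3).

Definition ae_on (A : set E) (P : E -> Prop) : Prop :=
  \forall p \ae lam3, A (pt3 p) -> P (pt3 p).

(* The 'rV[R]_3 norm of the library is the maximum norm. *)
Definition enorm (x : E) : R := Num.sqrt (\sum_(l < 3) x 0 l ^+ 2).

Definition dir (l : 'I_3) : E := delta_mx 0 l.
Definition partial (l : 'I_3) (f : E -> R) (x : E) : R := 'D_(dir l) f x.
Definition grad (f : E -> R) (x : E) : E := \row_(l < 3) partial l f x.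

Fixpoint Ck_on (U : set E) (n : nat) (f : E -> R) : Prop :=
  (forall x, U x -> {for x, continuous f}) /\
  if n is n'.+1 then
    forall l, (forall x, U x -> derivable f x (dir l)) /\
              Ck_on U n' (partial l f)
  else True.

(* Test functions C_c^\infty(U), extended by zero to the whole space. *)
Definition test_fun (U : set E) (phi : E -> R) : Prop :=
  [/\ forall n, Ck_on setT n phi,
      compact (closure [set x | phi x != 0]) &
      closure [set x | phi x != 0] `<=` U].

End Space.

Section FunctionSpaces.
Context {R : realType}.
Local Notation E := 'rV[R]_3.
Implicit Types (A U : set E) (f g phi : E -> R) (d : E -> E).

(* Elements of Lebesgue spaces are measurable representatives; membership in the
   spaces below is invariant under modification on null sets. *)

Definition L2 A f : Prop :=
  measurable_on A f /\
  (\int[lam3]_(p in pt3 @^-1` A) ((f (pt3 p)) ^+ 2)%:E < +oo)%E.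

Definition L2norm A f : R := Num.sqrt (integral3 A (fun x => f x ^+ 2)).

Definition L2v A d : Prop := forall l : 'I_3, L2 A (fun x => d x 0 l).

Definition weak_partial U (l : 'I_3) f g : Prop :=
  forall phi, test_fun U phi ->
    integral3 U (fun x => f x * partial l phi x) =
    - integral3 U (fun x => g x * phi x).

(* f belongs to W^{k,\infty}(U) and the L^\infty norms of f and of all its weak
   derivatives of order at most k are bounded by C. *)
Fixpoint Wkoo_le U (k : nat) (C : R) f : Prop :=
  [/\ measurable_on U f, ae_on U (fun x => `|f x| <= C) &
      if k is k'.+1 then
        forall l, exists2 g, weak_partial U l f g & Wkoo_le U k' C g
      else True].

(* g is the distributional divergence of d on U, and it is in L^2(U). It is a
   relation because g is only determined up to null sets. *)
Definition is_div U d g : Prop :=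
  L2 U g /\
  forall phi, test_fun U phi ->
    integral3 U (fun x => \sum_(l < 3) d x 0 l * partial l phi x) =
    - integral3 U (fun x => g x * phi x).

Definition Hdiv U d : Prop := L2v U d /\ exists g, is_div U d g.

(* Norm of d in H(div, U), where g is the divergence of d. *)
Definition Hdiv_norm U d g : R :=
  Num.sqrt (integral3 U (fun x => enorm (d x) ^+ 2) + L2norm U g ^+ 2).

(* The supremum over 0 <> d \in D of (\int_U phi div d) / |d|_{H(div, U)}. *)
Definition sup_quotient U (D : set (E -> E)) phi : \bar R :=
  ereal_sup [set y | exists d g,
    [/\ D d, ~ ae_on U (fun x => d x = 0), is_div U d g &
        y = (integral3 U (fun x => phi x * g x) / Hdiv_norm U d g)%:E]].

Definition inf_sup U (D : set (E -> E)) (S : set (E -> R)) (beta : R) : Prop :=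
  forall phi, S phi -> ((beta * L2norm U phi)%:E <= sup_quotient U D phi)%E.

(* [msize p] is the total degree plus one. *)
Definition poly_on A (m : nat) f : Prop :=
  exists p : mpoly 3 R, (msize p <= m.+1)%N /\
    forall x, A x -> f x = meval (fun l => x 0 l) p.

End FunctionSpaces.

Section Domain.
Context {R : realType}.
Local Notation E := 'rV[R]_3.
Implicit Types Omega : set E.

Definition bdry Omega : set E := closure Omega `\` Omega°.

(* Near each boundary point, in orthonormal coordinates given by the rows of Q,
   Omega is the strict epigraph of a Lipschitz function gam. *)
Definition lipschitz_bdry Omega : Prop :=
  forall x0, bdry Omega x0 ->
  exists (Q : 'M[R]_3) (r b L : R) (gam : R -> R -> R),
  [/\ Q *m Q^T = 1%:M, 0 < r, 0 < b,
      (forall s t s' t', `|gam s t - gam s' t'| <= L * (`|s - s'| + `|t - t'|)) /\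
      (forall s t, `|s| < r -> `|t| < r -> `|gam s t| < b) &
      forall z : E, `|z 0 0| < r -> `|z 0 1| < r -> `|z 0 2| < b ->
        (Omega (x0 + z *m Q) <-> gam (z 0 0) (z 0 1) < z 0 2)].

(* The boundary is a finite union of closed patches, each of which lies locally
   in a regular level surface of a C^m function. *)
Definition piecewise_Ck_bdry (m : nat) Omega : Prop :=
  exists (n : nat) (G : 'I_n -> set E),
  [/\ forall j, closed (G j),
      bdry Omega = [set x | exists j, G j x] &
      forall j x, G j x -> exists (U : set E) (F : E -> R),
        [/\ open U /\ U x, Ck_on U m F, forall y, U y -> grad F y != 0 &
            forall y, G j y -> U y -> F y = 0]].

Definition bounded_lipschitz_domain Omega : Prop :=
  [/\ Omega !=set0, open Omega, connected Omega, bounded_set Omega &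
      lipschitz_bdry Omega].

End Domain.

Section Mesh.
Context {R : realType}.
Local Notation E := 'rV[R]_3.

Record tetmesh := Tetmesh { ncells : nat ; vtx : 'I_ncells -> 'I_4 -> E }.

Implicit Types (T : tetmesh) (M : E -> E).

(* Convex hull of the vertices v l, l \in A. *)
Definition hull (v : 'I_4 -> E) (A : {set 'I_4}) : set E :=
  [set x | exists c : 'I_4 -> R,
    [/\ forall l, 0 <= c l, forall l, l \notin A -> c l = 0,
        \sum_l c l = 1 & x = \sum_l c l *: v l]].

Definition cell T (j : 'I_(ncells T)) : set E := hull (@vtx T j) [set: 'I_4]%SET.
Definition ocell T (j : 'I_(ncells T)) : set E := (cell j)°.

Definition nondegenerate (v : 'I_4 -> E) : Prop :=
  \det (\matrix_(a < 3) (v (lift ord0 a) - v ord0)) != 0.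

(* Two distinct tetrahedra meet in a common proper (possibly empty) face. *)
Definition conforming T : Prop :=
  forall j j' : 'I_(ncells T), j <> j' ->
  exists A A' : {set 'I_4},
  [/\ A != [set: 'I_4]%SET, A' != [set: 'I_4]%SET,
      cell j `&` cell j' = hull (@vtx T j) A &
      cell j `&` cell j' = hull (@vtx T j') A'].

Definition closed_polyhedron T : set E := [set x | exists j : 'I_(ncells T), cell j x].
Definition polyhedron T : set E := (closed_polyhedron T)°.

Definition is_mesh T : Prop :=
  [/\ (0 < ncells T)%N, forall j, nondegenerate (@vtx T j), conforming T &
      connected (polyhedron T)].

Definition diam (A : set E) : R :=
  sup [set s | exists x y, [/\ A x, A y & s = enorm (x - y)]].
Definition inradius (A : set E) : R :=
  sup [set r | 0 <= r /\ exists c, forall x, enorm (x - c) <= r -> A x].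
Definition meshsize T : R := \big[Num.max/0]_(j < ncells T) diam (cell j).

Definition shape_regular (sigma : R) T : Prop :=
  forall j : 'I_(ncells T), diam (cell j) <= sigma * inradius (cell j).
Definition quasi_uniform (tau : R) T : Prop :=
  forall j : 'I_(ncells T), meshsize T <= tau * diam (cell j).

(* The domains differ only within distance C h of the boundary of Omega. *)
Definition approximates (C : R) T (Omega : set E) : Prop :=
  forall x, (polyhedron T `\` Omega) x \/ (Omega `\` polyhedron T) x ->
  exists2 y, bdry Omega y & enorm (x - y) <= C * meshsize T.

Definition image_domain T M : set E := M @` polyhedron T.
Definition inv_map T M : E -> E := 'pinv_(fun=> 0) (polyhedron T) M.

(* Jacobians are taken element by element, on the open cells [ocell j] and their
   images; the values of M outside the closed polyhedron are irrelevant.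
   ['J M x] is the transpose of the usual Jacobian matrix, as the library's
   differentials act on row vectors from the right. M is one-to-one as a map on
   the mesh, that is, on the union of the closed tetrahedra. *)
Record mesh_map (k : nat) (C delta : R) T M : Prop := MeshMap {
  mesh_map_cont : {within closed_polyhedron T, continuous M} ;
  mesh_map_poly : forall (j : 'I_(ncells T)) (l : 'I_3),
    poly_on (cell j) k (fun x => M x 0 l) ;
  mesh_map_inj : {in closed_polyhedron T &, injective M} ;
  mesh_map_jac : forall (j : 'I_(ncells T)) (a b : 'I_3),
    Wkoo_le (ocell j) k C (fun x => 'J M x a b) ;
  mesh_map_jac_inv : forall (j : 'I_(ncells T)) (a b : 'I_3),
    Wkoo_le (M @` ocell j) k C (fun y => 'J (inv_map T M) y a b) ;
  mesh_map_jac_id : forall (j : 'I_(ncells T)) (a b : 'I_3),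
    ae_on (ocell j) (fun x => `|('J M x - 1%:M) a b| <= C * meshsize T) ;
  mesh_map_det : forall (j : 'I_(ncells T)) (x : E),
    ocell j x -> delta <= \det ('J M x) }.

Definition Dhat (m : nat) T : set (E -> E) :=
  [set d | Hdiv (polyhedron T) d /\
    forall (j : 'I_(ncells T)) (l : 'I_3), poly_on (ocell j) m (fun x => d x 0 l)].

Definition Shat (m : nat) T : set (E -> R) :=
  [set phi | L2 (polyhedron T) phi /\
    forall j : 'I_(ncells T), poly_on (ocell j) m phi].

(* The Piola transform; the row vector [d *m 'J M x] is J_M d in column form. *)
Definition piola M (d : E -> E) (x : E) : E :=
  (\det ('J M x))^-1 *: (d x *m 'J M x).

Definition Dh (m : nat) T M : set (E -> E) :=
  [set d | (forall l : 'I_3, measurable_on (image_domain T M) (fun y => d y 0 l)) /\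
    exists2 dhat, Dhat m T dhat &
      ae_on (image_domain T M) (fun y => d y = piola M dhat (inv_map T M y))].

Definition Sh (m : nat) T M : set (E -> R) :=
  [set phi | measurable_on (image_domain T M) phi /\
    exists2 phihat, Shat m T phihat &
      ae_on (image_domain T M) (fun y => phi y = phihat (inv_map T M y))].

End Mesh.
Arguments tetmesh : clear implicits.

(* Main.v *)
Require Import Defs.
From HB Require Import structures.
From mathcomp Require Import all_boot all_order all_algebra.
From mathcomp Require Import perm.
From mathcomp Require Import ring lra.
From mathcomp Require Import all_classical all_reals all_analysis.
From mathcomp Require Import measurable_realfun.
From mathcomp Require mpoly.
Import Order.TTheory GRing.Theory Num.Theory.
Import numFieldNormedType.Exports.

Set Implicit Arguments.
Unset Strict Implicit.
Unset Printing Implicit Defensive.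

Local Open Scope classical_set_scope.
Local Open Scope ring_scope.

(** Let [dhat] be a field on the straight mesh with divergence [ghat], and let [phihat] be
    transported to phi. The Piola transform of [dhat] has divergence ghat / det J carried over by
    [M], so the determinant cancels the Jacobian of the change of variables and the pairing of phi
    with the divergence equals that of [phihat] with [ghat] ([is_div_pushv], [pushdiv_pairing]). The
    bound on the entries of J and the lower bound [delta] on det J give norm(d) <= s1 * norm(dhat)
    and norm(phi) <= s2 * norm(phihat), with s1, s2 depending on [C] and [delta] only
    ([pushv_norm_le], [L2norm_pull_le]). A field [dhat] whose quotient exceeds half of the lower
    bound known on the straight mesh therefore has an image whose quotient is at least beta4 / (2 *
    s1 * s2) * norm(phi) ([inf_sup_transfer]).

    Two analytic facts carry this. The first is the change of variables formula for [M] on the union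
    of the open cells ([measure_change], [ge0_integral_change], [Rintegral_change]). The measures A
    -> volume of M(A) and A -> integral of det J over A are compared on small boxes, where [M] is
    almost affine ([local_sandwich]); bisection spreads the comparison to all boxes
    ([box_le_bisect]) and uniqueness of measures to all Borel sets. The rest of the mesh is
    negligible: boundaries of simplices are null ([simplex_boundary_null]), and so are their
    Lipschitz images ([lipschitz_image_null]).

    The second is that the Piola transform really has the stated distributional divergence. A test
    function on the curved domain, composed with [M], is only Lipschitz, with kinks across the
    faces, so it is no admissible test function for [dhat]. The divergence identity is extended to
    such functions by mollification and Fubini ([weak_div_lipschitz], [pull_div]); the square of the
    test function itself serves as mollifier. *)

(** * Lebesgue measure on triples and its determination by boxes *)

(*@@P1*)
Section Triples.
Context {R : realType}.
Local Notation E := 'rV[R]_3.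
Local Notation R' := (measurableTypeR R).
Local Notation T3 := (R' * R' * R')%type.

Definition mu3 : set T3 -> \bar R :=
  ((@lebesgue_measure R \x @lebesgue_measure R) \x @lebesgue_measure R)%E.
HB.instance Definition _ := Measure.on mu3.

Lemma integral3E (A : set E) (f : E -> R) :
  integral3 A f = \int[mu3]_(p in pt3 @^-1` A) f (pt3 p).
Proof. by []. Qed.

Lemma ae_onE (A : set E) (P : E -> Prop) :
  ae_on A P = \forall p \ae mu3, A (pt3 p) -> P (pt3 p).
Proof. by []. Qed.

Lemma L2E (A : set E) (f : E -> R) : L2 A f = (measurable_on A f /\
  (\int[mu3]_(p in pt3 @^-1` A) ((f (pt3 p)) ^+ 2)%:E < +oo)%E).
Proof. by []. Qed.

Definition unpt3 (x : E) : T3 := (x 0 0, x 0 1, x 0 2).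

Lemma ord3P (P : 'I_3 -> Prop) : P 0 -> P 1 -> P 2 -> forall i, P i.
Proof.
move=> P0 P1 P2 [[|[|[|//]]] hi].
- by rewrite (_ : Ordinal hi = 0) //; apply: val_inj.
- by rewrite (_ : Ordinal hi = 1) //; apply: val_inj.
- by rewrite (_ : Ordinal hi = 2) //; apply: val_inj.
Qed.

Lemma sum_ord3 (V : nmodType) (f : 'I_3 -> V) : \sum_i f i = f 0 + f 1 + f 2.
Proof.
rewrite !big_ord_recr big_ord0 /= add0r.
by congr (f _ + f _ + f _); apply: val_inj.
Qed.

Lemma prod_ord3 (f : 'I_3 -> R) : \prod_i f i = f 0 * f 1 * f 2.
Proof.
rewrite !big_ord_recr big_ord0 /= mul1r.
by congr (f _ * f _ * f _); apply: val_inj.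
Qed.

Lemma pt3_coord (p : T3) :
  (pt3 p 0 0 = p.1.1) * (pt3 p 0 1 = p.1.2) * (pt3 p 0 2 = p.2).
Proof. by rewrite /pt3 !mxE. Qed.

Lemma pt3K : cancel pt3 unpt3.
Proof. by move=> [[a b] c]; rewrite /unpt3 !pt3_coord. Qed.

Lemma unpt3K : cancel unpt3 pt3.
Proof.
by move=> x; apply/rowP; apply: ord3P; rewrite ?pt3_coord.
Qed.

Lemma measurable_coord (j : 'I_3) : measurable_fun setT (fun p : T3 => pt3 p 0 j).
Proof.
move: j; apply: ord3P.
- rewrite (_ : (fun _ => _) = fst \o fst); last first.
    by apply/funext=> p; rewrite pt3_coord.
  exact: measurableT_comp.
- rewrite (_ : (fun _ => _) = snd \o fst); last first.
    by apply/funext=> p; rewrite pt3_coord.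
  exact: measurableT_comp.
- rewrite (_ : (fun _ => _) = snd) //.
  by apply/funext=> p; rewrite pt3_coord.
Qed.

Lemma measurable_unpt3 d (T : measurableType d) (f : T -> E) :
  (forall j, measurable_fun setT (fun x => f x 0 j : R')) ->
  measurable_fun setT (unpt3 \o f).
Proof.
move=> mf; apply: measurable_fun_pair; last exact: (mf 2).
by apply: measurable_fun_pair; [exact: (mf 0)|exact: (mf 1)].
Qed.

(** Half-open, so that cutting a box yields two disjoint boxes and boxes are stable under
    intersection. *)
Definition box (a b : E) : set T3 :=
  [set p | forall j, a 0 j < pt3 p 0 j <= b 0 j].

Lemma boxE (a b : E) : box a b =
  (`]a 0 0, b 0 0] `*` `]a 0 1, b 0 1]) `*` `]a 0 2, b 0 2].
Proof.
apply/seteqP; split=> [p abp|p [[/= p0 p1] p2]].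
  by split; [split|] => /=; rewrite in_itv /=;
    [have := abp 0|have := abp 1|have := abp 2]; rewrite pt3_coord.
by apply: ord3P; rewrite pt3_coord; move: p0 p1 p2; rewrite !in_itv.
Qed.

Lemma measurable_box (a b : E) : measurable (box a b).
Proof. by rewrite boxE; apply: measurableX => //; exact: measurableX. Qed.

Lemma mu3_box (a b : E) : (forall j, a 0 j <= b 0 j) ->
  mu3 (box a b) = (\prod_j (b 0 j - a 0 j))%:E.
Proof.
move=> ab; rewrite boxE [LHS](product_measure1E _ lebesgue_measure) //; last first.
  exact: measurableX.
rewrite [X in (X * _)%E](product_measure1E lebesgue_measure lebesgue_measure) //.
rewrite /= !lebesgue_measure_itv /= !lte_fin.
have H j : (if a 0 j < b 0 j then ((b 0 j)%:E - (a 0 j)%:E)%E else 0%E) =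
    (b 0 j - a 0 j)%:E.
  case: ifPn => //; rewrite -leNgt => ba.
  by rewrite (le_anti (introT andP (conj ba (ab j)))) subrr.
by rewrite prod_ord3 !H -!EFinM.
Qed.

(** Corners are combined by maxima and minima. The bounds by the second box serve to keep the
    corresponding closed box inside an open set that contains the second closed box. *)
Lemma boxI (a b a' b' : E) : exists c d, box a b `&` box a' b' = box c d /\
  forall j, a' 0 j <= c 0 j /\ d 0 j <= b' 0 j.
Proof.
exists (\row_j Num.max (a 0 j) (a' 0 j)), (\row_j Num.min (b 0 j) (b' 0 j)).
split; last by move=> j; rewrite !mxE le_max ge_min !lexx !orbT.
apply/seteqP; split=> [p [h h'] j|p h].
  move: (h j) (h' j); move: (pt3 p) => x; rewrite !mxE gt_max le_min.
  by move=> /andP[-> ->] /andP[-> ->].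
split=> j; move: (h j); move: (pt3 p) => x; rewrite !mxE gt_max le_min;
by move=> /andP[/andP[h1 h2] /andP[h3 h4]]; rewrite ?h1 ?h2 ?h3 ?h4.
Qed.

Definition boxes : set (set T3) := [set B | exists a b, B = box a b].

Let cub (n : nat) : set T3 := box (const_mx (- n%:R)) (const_mx n%:R).

Lemma cub_cover : \bigcup_n cub n = setT.
Proof.
apply/seteqP; split=> // p _.
pose m := \big[Num.max/0]_(j < 3) `|pt3 p 0 j|.
exists (Num.truncn m).+1 => // j.
have h : `|pt3 p 0 j| < (Num.truncn m).+1%:R.
  by apply: le_lt_trans (truncnS_gt m); rewrite /m; exact: le_bigmax.
by move: h; move: (pt3 p) => x; rewrite !mxE ltr_norml => /andP[-> /ltW ->].
Qed.

(** In the sigma-algebra generated by boxes each coordinate is measurable, because a slab is the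
    union of boxes whose other sides grow; hence so is the identity onto the product structure. *)
Lemma boxes_generate : <<s boxes >> = (@measurable _ T3).
Proof.
apply/seteqP; split.
  apply: smallest_sub; first exact: sigma_algebra_measurable.
  by move=> _ [a [b ->]]; exact: measurable_box.
pose GT := g_sigma_algebraType boxes.
have mbox a b : @measurable _ GT (box a b).
  by apply: sub_sigma_algebra; exists a, b.
have mc (j : 'I_3) : measurable_fun setT (fun p : GT => pt3 p 0 j : R').
  apply: (@measurability _ _ GT R' setT _ (@ocitv R)) => //.
  move=> _ [_ [[u v] /= _ <-] <-]; rewrite setTI.
  rewrite [X in measurable X](_ : _ = \bigcup_n
    box (\row_i if i == j then u else - n%:R)
        (\row_i if i == j then v else n%:R)); first exact: bigcupT_measurable.
  apply/seteqP; split=> [p|p [n _ /(_ j)]] /=; last first.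
    by move: (pt3 p) => x; rewrite !mxE eqxx in_itv.
  rewrite in_itv /= => uv; have [n _ hn] : (\bigcup_n cub n) p by rewrite cub_cover.
  exists n => // i; move: (hn i) uv; move: (pt3 p) => x; rewrite !mxE.
  by case: eqVneq => [->|].
have mid : measurable_fun setT (id : GT -> T3).
  have -> : (id : GT -> T3) = unpt3 \o (pt3 : GT -> E).
    by apply/funext=> p /=; rewrite pt3K.
  exact: measurable_unpt3.
by move=> A mA; have := mid measurableT _ mA; rewrite setTI.
Qed.

(** Boxes form a generating pi-system, and the growing cubes [cub] exhaust the space with finite
    measure. *)
Lemma box_measure_unique (m1 m2 : {measure set T3 -> \bar R}) :
  (forall a b, m1 (box a b) = m2 (box a b)) ->
  (forall a b, m1 (box a b) < +oo)%E ->
  forall A, measurable A -> m1 A = m2 A.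
Proof.
move=> m12 m1oo A mA; apply: (measure_unique boxes cub) => //.
- by rewrite boxes_generate.
- move=> _ _ [a [b ->]] [a' [b' ->]].
  by have [c [d [-> _]]] := boxI a b a' b'; exists c, d.
- by move=> n; exists (const_mx (- n%:R)), (const_mx n%:R).
- exact: cub_cover.
- by move=> _ [a [b ->]].
- by move=> n; exact: m1oo.
Qed.

Lemma mu3_box_lty (a b : E) : (mu3 (box a b) < +oo)%E.
Proof.
case: (pselect (forall j, a 0 j <= b 0 j)) => [ab|].
  by rewrite mu3_box // ltry.
move/existsNP => [j /negP]; rewrite -ltNge => ba.
rewrite (_ : box a b = set0) ?measure0 //; apply/seteqP; split=> // p /(_ j).
by move=> /andP[/lt_le_trans h /h]; rewrite ltNge (ltW ba).
Qed.

Lemma mu3_sigma_finite : sigma_finite setT mu3.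
Proof.
exists cub; first by rewrite cub_cover.
by move=> n; split; [exact: measurable_box|exact: mu3_box_lty].
Qed.
HB.instance Definition _ := Measure_isSigmaFinite.Build _ _ _ mu3
  mu3_sigma_finite.

(* The sup norm makes the closed balls of 'rV[R]_3 cubes. *)
Lemma normr_rV_le (x : E) r : 0 <= r -> (`|x| <= r) <-> forall j, `|x 0 j| <= r.
Proof.
move=> r0; split=> [xr j|xr].
  rewrite (le_trans _ xr) //; rewrite [leRHS]mx_normrE.
  exact: (le_bigmax _ (fun ij => `|x ij.1 ij.2|) (0, j)).
rewrite [leLHS]mx_normrE; apply/bigmax_leP; split=> // -[i j] _ /=.
by rewrite ord1.
Qed.

Lemma normr_rV_lt (x : E) r : 0 < r -> (`|x| < r) <-> forall j, `|x 0 j| < r.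
Proof.
move=> r0; split=> [xr j|xr].
  rewrite (le_lt_trans _ xr) //; rewrite [leRHS]mx_normrE.
  exact: (le_bigmax _ (fun ij => `|x ij.1 ij.2|) (0, j)).
rewrite [ltLHS]mx_normrE; apply/bigmax_ltP; split=> // -[i j] _ /=.
by rewrite ord1.
Qed.

Lemma le_coord_norm (x : E) j : `|x 0 j| <= `|x|.
Proof. by move: j; apply/normr_rV_le. Qed.

End Triples.

(** * Image measures, affine maps of the line and skew products *)

(*@@P2*)
Definition pushm d1 d2 (T1 : measurableType d1) (T2 : measurableType d2)
    (R : realType) (m : {measure set T1 -> \bar R}) (f : T1 -> T2)
    (mf : measurable_fun setT f) : {measure set T2 -> \bar R} :=
  measure_function_pushforward__canonical__measure_function_Measure m mf.

Lemma ge0_integral_pushm d1 d2 (T1 : measurableType d1) (T2 : measurableType d2)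
    (R : realType) (m : {measure set T1 -> \bar R}) (f : T1 -> T2)
    (mf : measurable_fun setT f) (D : set T2) (h : T2 -> \bar R) :
  measurable D -> measurable_fun D h -> (forall y, D y -> 0 <= h y)%E ->
  (\int[pushm m mf]_(y in D) h y = \int[m]_(x in f @^-1` D) h (f x))%E.
Proof.
move=> mD mh h0; apply: ge0_integral_pushforward => // y.
by rewrite inE; exact: h0.
Qed.

Section LinearChange.
Context {R : realType}.
Local Notation E := 'rV[R]_3.
Local Notation R' := (measurableTypeR R).
Local Notation T3 := (R' * R' * R')%type.
Local Notation lam := (@lebesgue_measure R).

Lemma measurable_affine (c t : R) : measurable_fun setT (fun y : R' => c * y + t : R').
Proof. by apply: measurable_funD => //; exact: measurable_funM. Qed.

(** The image measure multiplied by [|c|] gives every half-open interval its length, so it is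
    Lebesgue measure. *)
Lemma lebesgue_measure_affine (c t : R) (A : set R') : c != 0 -> measurable A ->
  (lam ((fun y : R' => (c * y + t : R')%R) @^-1` A) * `|c|%:E = lam A)%E.
Proof.
move=> c0 mA; have mf := measurable_affine c t.
pose f := (fun y : R' => (c * y + t : R')%R).
pose m' : {measure set R' -> \bar R} :=
  mscale (NngNum (normr_ge0 c)) (pushm lam mf).
have m'E B : m' B = (lam (f @^-1` B) * `|c|%:E)%E by rewrite muleC.
rewrite -m'E; apply/esym; apply: (@lebesgue_measure_unique R m' _ A mA) => _ [[a b] _ <-].
rewrite m'E.
have [c_gt0|c_le0] := ltP 0 c.
  have -> : f @^-1` `]a, b] = `](a - t) / c, (b - t) / c]%classic.
    apply/seteqP; split=> y /=; rewrite !in_itv /= ltr_pdivrMr // ler_pdivlMr //;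
    by rewrite ltrBlDr lerBrDr mulrC.
  rewrite !lebesgue_measure_itv /= !lte_fin ltr_pM2r ?invr_gt0 // ltrD2r.
  case: ifP => _; last by rewrite mul0e.
  by rewrite -EFinM gtr0_norm // -!EFinB; congr EFin; field.
have c_lt0 : c < 0 by rewrite lt_neqAle c0.
(* A negative slope exchanges the open and the closed end, which does not affect the length. *)
have -> : f @^-1` `]a, b] = `[(b - t) / c, (a - t) / c[%classic.
  apply/seteqP; split=> y /=; rewrite !in_itv /= ler_ndivrMr // ltr_ndivlMr //;
  by rewrite ltrBlDr lerBrDr mulrC andbC.
rewrite !lebesgue_measure_itv /= !lte_fin ltr_nM2r ?invr_lt0 // ltrD2r.
case: ifP => _; last by rewrite mul0e.
by rewrite -EFinM ltr0_norm // -!EFinB; congr EFin; field.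
Qed.

End LinearChange.

Section Skew.
Context d1 d2 (T1 : measurableType d1) (T2 : measurableType d2) (R : realType).
Variables (m1 : {measure set T1 -> \bar R}) (m2 : {sigma_finite_measure set T2 -> \bar R}).

(** Sections of the preimage are preimages under [g x], whose scaling factor [c2] is the same for
    all x; the remaining outer integral is an integral against the image measure under [f]. *)
Lemma product_measure_skew (f : T1 -> T1) (g : T1 -> T2 -> T2) (c1 c2 : R) :
  0 <= c1 -> 0 <= c2 ->
  measurable_fun setT f -> measurable_fun setT (fun p : T1 * T2 => g p.1 p.2) ->
  (forall A, measurable A -> m1 (f @^-1` A) * c1%:E = m1 A)%E ->
  (forall x A, measurable A -> m2 (g x @^-1` A) * c2%:E = m2 A)%E ->
  forall B, measurable B ->
  ((m1 \x m2) ((fun p : T1 * T2 => (f p.1, g p.1 p.2)) @^-1` B) * (c1 * c2)%:E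
    = (m1 \x m2) B)%E.
Proof.
move=> c10 c20 mf mg fE gE B mB.
pose F := (fun p : T1 * T2 => (f p.1, g p.1 p.2)).
have mF : measurable_fun setT F.
  by apply: measurable_fun_pair => //; exact: measurableT_comp.
have mFB : measurable (F @^-1` B).
  by rewrite -[_ @^-1` _]setTI; exact: mF.
have mh : measurable_fun setT (m2 \o xsection B) by exact: measurable_fun_xsection.
rewrite EFinM (muleC c1%:E) muleA /product_measure1.
rewrite -ge0_integralZr //; last exact: measurable_fun_xsection.
rewrite (eq_integral (fun x => (m2 \o xsection B) (f x))); last first.
  move=> x _; rewrite /= -(gE x (xsection B (f x))); last exact: measurable_xsection.
  congr (m2 _ * _)%E.
transitivity ((\int[pushm m1 mf]_y (m2 \o xsection B) y) * c1%:E)%E.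
  by rewrite ge0_integral_pushm.
rewrite muleC -(ge0_integral_mscale (pushm m1 mf) measurableT (NngNum c10)) //=.
apply: eq_measure_integral => A mA _ /=.
by rewrite -fE // muleC.
Qed.

End Skew.

(** * Linear and affine change of variables in three dimensions *)

(*@@P3*)
Section Linear3.
Context {R : realType}.
Local Notation E := 'rV[R]_3.
Local Notation R' := (measurableTypeR R).
Local Notation T3 := (R' * R' * R')%type.
Local Notation lam := (@lebesgue_measure R).
Local Notation mu3 := (@mu3 R).

Definition mulp (A : 'M[R]_3) (p : T3) : T3 := unpt3 (pt3 p *m A).

Lemma measurable_mulp A : measurable_fun setT (mulp A).
Proof.
apply: measurable_unpt3 => j.
rewrite (_ : (fun _ => _) = (fun p => \sum_i pt3 p 0 i * A i j)); last first.
  by apply/funext => p; rewrite mxE.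
apply: measurable_sum => i; apply: measurable_funM => //.
exact: measurable_coord.
Qed.

Definition linscale (A : 'M[R]_3) := forall B : set T3, measurable B ->
  (mu3 (mulp A @^-1` B) * `|\det A|%:E = mu3 B)%E.

Lemma linscaleM A A' : linscale A -> linscale A' -> linscale (A *m A').
Proof.
move=> hA hA' B mB; rewrite det_mulmx normrM EFinM muleA.
have -> : mulp (A *m A') @^-1` B = mulp A @^-1` (mulp A' @^-1` B).
  by apply/seteqP; split=> p; rewrite /= /mulp unpt3K mulmxA.
have mB' : measurable (mulp A' @^-1` B).
  by rewrite -[_ @^-1` _]setTI; exact: measurable_mulp.
by rewrite (hA _ mB') hA'.
Qed.

Lemma box_set0 (a b : E) : ~ (forall j, a 0 j <= b 0 j) -> box a b = set0.
Proof.
move/existsNP => [j /negP]; rewrite -ltNge => ba.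
apply/seteqP; split=> // p /(_ j).
by move=> /andP[/lt_le_trans h /h]; rewrite ltNge (ltW ba).
Qed.

(** A permutation of coordinates turns a box into the box with permuted sides, and the product of
    the side lengths is unchanged. *)
Lemma linscale_perm (s : 'S_3) : linscale (perm_mx s).
Proof.
move=> B mB; rewrite det_perm normr_sign mule1.
have mf := measurable_mulp (perm_mx s).
pose c (a : E) : E := \row_j a 0 (s j).
have colp (x : E) i : (x *m perm_mx s) 0 i = x 0 (s^-1 i)%g.
  by rewrite -[s in LHS]invgK -col_permE mxE.
have boxP a b : mulp (perm_mx s) @^-1` box a b = box (c a) (c b).
  apply/seteqP; split=> p h j.
    move: (h (s j)); rewrite /mulp unpt3K colp permK; move: (pt3 p) => x.
    by rewrite !mxE.
  move: (h (s^-1 j)%g); rewrite /mulp unpt3K colp; move: (pt3 p) => x.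
  by rewrite !mxE permKV.
have -> : mu3 (mulp (perm_mx s) @^-1` B) = pushm mu3 mf B by [].
have m1E a b : pushm mu3 mf (box a b) = mu3 (box (c a) (c b)) by rewrite -boxP.
move: (pushm mu3 mf) m1E => m1 m1E.
apply: (@box_measure_unique R m1 mu3 _ _ B mB) => a b; last by rewrite m1E; exact: mu3_box_lty.
rewrite m1E; case: (pselect (forall j, a 0 j <= b 0 j)) => ab.
  have cab k : c a 0 k <= c b 0 k by rewrite !mxE.
  rewrite [LHS](mu3_box cab) [RHS](mu3_box ab); congr EFin.
  rewrite [RHS](reindex_inj (@perm_inj _ s)).
  by apply: eq_bigr => k _; rewrite !mxE.
rewrite !box_set0 // => h; apply: ab => j.
by have := h (s^-1 j)%g; rewrite !mxE permKV.
Qed.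

(** Acting on row vectors from the right, an upper triangular matrix sends each coordinate to a
    multiple of itself plus a shift by the earlier coordinates: two nested skew products. *)
Lemma linscale_upper (U : 'M[R]_3) : U 1 0 = 0 -> U 2 0 = 0 -> U 2 1 = 0 ->
  U 0 0 != 0 -> U 1 1 != 0 -> U 2 2 != 0 -> linscale U.
Proof.
move=> U10 U20 U21 U00 U11 U22 B mB.
have -> : `|\det U| = (`|U 0 0| * `|U 1 1|) * `|U 2 2|.
  rewrite -det_tr det_trig; first by rewrite prod_ord3 !mxE !normrM.
  apply/is_trig_mxP; apply: ord3P => [i|i|i] hi; rewrite mxE; last first.
  - by case: i hi => [[|[|[]]]].
  - by move: i hi; apply: ord3P.
  - by move: i hi; apply: ord3P.
pose f1 (x : R') : R' := U 0 0 * x + 0.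
pose g1 (x y : R') : R' := U 1 1 * y + x * U 0 1.
pose f2 (p : R' * R') : R' * R' := (f1 p.1, g1 p.1 p.2).
pose g2 (p : R' * R') (z : R') : R' := U 2 2 * z + (p.1 * U 0 2 + p.2 * U 1 2).
have -> : mulp U = (fun p => (f2 p.1, g2 p.1 p.2)).
  apply/funext => -[[x y] z]; rewrite /mulp /unpt3 /f2 /g2 /f1 /g1 /= !mxE.
  rewrite !sum_ord3 !pt3_coord /= U10 U20 U21.
  by congr (_, _, _); ring.
have mf1 : measurable_fun setT f1 by exact: measurable_affine.
have mg1 : measurable_fun setT (fun p : R' * R' => g1 p.1 p.2).
  by apply: measurable_funD; exact: measurable_funM.
have mf2 : measurable_fun setT f2.
  by apply: measurable_fun_pair => //; exact: measurableT_comp.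
apply: (@product_measure_skew _ _ _ _ R _ _ f2 g2) => //.
- apply: measurable_funD; first exact: measurable_funM.
  by apply: measurable_funD; apply: measurable_funM => //; exact: measurableT_comp.
- move=> A mA; apply: (@product_measure_skew _ _ _ _ R _ _ f1 g1) => //.
    by move=> A' mA'; exact: lebesgue_measure_affine.
  by move=> x A' mA'; exact: lebesgue_measure_affine.
- by move=> x A' mA'; exact: lebesgue_measure_affine.
Qed.

(** By the LUP decomposition the matrix is a product of a permutation, a lower and an upper
    triangular factor. Conjugation by the order-reversing permutation [w] makes the lower factor
    upper triangular. *)
Lemma linscale_unit (A : 'M[R]_3) : A \in unitmx -> linscale A.
Proof.
move=> uA; have dA : \det A != 0 by rewrite -unitfE.
pose w : 'S_3 := perm (@rev_ord_inj 3).
have ww : (w * w = 1)%g by apply/permP => i; rewrite permM !permE /= rev_ordK.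
case: (cormen_lup A) (cormen_lup_correct A) (cormen_lup_perm A)
  (cormen_lup_detL A) (@cormen_lup_lower _ _ A) (@cormen_lup_upper _ _ A).
move=> [P L] U /= PALU /is_perm_mxP[s Ps] dL hL hU.
set W : 'M[R]_3 := perm_mx w.
have WW : W *m W = 1%:M by rewrite -perm_mxM ww perm_mx1.
have -> : A = perm_mx s^-1 *m (W *m (W *m L *m W) *m W) *m U.
  have -> : W *m (W *m L *m W) *m W = L.
    by rewrite -mulmxA -mulmxA WW mulmx1 mulmxA WW mul1mx.
  rewrite -mulmxA -[L *m U]PALU Ps -[perm_mx s * A]/(perm_mx s *m A).
  by rewrite mulmxA -perm_mxM mulVg perm_mx1 mul1mx.
have dU : \det U != 0.
  have : \det (P * A) = \det (L * U) by rewrite PALU.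
  rewrite -[P * A]/(P *m A) -[L * U]/(L *m U) !det_mulmx dL mul1r => <-.
  by rewrite mulf_neq0 // Ps det_perm signr_eq0.
have dUE : \det U = U 0 0 * U 1 1 * U 2 2.
  rewrite -det_tr det_trig; first by rewrite prod_ord3 !mxE.
  by apply/is_trig_mxP => i j ij; rewrite mxE hU.
move: dU; rewrite dUE !mulf_eq0 !negb_or => /andP[/andP[U00 U11] U22].
apply: linscaleM; last by apply: linscale_upper => //; exact: hU.
apply: linscaleM; first exact: linscale_perm.
apply: linscaleM; last exact: linscale_perm.
apply: linscaleM; first exact: linscale_perm.
have wV : (w^-1 = w)%g by rewrite -[LHS]mulg1 -ww mulKg.
have WLW i j : (W *m L *m W) i j = L (rev_ord i) (rev_ord j).
  by rewrite -row_permE /W -wV -col_permE !mxE wV !permE.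
by apply: linscale_upper; rewrite WLW hL ?eqxx ?oner_neq0.
Qed.

Definition transp (v : E) (p : T3) : T3 := unpt3 (pt3 p + v).

Lemma measurable_transp v : measurable_fun setT (transp v).
Proof.
apply: measurable_unpt3 => j.
rewrite (_ : (fun _ => _) = (fun p => pt3 p 0 j + v 0 j)); last first.
  by apply/funext => p; rewrite mxE.
by apply: measurable_funD => //; exact: measurable_coord.
Qed.

Lemma mu3_trans v (B : set T3) : measurable B -> mu3 (transp v @^-1` B) = mu3 B.
Proof.
move=> mB; have mf := measurable_transp v.
have boxP a b : transp v @^-1` box a b = box (a - v) (b - v).
  apply/seteqP; split=> p h j; move: (h j); rewrite /transp unpt3K;
  move: (pt3 p) => x; rewrite !mxE; by rewrite ltrBlDr lerBrDr.
have -> : mu3 (transp v @^-1` B) = pushm mu3 mf B by [].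
have m1E a b : pushm mu3 mf (box a b) = mu3 (box (a - v) (b - v)) by rewrite -boxP.
move: (pushm mu3 mf) m1E => m1 m1E.
apply: (@box_measure_unique R m1 mu3 _ _ B mB) => a b; last first.
  by rewrite m1E; exact: mu3_box_lty.
rewrite m1E; case: (pselect (forall j, a 0 j <= b 0 j)) => ab.
  have cab k : (a - v) 0 k <= (b - v) 0 k by rewrite !mxE lerD2r.
  rewrite [LHS](mu3_box cab) [RHS](mu3_box ab); congr EFin.
  by apply: eq_bigr => k _; rewrite !mxE opprB addrA subrK.
rewrite !box_set0 // => h; apply: ab => j.
by have := h j; rewrite !mxE lerD2r.
Qed.

Lemma mu3_affine (A : 'M[R]_3) (v : E) (B : set T3) : A \in unitmx -> measurable B ->
  (mu3 ((fun p => unpt3 ((pt3 p + v) *m A)) @^-1` B) * `|\det A|%:E = mu3 B)%E.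
Proof.
move=> uA mB; have mB' : measurable (mulp A @^-1` B).
  by rewrite -[_ @^-1` _]setTI; exact: measurable_mulp.
rewrite -(linscale_unit uA mB) -(mu3_trans v mB').
suff -> : (fun p => unpt3 ((pt3 p + v) *m A)) @^-1` B = transp v @^-1` (mulp A @^-1` B).
  by [].
by apply/seteqP; split=> p; rewrite /= /mulp /transp unpt3K.
Qed.

End Linear3.

(** * Open sets as countable unions of boxes *)

(*@@P4*)
Section OpenSets.
Context {R : realType}.
Local Notation E := 'rV[R]_3.
Local Notation R' := (measurableTypeR R).
Local Notation T3 := (R' * R' * R')%type.

Definition cbox (a b : E) : set E := [set x | forall j, a 0 j <= x 0 j <= b 0 j].

Lemma rat_approx (x e : R) : 0 < e -> exists q : rat, ratr q < x < ratr q + e.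
Proof.
move=> e0; have xe : x - e < x by rewrite ltrBlDr ltrDl.
have [q] := rat_in_itvoo xe; rewrite in_itv /= => /andP[h1 h2].
by exists q; rewrite h2 -ltrBlDr.
Qed.

Lemma unpickle_surj (T : countType) (i : T) : exists k, unpickle k = Some i.
Proof. by exists (pickle i); rewrite pickleK. Qed.

(** The boxes are cubes with rational lower corner and side 1 / (n + 1), enumerated by [unpickle];
    the empty set stands for codes that are void or whose cube leaves the set. Closed cubes are
    required to lie in [O] because a bisection may converge to a boundary point of the box. *)
Lemma open_box_cover (O : set E) : open O -> exists F : nat -> set T3,
  pt3 @^-1` O = \bigcup_n F n /\
  forall n, F n = set0 \/ exists a b : E, [/\ forall j, a 0 j < b 0 j,
    cbox a b `<=` O & F n = box a b].
Proof.
move=> oO.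
pose lo (i : rat * rat * rat * nat) : E :=
  \row_j [:: ratr i.1.1.1; ratr i.1.1.2; ratr i.1.2]`_j.
pose hi (i : rat * rat * rat * nat) : E := lo i + const_mx i.2.+1%:R^-1.
pose F n := if unpickle n is Some i then
  if `[< cbox (lo i) (hi i) `<=` O >] then box (lo i) (hi i) else set0 else set0.
exists F; split; last first.
  move=> n; rewrite /F; case: unpickle => [i|]; last by left.
  case: asboolP => h; last by left.
  right; exists (lo i), (hi i); split=> // j.
  by rewrite [ltRHS]mxE ltrDl mxE invr_gt0.
apply/seteqP; split; last first.
  move=> p [n _]; rewrite /F; case: unpickle => [i|//].
  case: asboolP => // h hp; apply: h => j; have /andP[h1 h2] := hp j.
  by rewrite (ltW h1).
move=> p Op; have [r /= r0 hr] := open_subball oO Op.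
have [n hn] : exists n, n.+1%:R^-1 < r / 2 :> R.
  exists (Num.truncn (r / 2)^-1).
  rewrite -[ltRHS]invrK ltf_pV2 ?posrE ?invr_gt0 ?divr_gt0 //.
  exact: truncnS_gt.
have n0 : 0 < n.+1%:R^-1 :> R by rewrite invr_gt0.
have [q0 hq0] := rat_approx (pt3 p 0 0) n0.
have [q1 hq1] := rat_approx (pt3 p 0 1) n0.
have [q2 hq2] := rat_approx (pt3 p 0 2) n0.
have h : forall j, lo (q0, q1, q2, n) 0 j < pt3 p 0 j < hi (q0, q1, q2, n) 0 j.
  by apply: ord3P; move: (pt3 p) hq0 hq1 hq2 => x; rewrite !mxE.
have [k uk] := unpickle_surj (q0, q1, q2, n).
exists k => //; rewrite /F uk asboolT; first by move=> j; have /andP[-> /ltW ->] := h j.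
move=> y hy; apply: (hr (r / 2)) => //=.
- by rewrite sub0r normrN gtr0_norm ?divr_gt0 // ltr_pdivrMr // mulr_natr mulr2n ltrDl.
- by rewrite divr_gt0.
rewrite -ball_normE /=; apply/normr_rV_lt; first by rewrite divr_gt0.
move=> j; have /andP[h1 h2] := h j; have /andP[h3 h4] := hy j.
have hlh : hi (q0, q1, q2, n) 0 j = lo (q0, q1, q2, n) 0 j + n.+1%:R^-1.
  by rewrite [LHS]mxE [in X in _ + X = _]mxE.
move: h1 h2 h3 h4 hn; rewrite hlh; move: (pt3 p) (lo _) (n.+1%:R^-1) => x l e h1 h2 h3 h4 hn.
by rewrite !mxE ltr_norml; apply/andP; split; lra.
Qed.

Lemma measurable_open (O : set E) : open O -> measurable (pt3 @^-1` O : set T3).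
Proof.
move=> /open_box_cover[F [-> hF]]; apply: bigcupT_measurable => n.
by case: (hF n) => [->//|[a [b [_ _ ->]]]]; exact: measurable_box.
Qed.

Lemma measurable_closed (O : set E) : closed O -> measurable (pt3 @^-1` O : set T3).
Proof.
move=> cO; rewrite -(setCK O) preimage_setC; apply: measurableC.
by apply: (@measurable_open (~` O)); rewrite openC.
Qed.

Lemma continuous_measurable_on (U : set E) (f : E -> R) :
  open U -> (forall x, U x -> {for x, continuous f}) -> measurable_on U f.
Proof.
move=> oU cf mU; apply: (measurability _ (RGenOpens.measurableE R)) => //.
move=> _ [_ [a [b ->] <-]].
have -> : pt3 @^-1` U `&` (f \o pt3) @^-1` `]a, b[ = pt3 @^-1` (U `&` f @^-1` `]a, b[).
  by [].
apply: measurable_open; rewrite openE => x [Ux fx].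
apply: filterI; first exact: open_nbhs_nbhs.
by apply: (cf x Ux); apply: open_nbhs_nbhs; split => //; exact: interval_open.
Qed.

End OpenSets.

(** * Strict differentiability *)

(*@@P5*)
Lemma nbhs_normP_lt (R : realType) (V : normedModType R) (x : V) (P : V -> Prop) : nbhs x P <->
  exists2 r, 0 < r & forall y, `|y - x| < r -> P y.
Proof.
split=> [/nbhs_ballP[r /= r0 hr]|[r r0 hr]].
  by exists r => // y yx; apply: hr; rewrite -ball_normE /= distrC.
by apply/nbhs_ballP; exists r => // y; rewrite -ball_normE /= distrC; exact: hr.
Qed.

Section StrictDiff.
Context {R : realType}.
Local Notation E := 'rV[R]_3.
Implicit Types (f : E -> R) (x y z g h : E) (M : E -> E).

Definition dot h g : R := \sum_i h 0 i * g 0 i.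

Lemma dotDr h g g' : dot h (g + g') = dot h g + dot h g'.
Proof. by rewrite -big_split; apply: eq_bigr => i _; rewrite mxE mulrDr. Qed.

Lemma dotBr h g g' : dot h (g - g') = dot h g - dot h g'.
Proof. by rewrite -sumrB; apply: eq_bigr => i _; rewrite !mxE mulrBr. Qed.

Lemma dotZr h g c : dot h (c *: g) = c * dot h g.
Proof. by rewrite mulr_sumr; apply: eq_bigr => i _; rewrite mxE mulrCA. Qed.

Lemma dotZl h g c : dot (c *: h) g = c * dot h g.
Proof. by rewrite mulr_sumr; apply: eq_bigr => i _; rewrite mxE mulrA. Qed.

Lemma dotBl h h' g : dot (h - h') g = dot h g - dot h' g.
Proof. by rewrite -sumrB; apply: eq_bigr => i _; rewrite !mxE mulrBl. Qed.

Lemma dot0r h : dot h 0 = 0.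
Proof. by apply: big1 => i _; rewrite mxE mulr0. Qed.

Lemma dot_dir (l : 'I_3) g : dot (dir l) g = g 0 l.
Proof.
rewrite /dot (bigD1 l) //= mxE !eqxx mul1r big1 ?addr0 // => i /negPf il.
by rewrite mxE andbC il mul0r.
Qed.

Lemma norm_dir (l : 'I_3) : `|dir l : E| = 1.
Proof.
apply/le_anti/andP; split.
  by apply/normr_rV_le => // j; rewrite mxE; case: (_ && _); rewrite ?normr1 ?normr0.
by have := le_coord_norm (dir l : E) l; rewrite mxE !eqxx normr1.
Qed.

Lemma le_dot h g : `|dot h g| <= 3 * `|h| * `|g|.
Proof.
rewrite (le_trans (ler_norm_sum _ _ _)) //.
have -> : 3 * `|h| * `|g| = \sum_(i < 3) `|h| * `|g|.
  by rewrite sumr_const card_ord -mulrA mulr_natl.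
by apply: ler_sum => i _; rewrite normrM ler_pM // le_coord_norm.
Qed.

(* Strict differentiability: the derivative is automatically continuous where
   it exists, and composition and products need no further regularity. *)
Definition sd f x g := forall e, 0 < e -> exists2 r, 0 < r &
  forall y z, `|y - x| < r -> `|z - x| < r ->
    `|f y - f z - dot (y - z) g| <= e * `|y - z|.

(** Matrices act on row vectors from the right, so the gradient of the component j is the column j
    of [J]. *)
Definition sdm M x (J : 'M[R]_3) :=
  forall j, sd (fun y => M y 0 j) x (\row_i J i j).

Lemma sd_cst c x : sd (cst c) x 0.
Proof.
move=> e e0; exists 1 => // y z _ _.
by rewrite dot0r !subrr normr0 mulr_ge0 // ltW.
Qed.

Lemma sd_coord j x : sd (fun y => y 0 j) x (dir j).
Proof.
move=> e e0; exists 1 => // y z _ _.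
suff -> : dot (y - z) (dir j) = y 0 j - z 0 j.
  by rewrite subrr normr0 mulr_ge0 // ltW.
rewrite /dot (bigD1 j) //= big1 ?addr0 => [|i /negPf ij].
  by rewrite !mxE !eqxx mulr1.
by rewrite [dir _ _ _]mxE ij andbF mulr0.
Qed.

Lemma sd_local f f' x g r : 0 < r -> (forall y, `|y - x| < r -> f y = f' y) ->
  sd f x g -> sd f' x g.
Proof.
move=> r0 ff' hf e e0; have [s s0 hs] := hf e e0.
exists (Num.min r s) => [|y z]; first by rewrite lt_min r0.
by rewrite !lt_min => /andP[yr ys] /andP[zr zs]; rewrite -!ff' //; exact: hs.
Qed.

Lemma sd_lip f x g : sd f x g -> exists2 r, 0 < r & forall y z,
  `|y - x| < r -> `|z - x| < r -> `|f y - f z| <= (1 + 3 * `|g|) * `|y - z|.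
Proof.
move=> /(_ 1 ltr01)[r r0 h]; exists r => // y z yx zx.
rewrite -[X in `|X|](subrK (dot (y - z) g)) (le_trans (ler_normD _ _)) //.
by rewrite mulrDl lerD ?h // (le_trans (le_dot _ _)) // mulrAC.
Qed.

Lemma sd_continuous f x g : sd f x g -> {for x, continuous f}.
Proof.
move=> /sd_lip[r r0 h] A /nbhs_normP_lt[e e0 hA].
set C := 1 + 3 * `|g| in h; have C0 : 0 < C by rewrite ltr_pwDl ?mulr_ge0.
apply/nbhs_normP_lt; exists (Num.min r (e / C)).
  by rewrite lt_min r0 divr_gt0.
move=> y; rewrite lt_min => /andP[yr ye]; apply: hA.
rewrite (le_lt_trans (h _ _ yr _)) ?subrr ?normr0 //.
by rewrite mulrC -ltr_pdivlMr.
Qed.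

Lemma sdD f f' x g g' : sd f x g -> sd f' x g' -> sd (fun y => f y + f' y) x (g + g').
Proof.
move=> hf hf' e e0; have e20 : 0 < e / 2 by rewrite divr_gt0.
have [r r0 hr] := hf _ e20; have [s s0 hs] := hf' _ e20.
exists (Num.min r s) => [|y z]; first by rewrite lt_min r0.
rewrite !lt_min => /andP[yr ys] /andP[zr zs].
have -> : f y + f' y - (f z + f' z) - dot (y - z) (g + g') =
  (f y - f z - dot (y - z) g) + (f' y - f' z - dot (y - z) g').
  by rewrite dotDr; ring.
rewrite (le_trans (ler_normD _ _)) // (splitr e) mulrDl.
by rewrite lerD // (hr, hs).
Qed.

Lemma sdM f f' x g g' : sd f x g -> sd f' x g' ->
  sd (fun y => f y * f' y) x (f x *: g' + f' x *: g).
Proof.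
move=> hf hf' e e0.
have [s1 s10 h1] := sd_lip hf; have [s2 s20 h2] := sd_lip hf'.
set L1 := 1 + 3 * `|g| in h1; set L2 := 1 + 3 * `|g'| in h2.
have L10 : 0 < L1 by rewrite ltr_pwDl ?mulr_ge0.
have L20 : 0 < L2 by rewrite ltr_pwDl ?mulr_ge0.
(* f y f' y - f z f' z - L = f y (f' y - f' z - g') + (f y - f x) g'
   + f' z (f y - f z - g) + (f' z - f' x) g *)
pose K := `|f x| + `|f' x| + L1 + L2 + 3 * `|g| + 3 * `|g'|.
have K0 : 0 < K.
  rewrite /K; have := normr_ge0 (f x); have := normr_ge0 (f' x); have := normr_ge0 g.
  by have := normr_ge0 g'; lra.
have eK : 0 < e / (4 * K) by rewrite divr_gt0 // mulr_gt0.
have [r1 r10 k1] := hf _ eK; have [r2 r20 k2] := hf' _ eK.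
(* The bound 1 keeps the values of both functions near the point below [K]; [e / (4 * K * K)] makes
   each term containing an increment from x at most a quarter of the error. *)
pose r := Num.min (Num.min (Num.min s1 s2) (Num.min r1 r2))
  (Num.min 1 (e / (4 * K * K))).
have r0 : 0 < r by rewrite /r !lt_min s10 s20 r10 r20 ltr01 divr_gt0 // !mulr_gt0.
exists r => // y z; rewrite /r !lt_min.
move=> /andP[/andP[/andP[y1 y2] /andP[y3 y4]] /andP[y5 y6]].
move=> /andP[/andP[/andP[z1 z2] /andP[z3 z4]] /andP[z5 z6]].
have xx a : 0 < a -> `|x - x| < a by rewrite subrr normr0.
have -> : f y * f' y - f z * f' z - dot (y - z) (f x *: g' + f' x *: g) =
  f y * (f' y - f' z - dot (y - z) g') + (f y - f x) * dot (y - z) g' +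
  f' z * (f y - f z - dot (y - z) g) + (f' z - f' x) * dot (y - z) g.
  by rewrite dotDr !dotZr; ring.
have fyx := h1 _ _ y1 (xx _ s10); have fzx := h2 _ _ z2 (xx _ s20).
have fy : `|f y| <= K.
  rewrite -[f y](subrK (f x)) (le_trans (ler_normD _ _)) //.
  rewrite (le_trans (lerD fyx (lexx _))) // /K.
  have : L1 * `|y - x| <= L1 by rewrite ler_piMr ?ltW.
  have := normr_ge0 (f' x); have := normr_ge0 g; have := normr_ge0 g'; lra.
have fz : `|f' z| <= K.
  rewrite -[f' z](subrK (f' x)) (le_trans (ler_normD _ _)) //.
  rewrite (le_trans (lerD fzx (lexx _))) // /K.
  have : L2 * `|z - x| <= L2 by rewrite ler_piMr ?ltW.
  have := normr_ge0 (f x); have := normr_ge0 g; have := normr_ge0 g'; lra.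
have nyz := normr_ge0 (y - z).
have b1 : `|f y * (f' y - f' z - dot (y - z) g')| <= e / 4 * `|y - z|.
  rewrite normrM (le_trans (ler_pM _ _ fy (k2 _ _ y4 z4))) //.
  by rewrite le_eqVlt; apply/orP; left; apply/eqP; field; rewrite gt_eqF.
have b3 : `|f' z * (f y - f z - dot (y - z) g)| <= e / 4 * `|y - z|.
  rewrite normrM (le_trans (ler_pM _ _ fz (k1 _ _ y3 z3))) //.
  by rewrite le_eqVlt; apply/orP; left; apply/eqP; field; rewrite gt_eqF.
have LK1 : L1 <= K.
  rewrite /K; have := normr_ge0 (f x); have := normr_ge0 (f' x); have := normr_ge0 g.
  by have := normr_ge0 g'; lra.
have LK2 : L2 <= K.
  rewrite /K; have := normr_ge0 (f x); have := normr_ge0 (f' x); have := normr_ge0 g.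
  by have := normr_ge0 g'; lra.
have gK1 : 3 * `|g| <= K by rewrite (le_trans _ LK1) // lerDr.
have gK2 : 3 * `|g'| <= K by rewrite (le_trans _ LK2) // lerDr.
have bd c (u : E) d : `|c| <= K * d -> 0 <= d -> d < e / (4 * K * K) -> 3 * `|u| <= K ->
    `|c * dot (y - z) u| <= e / 4 * `|y - z|.
  move=> hc d0 hd hu; rewrite normrM.
  have hd' : `|dot (y - z) u| <= K * `|y - z|.
    rewrite (le_trans (le_dot _ _)) // mulrAC ler_wpM2r //.
  rewrite (le_trans (ler_pM _ _ hc hd')) //.
  have -> : K * d * (K * `|y - z|) = (d * (K * K)) * `|y - z| by ring.
  rewrite ler_wpM2r // -ler_pdivlMr ?mulr_gt0 // (le_trans (ltW hd)) //.
  by rewrite le_eqVlt; apply/orP; left; apply/eqP; field; rewrite gt_eqF.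
have b2 : `|(f y - f x) * dot (y - z) g'| <= e / 4 * `|y - z|.
  by apply: (bd _ _ `|y - x|) => //; rewrite (le_trans fyx) // ler_wpM2r.
have b4 : `|(f' z - f' x) * dot (y - z) g| <= e / 4 * `|y - z|.
  by apply: (bd _ _ `|z - x|) => //; rewrite (le_trans fzx) // ler_wpM2r.
rewrite (le_trans (ler_normD _ _)) // (le_trans (lerD (ler_normD _ _) (lexx _))) //.
rewrite (le_trans (lerD (lerD (ler_normD _ _) (lexx _)) (lexx _))) //.
have -> : e * `|y - z| = e / 4 * `|y - z| + e / 4 * `|y - z| + e / 4 * `|y - z| +
  e / 4 * `|y - z| by field.
exact: (lerD (lerD (lerD b1 b2) b3) b4).
Qed.

Lemma sd_Z c f x g : sd f x g -> sd (fun y => c * f y) x (c *: g).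
Proof.
move=> hf; have := sdM (sd_cst c x) hf.
by rewrite /cst scaler0 addr0.
Qed.

Lemma sd_sum (I : Type) (s : seq I) (F : I -> E -> R) x :
  (forall i, exists g, sd (F i) x g) -> exists g, sd (fun y => \sum_(i <- s) F i y) x g.
Proof.
move=> hF; elim: s => [|i s [g hg]].
  by exists 0; under eq_fun do rewrite big_nil; exact: sd_cst.
have [g' hg'] := hF i; exists (g' + g).
by under eq_fun do rewrite big_cons; exact: sdD.
Qed.

Lemma sd_prod (I : Type) (s : seq I) (F : I -> E -> R) x :
  (forall i, exists g, sd (F i) x g) -> exists g, sd (fun y => \prod_(i <- s) F i y) x g.
Proof.
move=> hF; elim: s => [|i s [g hg]].
  by exists 0; under eq_fun do rewrite big_nil; exact: sd_cst.
have [g' hg'] := hF i; eexists.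
by under eq_fun do rewrite big_cons; exact: (sdM hg' hg).
Qed.

Lemma sd_meval (p : mpoly.mpoly 3 R) x :
  exists g, sd (fun y => mpoly.meval (fun l => y 0 l) p) x g.
Proof.
rewrite (_ : (fun y => _) = (fun y => \sum_(m <- mpoly.msupp p)
    mpoly.mcoeff m p * \prod_i y 0 i ^+ (mpoly.fun_of_multinom m i))) //.
apply: sd_sum => m.
have [g hg] : exists g, sd (fun y => \prod_i y 0 i ^+ (mpoly.fun_of_multinom m i)) x g.
  apply: sd_prod => i; have [k hk] : exists k, k = mpoly.fun_of_multinom m i by eexists.
  rewrite -hk; elim: k {hk} => [|k [g hg]].
    by exists 0; under eq_fun do rewrite expr0; exact: sd_cst.
  by eexists; under eq_fun do rewrite exprS; exact: (sdM (sd_coord i x) hg).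
by eexists; exact: sd_Z hg.
Qed.

End StrictDiff.

(** * Gradients, Jacobians and the chain rule *)

(*@@P6*)
Section StrictDiff2.
Context {R : realType}.
Local Notation E := 'rV[R]_3.
Implicit Types (f : E -> R) (x y z g h : E) (M : E -> E).

Lemma sd_is_derive f x g l : sd f x g -> is_derive x (dir l) f (g 0 l).
Proof.
move=> hf; suff h : (fun h : R => h^-1 *: ((f \o shift x) (h *: dir l) - f x)) @ 0^' --> g 0 l.
  by apply: DeriveDef; [apply/cvg_ex; exists (g 0 l)|exact/cvg_lim].
apply/cvgrPdist_le => e e0; have [r r0 hr] := hf e e0.
near=> t; have t0 : t != 0 by near: t; exact: nbhs_dnbhs_neq.
have tr : `|t| < r by near: t; exact: dnbhs0_lt.
have /= := hr (t *: dir l + x) x; rewrite addrK normrZ norm_dir mulr1 subrr normr0.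
move=> /(_ tr r0); rewrite dotZl dot_dir => h.
rewrite -[g 0 l](mulKf t0) -[_ *: _]/(_ * _) -mulrBr normrM normfV distrC.
by rewrite mulrC ler_pdivrMr ?normr_gt0.
Unshelve. all: by end_near. Qed.

Lemma sd_partial f x g l : sd f x g -> derivable f x (dir l) /\ partial l f x = g 0 l.
Proof. by move=> /(sd_is_derive l)[]. Qed.

Lemma sd_unique f x g g' : sd f x g -> sd f x g' -> g = g'.
Proof.
by move=> h h'; apply/rowP => l; rewrite -(sd_partial l h).2 -(sd_partial l h').2.
Qed.

Lemma sd_grad f x g : sd f x g -> grad f x = g.
Proof. by move=> h; apply/rowP => l; rewrite mxE (sd_partial l h).2. Qed.

(** Strict differentiability at x controls difference quotients whose two ends both lie near x. Over
    a short step from y the same quotient is also close to the gradient at y, so the two gradients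
    are close. *)
Lemma sd_grad_near f x (G : E -> E) e : 0 < e -> sd f x (G x) -> (\near x, sd f x (G x)) ->
  \forall y \near x, `|G y - G x| <= e.
Proof.
move=> e0 hf /nbhs_normP_lt[s s0 hs].
have e20 : 0 < e / 2 by rewrite divr_gt0.
have [r r0 hr] := hf _ e20.
apply/nbhs_normP_lt; exists (Num.min r s); first by rewrite lt_min r0.
move=> y; rewrite lt_min => /andP[yr ys]; have [q q0 hq] := hs y ys _ e20.
apply/(normr_rV_le _ (ltW e0)) => l; rewrite !mxE.
have [t [t0 tq tr]] : exists t, [/\ 0 < t, t < q & t < r - `|y - x|].
  exists (Num.min q (r - `|y - x|) / 2).
  have m0 : 0 < Num.min q (r - `|y - x|) by rewrite lt_min q0 subr_gt0.
  have m1 : Num.min q (r - `|y - x|) <= q by rewrite ge_min lexx.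
  have m2 : Num.min q (r - `|y - x|) <= r - `|y - x| by rewrite ge_min lexx orbT.
  by move: m0 m1 m2; move: (Num.min _ _) => m *; split; lra.
have ntl : `|t *: dir l : E| = t by rewrite normrZ norm_dir mulr1 gtr0_norm.
have yt : `|y + t *: dir l - y| = t by rewrite addrC addKr.
have h1 := hq (y + t *: dir l) y _ _; rewrite yt subrr normr0 in h1.
have {}h1 := h1 tq q0.
have h2 := hr (y + t *: dir l) y _ yr; rewrite yt in h2.
have {}h2 : `|f (y + t *: dir l) - f y - dot (y + t *: dir l - y) (G x)| <= e / 2 * t.
  apply: h2; rewrite addrAC (le_lt_trans (ler_normD _ _)) // ntl; lra.
move: h1 h2; rewrite [y + _ - y]addrC addKr !dotZl !dot_dir.
rewrite !ler_norml => /andP[a1 a2] /andP[b1 b2].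
by apply/andP; split; rewrite -(ler_pM2l t0); lra.
Qed.

Lemma sdm_lin M x J e : 0 < e -> sdm M x J -> exists2 r, 0 < r & forall y z,
  `|y - x| < r -> `|z - x| < r -> `|M y - M z - (y - z) *m J| <= e * `|y - z|.
Proof.
move=> e0 hM; have [r0 r00 h0] := hM 0 e e0; have [r1 r10 h1] := hM 1 e e0.
have [r2 r20 h2] := hM 2 e e0.
exists (Num.min r0 (Num.min r1 r2)); first by rewrite !lt_min r00 r10.
move=> y z; rewrite !lt_min => /and3P[y0 y1 y2] /and3P[z0 z1 z2].
apply/normr_rV_le; first by rewrite mulr_ge0 // ltW.
have dE j : (M y - M z - (y - z) *m J) 0 j =
    M y 0 j - M z 0 j - dot (y - z) (\row_i J i j).
  by rewrite !mxE; congr (_ - _); apply: eq_bigr => i _; rewrite !mxE.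
by apply: ord3P; rewrite dE; [exact: h0|exact: h1|exact: h2].
Qed.

Lemma norm_mulmx_le (h : E) (J : 'M[R]_3) c : 0 <= c -> (forall i j, `|J i j| <= c) ->
  `|h *m J| <= 3 * c * `|h|.
Proof.
move=> c0 hJ; apply/normr_rV_le; first by rewrite !mulr_ge0.
move=> j; have -> : (h *m J) 0 j = dot h (\row_i J i j).
  by rewrite mxE; apply: eq_bigr => i _; rewrite mxE.
rewrite (le_trans (le_dot _ _)) // mulrAC ler_wpM2r // ler_wpM2l //.
by apply/normr_rV_le => // i; rewrite mxE.
Qed.

Lemma mx_bound (J : 'M[R]_3) : exists2 c, 0 <= c & forall i j, `|J i j| <= c.
Proof.
exists (\sum_i \sum_j `|J i j|); first by apply: sumr_ge0 => i _; exact: sumr_ge0.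
move=> i j; rewrite (bigD1 i) //= (bigD1 j) //= -addrA lerDl addr_ge0 //.
  exact: sumr_ge0.
by apply: sumr_ge0 => k _; exact: sumr_ge0.
Qed.

Lemma sdm_lip M x J : sdm M x J -> exists2 L, 0 < L & exists2 r, 0 < r & forall y z,
  `|y - x| < r -> `|z - x| < r -> `|M y - M z| <= L * `|y - z|.
Proof.
move=> /(sdm_lin ltr01)[r r0 h]; have [c c0 hc] := mx_bound J.
exists (1 + 3 * c); first by rewrite ltr_pwDl ?mulr_ge0.
exists r => // y z yx zx.
rewrite -[X in `|X|](subrK ((y - z) *m J)) (le_trans (ler_normD _ _)) //.
by rewrite mulrDl lerD ?h // norm_mulmx_le.
Qed.

Lemma sdm_continuous M x J : sdm M x J -> {for x, continuous M}.
Proof.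
move=> /sdm_lip[L L0 [r r0 h]] A /nbhs_normP_lt[e e0 hA].
apply/nbhs_normP_lt; exists (Num.min r (e / L)); first by rewrite lt_min r0 divr_gt0.
move=> y; rewrite lt_min => /andP[yr ye]; apply: hA.
rewrite (le_lt_trans (h _ _ yr _)) ?subrr ?normr0 //.
by rewrite mulrC -ltr_pdivlMr.
Qed.

(** For row vectors the transpose moves the derivative across the pairing:
    [dot (h *m J) g = dot h (g *m J^T)]. *)
Lemma sd_comp f M x g J : sdm M x J -> sd f (M x) g ->
  sd (f \o M) x (g *m J^T).
Proof.
move=> hM hf e e0; have [L L0 [s s0 hs]] := sdm_lip hM.
pose e1 := e / (2 * L); pose e2 := e / (2 * (1 + 3 * `|g|)).
have g0 : 0 < 1 + 3 * `|g| by rewrite ltr_pwDl ?mulr_ge0.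
have e10 : 0 < e1 by rewrite divr_gt0 ?mulr_gt0.
have e20 : 0 < e2 by rewrite divr_gt0 ?mulr_gt0.
have [r r0 hr] := hf _ e10; have [q q0 hq] := sdm_lin e20 hM.
exists (Num.min (Num.min s q) (r / L)); first by rewrite !lt_min s0 q0 divr_gt0.
move=> y z; rewrite !lt_min => /andP[/andP[y1 y2] y3] /andP[/andP[z1 z2] z3].
have inr u : `|u - x| < s -> `|u - x| < r / L -> `|M u - M x| < r.
  move=> us uL; rewrite (le_lt_trans (hs _ _ us _)) ?subrr ?normr0 //.
  by rewrite mulrC -ltr_pdivlMr.
have -> : dot (y - z) (g *m J^T) = dot ((y - z) *m J) g.
  have d1 i : (y - z) 0 i * (g *m J^T) 0 i = \sum_j (y - z) 0 i * J i j * g 0 j.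
    rewrite [(g *m _) _ _]mxE mulr_sumr; apply: eq_bigr => j _.
    by rewrite [J^T _ _]mxE; ring.
  rewrite /dot (eq_bigr _ (fun i _ => d1 i)) exchange_big; apply: eq_bigr => j _.
  by rewrite [(_ *m J) _ _]mxE mulr_suml.
have -> : (f \o M) y - (f \o M) z - dot ((y - z) *m J) g =
  (f (M y) - f (M z) - dot (M y - M z) g) + dot (M y - M z - (y - z) *m J) g.
  by rewrite (dotBl (M y - M z)) /=; ring.
rewrite (le_trans (ler_normD _ _)) // (splitr e) mulrDl; apply: lerD.
  rewrite (le_trans (hr _ _ (inr _ y1 y3) (inr _ z1 z3))) //.
  have -> : e / 2 * `|y - z| = e1 * (L * `|y - z|) by rewrite /e1; field; rewrite gt_eqF.
  by rewrite ler_wpM2l ?(ltW e10) // hs.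
rewrite (le_trans (le_dot _ _)) //.
have -> : e / 2 * `|y - z| = (1 + 3 * `|g|) * (e2 * `|y - z|).
  by rewrite /e2; field; rewrite gt_eqF.
have hh := hq _ _ y2 z2; rewrite mulrAC ler_pM ?mulr_ge0 //.
by rewrite lerDr.
Qed.

Lemma sdm_jacobian M x J : sdm M x J -> 'J M x = J.
Proof.
move=> hM; pose L := mulmxr J : {linear E -> E}.
have cL : continuous L.
  move=> h A /nbhs_normP_lt[e e0 hA]; have [c c0 hc] := mx_bound J.
  apply/nbhs_normP_lt; have k0 : 0 < 1 + 3 * c by rewrite ltr_pwDl ?mulr_ge0.
  exists (e / (1 + 3 * c)); first by rewrite divr_gt0.
  move=> y hy; apply: hA; rewrite /= -mulmxBl.
  rewrite (le_lt_trans (norm_mulmx_le _ c0 hc)) //.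
  rewrite (@le_lt_trans _ _ ((1 + 3 * c) * `|y - h|)) ?ler_wpM2r ?lerDr //.
  by rewrite mulrC -ltr_pdivlMr.
have dE : 'd M x = L :> (E -> E).
  apply: diff_unique => //; apply/eqaddoP => e e0.
  have [r r0 hr] := sdm_lin e0 hM.
  apply/nbhs_normP_lt; exists r => // y; rewrite subr0 => yr /=.
  have := hr (y + x) x; rewrite addrK subrr normr0 => /(_ yr r0).
  by rewrite opprD addrA.
rewrite /jacobian dE; apply/row_matrixP => i; rewrite !rowE mul_rV_lin1 //.
Qed.

End StrictDiff2.

(** * Mean value estimates along coordinate directions *)

(*@@P7*)
Section MVT3.
Context {R : realType}.
Local Notation E := 'rV[R]_3.
Implicit Types (f : E -> R) (x y z w g h : E).

Lemma is_derive_line f w (l : 'I_3) t : derivable f (w + t *: dir l) (dir l) ->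
  is_derive t 1 (fun s : R => f (w + s *: dir l)) (partial l f (w + t *: dir l)).
Proof.
move=> df.
have E1 : (fun h : R => h^-1 *: (((fun s : R => f (w + s *: dir l)) \o shift t) (h *: 1) -
    f (w + t *: dir l))) = (fun h : R => h^-1 *: ((f \o shift (w + t *: dir l)) (h *: dir l) -
    f (w + t *: dir l))).
  apply/funext => h /=; congr (_ *: (f _ - _)).
  by rewrite scalerDl addrCA -[h *: 1]/(h * 1) mulr1.
split; first by rewrite /derivable E1.
by rewrite /derive E1.
Qed.

(** The one-variable mean value theorem on [0, s] or [s, 0], according to the sign of [s]; the
    condition [0 <= t * s] selects the points between 0 and [s]. *)
Lemma partial_step f (l : 'I_3) w (s g e : R) :
  (forall t, `|t| <= `|s| -> 0 <= t * s -> derivable f (w + t *: dir l) (dir l) /\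
    `|partial l f (w + t *: dir l) - g| <= e) ->
  `|f (w + s *: dir l) - f w - s * g| <= e * `|s|.
Proof.
move=> H; pose F t := f (w + t *: dir l).
pose F' t := partial l f (w + t *: dir l).
have w0 : f w = F 0 by rewrite /F scale0r addr0.
have key a b : a <= b -> (forall t, a <= t <= b -> `|t| <= `|s| /\ 0 <= t * s) ->
    `|F b - F a - (b - a) * g| <= e * (b - a).
  move=> ab hab.
  have hd t : t \in `[a, b]%R -> is_derive t 1 F (F' t).
    rewrite in_itv => /hab[h1 h2].
    by apply: is_derive_line; exact: (H t h1 h2).1.
  have hd' t : t \in `]a, b[%R -> is_derive t 1 F (F' t).
    by rewrite in_itv /= => /andP[/ltW ta /ltW tb]; apply: hd; rewrite in_itv /= ta.
  have hc : {within `[a, b], continuous F}.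
    apply: (@derivable_within_continuous R R F `[a, b]%R) => t tab.
    exact: (@ex_derive _ _ _ _ _ _ _ (hd t tab)).
  have [c cab ->] := @MVT_segment R F F' a b ab hd' hc.
  move: cab; rewrite in_itv => /hab[h1 h2].
  have -> : F' c * (b - a) - (b - a) * g = (F' c - g) * (b - a) by ring.
  rewrite normrM (ger0_norm (_ : 0 <= b - a)) ?subr_ge0 //.
  by rewrite ler_wpM2r ?subr_ge0 // (H c h1 h2).2.
rewrite w0 -/(F s); have [s0|s0] := leP 0 s.
  have := key 0 s s0; rewrite subr0 ger0_norm //; apply => t /andP[t0 ts].
  by rewrite !ger0_norm // mulr_ge0.
have := key s 0 (ltW s0); rewrite sub0r (ltr0_norm s0) => h.
have -> : F s - F 0 - s * g = - (F 0 - F s - - s * g) by ring.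
rewrite normrN.
apply: h => t /andP[ts t0].
by rewrite (ler0_norm t0) lerN2 ts mulr_le0 // ltW.
Qed.

Let mid1 y z : E := \row_j if j == 0 then y 0 j else z 0 j.
Let mid2 y z : E := \row_j if j == 2 then z 0 j else y 0 j.

Let path1 y z : mid1 y z = z + (y 0 0 - z 0 0) *: dir 0.
Proof.
by apply/rowP; apply: ord3P; rewrite !mxE /= ?mulr0 ?mulr1 ?addr0 // addrC subrK.
Qed.

Let path2 y z : mid2 y z = mid1 y z + (y 0 1 - z 0 1) *: dir 1.
Proof.
by apply/rowP; apply: ord3P; rewrite !mxE /= ?mulr0 ?mulr1 ?addr0 // addrC subrK.
Qed.

Let path3 y z : y = mid2 y z + (y 0 2 - z 0 2) *: dir 2.
Proof.
by apply/rowP; apply: ord3P; rewrite !mxE /= ?mulr0 ?mulr1 ?addr0 // addrC subrK.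
Qed.

(* Between z and y one moves along the three coordinate directions in turn. *)
Lemma partial_bound f x r g (e : R) : 0 <= e ->
  (forall w l, `|w - x| < r -> derivable f w (dir l) /\ `|partial l f w - g 0 l| <= e) ->
  forall y z, `|y - x| < r -> `|z - x| < r ->
  `|f y - f z - dot (y - z) g| <= 3 * e * `|y - z|.
Proof.
move=> e0 H y z yx zx; have r0 : 0 < r by exact: le_lt_trans yx.
have nyz l : `|y 0 l - z 0 l| <= `|y - z| by have := le_coord_norm (y - z) l; rewrite !mxE.
have yc j := (normr_rV_lt (y - x) r0).1 yx j.
have zc j := (normr_rV_lt (z - x) r0).1 zx j.
(* Balls of the maximum norm are cubes, so a coordinate that moves from that of z towards that of y
   stays within [r] of that of x. *)
have btw (a b c t : R) : `|a - c| < r -> `|b - c| < r -> `|t| <= `|a - b| ->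
    0 <= t * (a - b) -> `|b + t - c| < r.
  rewrite !ltr_norml => /andP[a1 a2] /andP[b1 b2].
  have [ab|ab] := leP 0 (a - b).
    rewrite (ger0_norm ab); have [t0|t0] := leP 0 t.
      by rewrite (ger0_norm t0) => h _; apply/andP; split; lra.
    have [ab0|ab0] := eqVneq (a - b) 0.
      by rewrite ab0 (ltr0_norm t0) => h _; apply/andP; split; lra.
    have abp : 0 < a - b by rewrite lt_neqAle eq_sym ab0.
    by move=> _; rewrite leNgt nmulr_rlt0 // abp.
  rewrite (ltr0_norm ab); have [t0|t0] := leP t 0.
    by rewrite (ler0_norm t0) => h _; apply/andP; split; lra.
  by move=> _; rewrite leNgt pmulr_rlt0 // ab.
have st w (l : 'I_3) : w 0 l = z 0 l -> (forall j, `|(w - x) 0 j| < r) ->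
    `|f (w + (y 0 l - z 0 l) *: dir l) - f w - (y 0 l - z 0 l) * g 0 l| <= e * `|y - z|.
  move=> wl hw; apply: (@le_trans _ _ (e * `|y 0 l - z 0 l|)); last first.
    by rewrite ler_wpM2l.
  apply: partial_step => t t1 t2; apply: H.
  apply/(normr_rV_lt _ r0) => j; have := hw j; rewrite !mxE /=.
  have [->|jl] := eqVneq j l; last by rewrite /= mulr0 addr0.
  move=> _; rewrite mulr1 wl; have := yc l; have := zc l; rewrite !mxE => h1 h2.
  exact: (btw (y 0 l)  _ _ t h2 h1 t1 t2).
have h1 := st z 0 erefl zc.
have h2 : `|f (mid2 y z) - f (mid1 y z) - (y 0 1 - z 0 1) * g 0 1| <= e * `|y - z|.
  rewrite path2; apply: st; first by rewrite !mxE.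
  move=> j; have := yc j; have := zc j; rewrite !mxE.
  by case: ifP.
have h3 : `|f y - f (mid2 y z) - (y 0 2 - z 0 2) * g 0 2| <= e * `|y - z|.
  rewrite {1}(path3 y z); apply: st; first by rewrite !mxE.
  move=> j; have := yc j; have := zc j; rewrite !mxE.
  by case: ifP.
rewrite -path1 in h1.
have -> : f y - f z - dot (y - z) g =
    (f (mid1 y z) - f z - (y 0 0 - z 0 0) * g 0 0) +
    (f (mid2 y z) - f (mid1 y z) - (y 0 1 - z 0 1) * g 0 1) +
    (f y - f (mid2 y z) - (y 0 2 - z 0 2) * g 0 2).
  by rewrite /dot sum_ord3 !mxE; ring.
rewrite (le_trans (ler_normD _ _)) // (le_trans (lerD (ler_normD _ _) (lexx _))) //.
have -> : 3 * e * `|y - z| = e * `|y - z| + e * `|y - z| + e * `|y - z| by ring.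
exact: (lerD (lerD h1 h2) h3).
Qed.

Lemma C1_sd f : Ck_on setT 1 f -> forall x, sd f x (grad f x).
Proof.
move=> [_ C1] x e e0; have e30 : 0 < e / 3 by rewrite divr_gt0.
have cl l : exists2 r, 0 < r & forall w, `|w - x| < r -> `|partial l f w - partial l f x| < e / 3.
  have /nbhs_normP_lt h : nbhs x [set w | `|partial l f w - partial l f x| < e / 3].
    apply: ((C1 l).2.1 x I [set v | `|v - partial l f x| < e / 3]).
    by apply/nbhs_normP_lt; exists (e / 3).
  by case: h => r r0 hr; exists r.
have [r0 r00 h0] := cl 0; have [r1 r10 h1] := cl 1; have [r2 r20 h2] := cl 2.
exists (Num.min r0 (Num.min r1 r2)); first by rewrite !lt_min r00 r10.
move=> y z yx zx; have -> : e = 3 * (e / 3) by field.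
apply: (partial_bound (ltW e30) _ yx zx) => w l.
rewrite !lt_min => /and3P[w0 w1 w2]; split; first exact: (C1 l).1.
by rewrite mxE ltW //; move: l; apply: ord3P; [exact: h0|exact: h1|exact: h2].
Qed.

Lemma bounded_partial_lip f (B : R) : 0 <= B ->
  (forall w l, derivable f w (dir l) /\ `|partial l f w| <= B) ->
  forall y z, `|f y - f z| <= 3 * B * `|y - z|.
Proof.
move=> B0 H y z.
have H0 w l : `|w - z| < `|y - z| + 1 -> derivable f w (dir l) /\
  `|partial l f w - (0 : E) 0 l| <= B by move=> _; rewrite mxE subr0; exact: H.
have := partial_bound B0 H0; move/(_ y z); rewrite dot0r subr0; apply.
  by rewrite ltrDl.
by rewrite subrr normr0 ltr_wpDl.
Qed.

End MVT3.

(** * Comparison of two measures on a box by bisection *)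

(*@@P8*)
Section Bisection.
Context {R : realType}.
Local Notation E := 'rV[R]_3.
Local Notation R' := (measurableTypeR R).
Local Notation T3 := (R' * R' * R')%type.
Variables m1 m2 : {measure set T3 -> \bar R}.

Let bad (ab : E * E) := ~ (m1 (box ab.1 ab.2) <= m2 (box ab.1 ab.2))%E.
Let lt (a b : E) := forall j, a 0 j < b 0 j.
Let le (a b : E) := forall j, a 0 j <= b 0 j.
Let upd (x : E) l v : E := \row_j if j == l then v else x 0 j.

Let cut l (a b : E) : lt a b -> bad (a, b) -> exists ab', [/\ bad ab', lt ab'.1 ab'.2,
  le a ab'.1, le ab'.2 b & forall j, ab'.2 0 j - ab'.1 0 j =
    if j == l then (b 0 j - a 0 j) / 2 else b 0 j - a 0 j].
Proof.
move=> ab hbad; pose m := (a 0 l + b 0 l) / 2.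
have abl := ab l; have am : a 0 l < m by rewrite /m; lra.
have mb : m < b 0 l by rewrite /m; lra.
have UE : box a b = box a (upd b l m) `|` box (upd a l m) b.
  apply/seteqP; split=> [p h|p [h|h] j].
  - have /andP[h1 h2] := h l; have [pm|mp] := leP (pt3 p 0 l) m; [left|right] => j;
    move: (h j); move: (pt3 p) h1 h2 pm || move: (pt3 p) h1 h2 mp => x; rewrite ?mxE;
    case: eqVneq => // -> h1 h2 hm; by rewrite ?h1 ?h2 ?hm.
  - move: (h j); move: (pt3 p) => x; rewrite !mxE; case: eqVneq => // ->.
    by move=> /andP[-> h2]; rewrite (le_trans h2) // ltW.
  - move: (h j); move: (pt3 p) => x; rewrite !mxE; case: eqVneq => // ->.
    by move=> /andP[h1 ->]; rewrite (lt_trans am).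
have DE : box a (upd b l m) `&` box (upd a l m) b = set0.
  apply/seteqP; split=> // p [/(_ l) h1 /(_ l)]; move: h1; move: (pt3 p) => x.
  by rewrite !mxE eqxx => /andP[_ h1] /andP[h2 _]; move: (le_lt_trans h1 h2); rewrite ltxx.
have mE (mm : {measure set T3 -> \bar R}) : mm (box a b) =
    (mm (box a (upd b l m)) + mm (box (upd a l m) b))%E.
  by rewrite UE measureU //; exact: measurable_box.
have [b1|b2] : bad (a, upd b l m) \/ bad (upd a l m, b).
  apply: contrapT => /not_orP[/contrapT h1 /contrapT h2]; apply: hbad.
  by rewrite /= !mE leeD.
- exists (a, upd b l m); split=> //= j; rewrite !mxE; case: eqVneq => // ->;
  by rewrite ?(ltW mb) ?am //; rewrite /m; field.
- exists (upd a l m, b); split=> //= j; rewrite !mxE; case: eqVneq => // ->;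
  by rewrite ?(ltW am) ?mb //; rewrite /m; field.
Qed.

Let cut3 (a b : E) : lt a b -> bad (a, b) -> exists ab', [/\ bad ab', lt ab'.1 ab'.2,
  le a ab'.1, le ab'.2 b & forall j, ab'.2 0 j - ab'.1 0 j = (b 0 j - a 0 j) / 2].
Proof.
move=> ab hbad.
have [[a0 b0] [/= B0 L0 aa0 bb0 d0]] := cut 0 ab hbad.
have [[a1 b1] [/= B1 L1 aa1 bb1 d1]] := cut 1 L0 B0.
have [[a2 b2] [/= B2 L2 aa2 bb2 d2]] := cut 2 L1 B1.
exists (a2, b2); split=> //= j.
- exact: le_trans (aa0 j) (le_trans (aa1 j) (aa2 j)).
- exact: le_trans (bb2 j) (le_trans (bb1 j) (bb0 j)).
- by rewrite d2 d1 d0; move: j; apply: ord3P.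
Qed.

(** If the inequality failed on the box, additivity would make it fail on one of its halves. Halving
    the three sides in turn gives nested bad boxes with unchanged proportions that shrink to a
    point, against the local hypothesis at that point. *)
Lemma box_le_bisect (a b : E) : (forall j, a 0 j < b 0 j) ->
  (forall x, cbox a b x -> exists2 r, 0 < r & forall (c : E) s, 0 < s -> s < r ->
    cbox c (c + s *: (b - a)) x ->
    (m1 (box c (c + s *: (b - a))) <= m2 (box c (c + s *: (b - a))))%E) ->
  (m1 (box a b) <= m2 (box a b))%E.
Proof.
move=> ab H; apply: contrapT => hbad.
pose S := {ab : E * E | bad ab /\ lt ab.1 ab.2}.
have step (s : S) : {t : S | [/\ le (sval s).1 (sval t).1, le (sval t).2 (sval s).2 &
    forall j, (sval t).2 0 j - (sval t).1 0 j = ((sval s).2 0 j - (sval s).1 0 j) / 2]}.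
  apply: cid; case: s => -[a' b'] /= [h1 h2].
  have [t [t1 t2 t3 t4 t5]] := cut3 h2 h1.
  by exists (exist _ t (conj t1 t2)).
pose u n : S := iter n (fun s => sval (step s)) (exist _ (a, b) (conj hbad ab)).
pose A n := (sval (u n)).1; pose B n := (sval (u n)).2.
have AS n : le (A n) (A n.+1) by have [] := svalP (step (u n)).
have BS n : le (B n.+1) (B n) by have [] := svalP (step (u n)).
have AB n j : A n 0 j < B n 0 j by have [_] := svalP (u n); exact.
have BA n j : B n 0 j - A n 0 j = (b 0 j - a 0 j) / 2 ^+ n.
  elim: n => [|n IH]; first by rewrite expr0 divr1.
  have [_ _ /(_ j)] := svalP (step (u n)); rewrite -/(B n) -/(A n) IH => h.
  by rewrite [LHS]h exprS invfM mulrA mulrAC.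
have Amon j m n : (m <= n)%N -> A m 0 j <= A n 0 j.
  by move=> /subnK <-; elim: (n - m)%N => // k /le_trans; apply; exact: AS.
have Bmon j m n : (m <= n)%N -> B n 0 j <= B m 0 j.
  by move=> /subnK <-; elim: (n - m)%N => // k; apply: le_trans; exact: BS.
have ABmn j m n : A m 0 j <= B n 0 j.
  apply: le_trans (Amon j _ _ (leq_maxl m n)) _.
  exact: le_trans (ltW (AB _ _)) (Bmon j _ _ (leq_maxr m n)).
(* The common point of the nested closed boxes, as supremum of the lower corners. *)
pose x : E := \row_j sup [set A n 0 j | n in setT].
have xAB n : cbox (A n) (B n) x.
  move=> j; rewrite mxE; apply/andP; split.
    apply: sup_upper_bound; last by exists n.
    split; first by exists (A 0%N 0 j), 0%N.
    by exists (B 0%N 0 j) => _ [k _ <-].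
  by apply: ge_sup; [exists (A 0%N 0 j), 0%N|move=> _ [k _ <-]].
have [r r0 hr] := H x (xAB 0%N).
have [n hn] : exists n, (2 ^+ n)^-1 < r.
  exists (Num.truncn r^-1); rewrite -[ltRHS]invrK ltf_pV2 ?posrE ?invr_gt0 ?exprn_gt0 //.
  apply: lt_le_trans (truncnS_gt _) _.
  by rewrite -natrX ler_nat ltn_expl.
have BE : B n = A n + (2 ^+ n)^-1 *: (b - a).
  by apply/rowP => j; rewrite !mxE [_^-1 * _]mulrC -BA addrC subrK.
have [+ _] := svalP (u n); apply; rewrite -/(A n) -/(B n) BE; apply: hr => //.
by rewrite -BE.
Qed.

End Bisection.

(*@@P9*)
(* The library has no join of the complete and normed structures on matrices. *)
HB.instance Definition _ (R : realType) :=
  Uniform_isComplete.Build 'rV[R]_3 (@cauchy_cvg _).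

(** * The image of a small box under a strictly differentiable map *)

Section LocalEstimate.
Context {R : realType}.
Local Notation E := 'rV[R]_3.
Local Notation R' := (measurableTypeR R).
Local Notation T3 := (R' * R' * R')%type.
Local Notation mu3 := (@mu3 R).

Lemma contraction_fixed_point (f : E -> E) (rho q : R) : 0 <= rho -> 0 <= q -> q < 1 ->
  (forall z, `|z| <= rho -> `|f z| <= rho) ->
  (forall z z', `|z| <= rho -> `|z'| <= rho -> `|f z - f z'| <= q * `|z - z'|) ->
  exists2 z, `|z| <= rho & z = f z.
Proof.
move=> rho0 q0 q1 fB fL; pose U : set E := [set z | `|z| <= rho].
have fU : set_fun U U f by move=> z; exact: fB.
pose g := mkfun fU.
have [z Uz zg] : exists2 p, U p & p = g p.
  apply: banach_fixed_point.
  - exists (NngNum q0); split => //= -[y z] [/= Uy Uz]; exact: fL.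
  - rewrite [X in closed X](_ : _ = Num.norm @^-1` [set t | t <= rho]) //.
    by apply: closed_comp; [move=> y _; exact: norm_continuous|exact: closed_le].
  - by exists 0; rewrite /U /= normr0.
by exists z.
Qed.

Definition imgM (M : E -> E) (Q : set T3) : set T3 :=
  [set p | exists2 y, Q (unpt3 y) & pt3 p = M y].

Definition cube (rho : R) : set T3 := box (const_mx (- rho)) (const_mx rho).

Lemma mu3_cube rho : 0 <= rho -> mu3 (cube rho) = ((2 * rho) ^+ 3)%:E.
Proof.
move=> r0; rewrite mu3_box => [|j]; last by rewrite !mxE; lra.
by rewrite prod_ord3 !mxE; congr EFin; ring.
Qed.

Lemma row_lower_bound (w : E) : (forall j, 0 < w 0 j) -> exists2 k, 0 < k & forall j, k <= w 0 j.
Proof.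
move=> w0; exists (Num.min (w 0 0) (Num.min (w 0 1) (w 0 2))).
  by rewrite !lt_min !w0.
by apply: ord3P; rewrite !ge_min lexx ?orbT.
Qed.

(** The affine map [F] undoes the derivative and rescales the box to the cube of radius 1 about its
    centre. In these coordinates [M] differs from the identity by at most [eta], so the image lies
    in the cube of radius 1 + 2 * eta and covers the one of radius 1 - 2 * eta, the latter by the
    contraction principle. [X1] and [X2] are the preimages of these two cubes. *)
Lemma local_sandwich (M : E -> E) (x : E) (J0 : 'M[R]_3) (w : E) (eta : R) :
  sdm M x J0 -> J0 \in unitmx -> (forall j, 0 < w 0 j) -> 0 < eta -> eta < 4^-1 ->
  exists2 r, 0 < r & forall c s, 0 < s -> s < r -> cbox c (c + s *: w) x ->
    exists X1 X2 : set T3, [/\ measurable X1 /\ measurable X2,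
      X2 `<=` imgM M (box c (c + s *: w)), imgM M (box c (c + s *: w)) `<=` X1,
      mu3 X1 = (((1 + 2 * eta) ^+ 3 * `|\det J0|)%:E * mu3 (box c (c + s *: w)))%E &
      mu3 X2 = (((1 - 2 * eta) ^+ 3 * `|\det J0|)%:E * mu3 (box c (c + s *: w)))%E].
Proof.
move=> hM uJ w0 eta0 eta1.
have [k k0 kw] := row_lower_bound w0.
have [K K0 hK] := mx_bound (invmx J0).
have W0 : 0 < `|w| by apply: lt_le_trans (le_coord_norm w 0); rewrite gtr0_norm.
have K1 : 0 < 3 * (K + 1) by rewrite mulr_gt0 // ltr_wpDl.
(* The linearisation error is multiplied by at most [3 * (K + 1)] when [J0] is inverted and divided
   by a half side of length at least [s / 2 * k]; with this [e] the result is at most [eta]. *)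
pose e := eta * k / (3 * (K + 1) * `|w|).
have e0 : 0 < e by apply: divr_gt0; apply: mulr_gt0.
have [r0 r00 h0] := sdm_lin e0 hM.
exists (r0 / `|w|); first by rewrite divr_gt0.
move=> c s s0; rewrite ltr_pdivlMr // => sr xc.
have [d dj] : exists d : E, forall j, d 0 j = s / 2 * w 0 j.
  by exists ((s / 2) *: w) => j; rewrite mxE.
pose m := c + d.
have d0 j : 0 < d 0 j by rewrite dj mulr_gt0 // divr_gt0.
pose Di : 'M[R]_3 := diag_mx (\row_j (d 0 j)^-1); pose Ai := invmx J0 *m Di.
pose D : 'M[R]_3 := diag_mx d.
have vD (v : E) j : (v *m D) 0 j = v 0 j * d 0 j by rewrite mul_mx_diag mxE.
have vDi (v : E) j : (v *m Di) 0 j = v 0 j / d 0 j by rewrite mul_mx_diag !mxE.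
have DDi : D *m Di = 1%:M.
  apply/row_matrixP => i; rewrite row_mul row1; apply/rowP => j.
  rewrite vDi /D row_diag_mx !mxE /=.
  by case: (eqVneq j i) => [->|_] /=; rewrite ?mulr1 ?mulr0 ?mul0r // divff // gt_eqF.
have DiD : Di *m D = 1%:M by apply: mulmx1C.
have detJ : \det J0 != 0 by rewrite -unitfE.
have detDi : \det Di = (\prod_j d 0 j)^-1.
  by rewrite det_diag -prodfV; apply: eq_bigr => j _; rewrite mxE.
have P0 : 0 < \prod_j d 0 j by apply: prodr_gt0 => j _.
have uAi : Ai \in unitmx.
  by rewrite unitmxE det_mulmx unitfE mulf_neq0 ?det_inv ?invr_neq0 // detDi invr_neq0 ?gt_eqF.
have detAi : `|\det Ai| = (`|\det J0| * \prod_j d 0 j)^-1.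
  by rewrite det_mulmx det_inv detDi normrM !normfV (gtr0_norm P0) invfM.
have in_ball y : cbox c (c + s *: w) y -> `|y - x| < r0.
  move=> hy; apply: le_lt_trans sr.
  apply/normr_rV_le; first by rewrite mulr_ge0 // ltW.
  move=> j; have := hy j; have := xc j; rewrite !mxE => /andP[a1 a2] /andP[b1 b2].
  have : s * w 0 j <= s * `|w|.
    by rewrite ler_pM2l // (le_trans (ler_norm _)) // le_coord_norm.
  by rewrite ler_norml => h; apply/andP; split; lra.
have key y y' : cbox c (c + s *: w) y -> cbox c (c + s *: w) y' ->
    `|(M y - M y') *m Ai - (y - y') *m Di| <= eta * `|(y - y') *m Di|.
  move=> hy hy'; have hh := h0 y y' (in_ball y hy) (in_ball y' hy').
  set z := (y - y') *m Di.
  have yz : y - y' = z *m D by rewrite /z -mulmxA DiD mulmx1.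
  have nyz : `|y - y'| <= (s / 2 * `|w|) * `|z|.
    have s20 : 0 <= s / 2 by rewrite divr_ge0 // ltW.
    apply/normr_rV_le; first by rewrite !(mulr_ge0, normr_ge0, s20).
    move=> j; rewrite yz vD normrM mulrC ler_pM ?le_coord_norm //.
    rewrite dj normrM ger0_norm ?divr_ge0 ?(ltW s0) //.
    by rewrite ler_wpM2l ?le_coord_norm // divr_ge0 // ltW.
  have -> : (M y - M y') *m Ai - z = (M y - M y' - (y - y') *m J0) *m invmx J0 *m Di.
    rewrite /z /Ai; move: (M y - M y') (y - y') => a b.
    by rewrite !mulmxBl mulmxK // mulmxA.
  apply/normr_rV_le; first by rewrite mulr_ge0 // ltW.
  move=> j; rewrite vDi normrM normfV (gtr0_norm (d0 j)) ler_pdivrMr //.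
  rewrite (le_trans (le_coord_norm _ j)) // (le_trans (norm_mulmx_le _ K0 hK)) //.
  have h1 : 3 * K <= 3 * (K + 1) by lra.
  rewrite (le_trans (ler_pM _ _ h1 hh)) ?mulr_ge0 //.
  rewrite (le_trans (ler_wpM2l _ (ler_wpM2l _ nyz))) ?(ltW K1) ?(ltW e0) //.
  have -> : 3 * (K + 1) * (e * (s / 2 * `|w| * `|z|)) = eta * `|z| * (s / 2 * k).
    by rewrite /e; field; rewrite gt_eqF //= gt_eqF // ltr_wpDl.
  by rewrite ler_wpM2l ?mulr_ge0 ?(ltW eta0) // dj ler_pM2l ?divr_gt0.
have zbox y : box c (c + s *: w) (unpt3 y) <-> forall j, -1 < ((y - m) *m Di) 0 j <= 1.
  rewrite /box /=; split=> h j; move: (h j); rewrite ?unpt3K vDi !mxE ltr_pdivlMr //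
    ler_pdivrMr // !dj => /andP[a1 a2]; apply/andP; split; lra.
have sub_cbox y : box c (c + s *: w) (unpt3 y) -> cbox c (c + s *: w) y.
  by move=> h j; have := h j; rewrite unpt3K => /andP[/ltW -> ->].
have mc : cbox c (c + s *: w) m.
  by move=> j; have := mulr_gt0 s0 (w0 j); rewrite !mxE !dj => h; apply/andP; split; lra.
pose F (p : T3) : T3 := unpt3 ((pt3 p + - M m) *m Ai).
have mF rho : measurable (F @^-1` cube rho).
  have mF' : measurable_fun setT F.
    have -> : F = mulp Ai \o transp (- M m).
      by apply/funext => p; rewrite /F /mulp /transp /= unpt3K.
    by apply: measurableT_comp; [exact: measurable_mulp|exact: measurable_transp].
  by rewrite -[_ @^-1` _]setTI; apply: mF' => //; exact: measurable_box.
have FE rho : 0 <= rho -> mu3 (F @^-1` cube rho) =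
    ((rho ^+ 3 * `|\det J0|)%:E * mu3 (box c (c + s *: w)))%E.
  move=> rho0; have := mu3_affine (- M m) uAi (measurable_box (const_mx (- rho)) (const_mx rho)).
  rewrite -/F -/(cube rho) mu3_cube // detAi => h.
  have JP : `|\det J0| * \prod_j d 0 j != 0.
    by rewrite mulf_neq0 ?normr_eq0 // gt_eqF.
  have -> : mu3 (box c (c + s *: w)) = (8 * \prod_j d 0 j)%:E.
    rewrite mu3_box => [|j]; last by rewrite !mxE lerDl mulr_ge0 // ltW.
    by rewrite !prod_ord3 !mxE !dj; congr EFin; field.
  have -> : mu3 (F @^-1` cube rho) = (mu3 (F @^-1` cube rho) *
      (`|\det J0| * \prod_j d 0 j)^-1%:E * (`|\det J0| * \prod_j d 0 j)%:E)%E.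
    by rewrite -muleA -EFinM mulVf // mule1.
  by rewrite h -!EFinM; congr EFin; ring.
exists (F @^-1` cube (1 + 2 * eta)), (F @^-1` cube (1 - 2 * eta)).
split=> //; [| |by apply: FE; lra|by apply: FE; lra].
- move=> p hp.
  pose u := (pt3 p - M m) *m Ai.
  have hu : `|u| <= 1 - 2 * eta.
    apply/normr_rV_le; first by lra.
    move=> j; have := hp j; rewrite /F unpt3K -/u !mxE ler_norml => /andP[a1 a2].
    by rewrite ltW.
  pose Y (z : E) := m + z *m D.
  have YDi z : (Y z - m) *m Di = z by rewrite /Y addrC addKr -mulmxA DDi mulmx1.
  have Ybox z : `|z| <= 1 - eta -> box c (c + s *: w) (unpt3 (Y z)).
    move=> hz; apply/zbox => j; rewrite YDi.
    have := le_trans (le_coord_norm z j) hz; rewrite ler_norml => /andP[a1 a2].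
    by apply/andP; split; lra.
  (* A fixed point of [f] is a solution of [M (Y z) = pt3 p]. [f] contracts by [eta] and preserves
     the ball of radius 1 - eta, since (1 - 2 * eta) + eta * (1 - eta) <= 1 - eta. *)
  pose f z := u - ((M (Y z) - M m) *m Ai - z).
  have [z hz zf] : exists2 z, `|z| <= 1 - eta & z = f z.
    apply: (contraction_fixed_point (q := eta)); [lra|lra|lra|..].
    - move=> z hz; rewrite /f (le_trans (ler_normB _ _)) //.
      have := key (Y z) m (sub_cbox _ (Ybox z hz)) mc; rewrite YDi => h.
      have h2 : eta * `|z| <= eta * (1 - eta) by rewrite ler_pM2l.
      have h3 : 0 <= eta * eta by rewrite mulr_ge0 // ltW.
      rewrite mulrBr mulr1 in h2; lra.
    - move=> z z' hz hz'.
      have := key (Y z) (Y z') (sub_cbox _ (Ybox z hz)) (sub_cbox _ (Ybox z' hz')).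
      have YY : (Y z - Y z') *m Di = z - z'.
        by rewrite /Y opprD addrACA subrr add0r -mulmxBl -mulmxA DDi mulmx1.
      rewrite YY; rewrite -[X in X <= _ -> _]normrN; apply: le_trans.
      rewrite le_eqVlt; apply/orP; left; apply/eqP; congr `|_|; rewrite /f.
      have -> : M (Y z) - M (Y z') = (M (Y z) - M m) - (M (Y z') - M m).
        by rewrite opprB addrA subrK.
      rewrite [in RHS]mulmxBl.
      move: ((M (Y z) - M m) *m Ai) ((M (Y z') - M m) *m Ai) => A B.
      by apply/rowP => j; rewrite !mxE; ring.
  exists (Y z); first exact: Ybox.
  have Au : (M (Y z) - M m) *m Ai = u.
    by move: zf; rewrite /f opprB addrA => /eqP; rewrite eq_sym subr_eq addrC => /eqP /addrI ->.
  have : pt3 p - M m = M (Y z) - M m.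
    by rewrite -[LHS](mulmxK uAi) -/u -Au mulmxK.
  by move/addIr.
- move=> p [y hy py] j; rewrite /F unpt3K py.
  have := key y m (sub_cbox _ hy) mc; have := (zbox y).1 hy.
  set z := (y - m) *m Di; set v := _ *m Ai; clearbody z v => zj hv.
  have z1 : `|z| <= 1.
    by apply/normr_rV_le => // i; have /andP[a1 a2] := zj i; rewrite ler_norml a2 andbT ltW.
  have h2 : eta * `|z| <= eta by rewrite ler_piMr // ltW.
  have := le_trans (le_trans (le_coord_norm _ j) hv) h2.
  have /andP[a1 a2] := zj j; rewrite !mxE ler_norml => /andP[b1 b2].
  by apply/andP; split; lra.
Qed.

End LocalEstimate.

(** * Measures with a density *)

(*@@P10*)
Section Density.
Local Open Scope ereal_scope.
Context d (T : measurableType d) (R : realType).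
Variables (mu : {measure set T -> \bar R}) (h : T -> R).
Hypotheses (mh : measurable_fun setT h) (h0 : forall x, (0 <= h x)%R).

Let mhE : measurable_fun setT (EFin \o h). Proof. exact/measurable_EFinP. Qed.

Definition dens (A : set T) := \int[mu]_(x in A) (h x)%:E.

Let dens0 : dens set0 = 0. Proof. exact: integral_set0. Qed.

Let dens_ge0 A : 0 <= dens A. Proof. by apply: integral_ge0 => x _; rewrite lee_fin. Qed.

Let dens_sigma_additive : semi_sigma_additive dens.
Proof.
move=> F mF tF mUF.
rewrite [X in _ --> X](_ : _ = \sum_(n <oo) dens (F n)).
  by apply/cvg_closeP; split; [exact: is_cvg_nneseries|rewrite closeE].
by rewrite /dens ge0_integral_bigcup //; [exact: measurable_funTS|by move=> x _; rewrite lee_fin].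
Qed.

HB.instance Definition _ := isMeasure.Build _ _ _ dens
  dens0 dens_ge0 dens_sigma_additive.

Definition densm : {measure set T -> \bar R} := dens.

Variables (D : set T) (mD : measurable D).

Import HBNNSimple.

Let integral_dens_indic E : measurable E ->
  \int[densm]_(x in D) (\1_E x)%:E = \int[mu]_(x in D) ((\1_E x)%:E * (h x)%:E).
Proof.
move=> mE; rewrite integral_indic //= /dens setIC integral_mkcondr.
apply: eq_integral => x _; rewrite /patch indicE.
by case: ifP; rewrite ?mul1e ?mul0e.
Qed.

Let integral_dens_nnsfun (g : {nnsfun T >-> R}) :
  \int[densm]_(x in D) (g x)%:E = \int[mu]_(x in D) ((g x)%:E * (h x)%:E).
Proof.
have mhD : measurable_fun D (EFin \o h) by exact: measurable_funTS.
under [LHS]eq_integral do rewrite fimfunE -fsumEFin//.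
rewrite [LHS]ge0_integral_fsum//; last 2 first.
  - by move=> r; exact/measurable_EFinP/measurableT_comp.
  - by move=> n x _; rewrite EFinM nnfun_muleindic_ge0.
transitivity (\int[mu]_(x in D)
    \sum_(r \in range g) ((r * \1_(g @^-1` [set r]) x)%:E * (h x)%:E)); last first.
  apply: eq_integral => x xD; rewrite fimfunE -fsumEFin// ge0_mule_fsuml //.
  by move=> r; rewrite EFinM nnfun_muleindic_ge0.
rewrite [RHS]ge0_integral_fsum//; last 2 first.
  - by move=> r; apply: emeasurable_funM => //; exact/measurable_EFinP/measurableT_comp.
  - move=> n x _; apply: mule_ge0; last by rewrite lee_fin.
    by rewrite EFinM nnfun_muleindic_ge0.
apply: eq_fsbigr => r /[!inE] -[y _ gy]; have r0 : (0 <= r)%R by rewrite -gy.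
rewrite integralZl_indic_nnsfun //= integral_dens_indic //.
under [RHS]eq_integral do rewrite EFinM -muleA.
rewrite ge0_integralZl_EFin //.
- by move=> x _; rewrite mule_ge0 ?lee_fin.
- by apply: emeasurable_funM => //; exact/measurable_EFinP.
Qed.

(** Indicators come first, then simple functions by linearity, then monotone limits. *)
Lemma ge0_integral_densm (f : T -> \bar R) (mf : measurable_fun D f) :
  (forall x, D x -> 0 <= f x) ->
  \int[densm]_(x in D) f x = \int[mu]_(x in D) (f x * (h x)%:E).
Proof.
move=> f0; pose f_ := nnsfun_approx mD mf.
have mhD : measurable_fun D (EFin \o h) by exact: measurable_funTS.
transitivity (limn (fun n => \int[densm]_(x in D) (f_ n x)%:E)).
  rewrite -monotone_convergence//=.
  - apply: eq_integral => x /[!inE] xD; apply/esym/cvg_lim => //=.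
    exact: cvg_nnsfun_approx.
  - by move=> n; apply: measurableT_comp => //; exact: measurable_funTS.
  - by move=> n x _; rewrite lee_fin.
  - by move=> x _ a b ab; rewrite lee_fin//; exact/lefP/nd_nnsfun_approx.
under eq_fun do rewrite integral_dens_nnsfun.
rewrite -monotone_convergence//=.
- apply: eq_integral => x /[!inE] xD; apply/cvg_lim => //.
  by apply: cvgeZr => //; exact: cvg_nnsfun_approx.
- by move=> n; apply: emeasurable_funM => //; exact/measurable_EFinP/measurable_funTS.
- by move=> n x _; rewrite mule_ge0 ?lee_fin.
- by move=> x _ a b ab; rewrite lee_wpmul2r // lee_fin//; exact/lefP/nd_nnsfun_approx.
Qed.

End Density.

(** * The change of variables formula for an injective map *)

(*@@P11*)
Section ChangeOfVariables.
Context {R : realType}.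
Local Notation E := 'rV[R]_3.
Local Notation R' := (measurableTypeR R).
Local Notation T3 := (R' * R' * R')%type.
Local Notation mu3 := (@mu3 R).

Lemma det_continuous_at (J : E -> 'M[R]_3) (x : E) :
  (forall i j, {for x, continuous (fun y => J y i j)}) ->
  {for x, continuous (fun y => \det (J y))}.
Proof.
move=> cJ; have FF : Filter (nbhs x) by exact: nbhs_filter.
rewrite /continuous_at /determinant.
apply: cvg_big => [|s _]; first exact: add_continuous.
apply: (@cvgM _ _ (nbhs x) FF (cst ((-1) ^+ s)) (fun y => \prod_i J y i (s i))).
  exact: (@cvg_cst _ _ _ (nbhs x) FF).
by apply: cvg_big => [|i _]; [exact: mul_continuous|exact: cJ].
Qed.

Lemma sdm_entry_continuous (U : set E) (M : E -> E) (J : E -> 'M[R]_3) :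
  open U -> (forall x, U x -> sdm M x (J x)) ->
  forall x, U x -> forall i j, {for x, continuous (fun y => J y i j)}.
Proof.
move=> oU hM x Ux i j A /nbhs_normP_lt[e e0 hA].
have e20 : 0 < e / 2 by rewrite divr_gt0.
have nU : \near x, sd (fun y => M y 0 j) x (\row_i J x i j).
  by apply: (filterS _ (open_nbhs_nbhs (conj oU Ux))) => y Uy; exact: hM.
have := @sd_grad_near _ _ _ (fun x => \row_i J x i j) _ e20 (hM x Ux j) nU.
apply: filterS => y h; apply: hA; apply: (@le_lt_trans _ _ (e / 2)); last by lra.
by apply: le_trans h; have := le_coord_norm (\row_i J y i j - \row_i J x i j) i; rewrite !mxE.
Qed.

Variables (U : set E) (M : E -> E) (J : E -> 'M[R]_3) (G : T3 -> T3).
Hypotheses (oU : open U) (hM : forall x, U x -> sdm M x (J x)).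
Hypothesis hJ : forall x, U x -> 0 < \det (J x).
Hypotheses (mG : measurable_fun setT G) (GM : forall x, U x -> G (unpt3 (M x)) = unpt3 x).

Let UT : set T3 := pt3 @^-1` U.
Let V : set T3 := pt3 @^-1` (M @` U).
Hypotheses (mV : measurable V) (Vfin : (mu3 V < +oo)%E).

Let mUT : measurable UT. Proof. exact: (measurable_open oU). Qed.

Let cdet x : U x -> {for x, continuous (fun y => \det (J y))}.
Proof.
move=> Ux; apply: det_continuous_at => i j.
exact: (sdm_entry_continuous oU hM Ux).
Qed.

(** Extended by zero off [U], so that it is a density on the whole space. *)
Definition jacT (p : T3) : R := ((fun p => \det (J (pt3 p))) \_ UT) p.

Let mjac : measurable_fun setT jacT.
Proof.
apply/(measurable_restrictT _ mUT).
exact: (@continuous_measurable_on _ U (fun y => \det (J y)) oU cdet).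
Qed.

Let jac_ge0 p : 0 <= jacT p.
Proof.
by rewrite /jacT /patch; case: ifPn => // /set_mem /= Up; exact/ltW/hJ.
Qed.

Let jacE x : U x -> jacT (unpt3 x) = \det (J x).
Proof. by move=> Ux; rewrite /jacT /patch mem_set /UT /= unpt3K. Qed.

Let mI : measurable_fun setT (\1_V : T3 -> R). Proof. exact: measurable_indic. Qed.
Let I0 p : 0 <= (\1_V : T3 -> R) p. Proof. by rewrite indicE. Qed.

Let kap := densm mu3 mjac jac_ge0.
(** Lebesgue measure on the image [V], pushed forward by the measurable left inverse [G], is the set
    function A -> volume of M(A). In this form it is a measure at once, with no separate proof of
    additivity. *)
Let nu := pushm (densm mu3 mI I0) mG.

Let nuE A : measurable A -> nu A = mu3 (G @^-1` A `&` V).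
Proof.
move=> mA; have mGA : measurable (G @^-1` A) by rewrite -[_ @^-1` _]setTI; exact: mG.
by rewrite setIC -[RHS](integral_indic _ mGA) //.
Qed.

Let nu_img A : measurable A -> A `<=` UT -> nu A = mu3 (imgM M A).
Proof.
move=> mA AU; rewrite nuE //; congr (mu3 _); apply/seteqP; split=> p.
  move=> [GA [x Ux Mx]]; exists x => //.
  by rewrite -(GM Ux) Mx pt3K.
move=> [x Ax px]; have Ux : U x by have := AU _ Ax; rewrite /UT /= unpt3K.
by split; [rewrite /= -[p]pt3K px GM|exists x].
Qed.

Let kap_ge Q l : measurable Q -> 0 <= l -> (forall p, Q p -> l <= jacT p) ->
  (l%:E * mu3 Q <= kap Q)%E.
Proof.
move=> mQ l0 hl; have <- := integral_cst mu3 mQ l%:E.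
by apply: ge0_le_integral => //; exact/measurable_EFinP/measurable_funTS.
Qed.

Let kap_le Q l : measurable Q -> 0 <= l -> (forall p, Q p -> jacT p <= l) ->
  (kap Q <= l%:E * mu3 Q)%E.
Proof.
move=> mQ l0 hl; have <- := integral_cst mu3 mQ l%:E.
apply: ge0_le_integral => //; first by move=> p _; rewrite lee_fin.
by apply/measurable_EFinP/measurable_funTS.
Qed.

(** On a small box of the given proportions det J is nearly constant, and [local_sandwich] compares
    the volume of the image with that constant times the volume of the box. *)
Let local_cmp (w x : E) (eps : R) : (forall j, 0 < w 0 j) -> U x -> 0 < eps ->
  exists2 r, 0 < r & forall c s, 0 < s -> s < r -> cbox c (c + s *: w) x ->
    (nu (box c (c + s *: w)) <= (1 + eps)%:E * kap (box c (c + s *: w)))%E /\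
    (kap (box c (c + s *: w)) <= (1 + eps)%:E * nu (box c (c + s *: w)))%E.
Proof.
move=> w0 Ux eps0; pose D0 := \det (J x); have D00 : 0 < D0 by exact: hJ.
(* Then [27 * eta + 6 * (eta * eps) = eps], which leaves room for both [(1 + 2 * eta) ^+ 3 <= (1 +
   eps) * (1 - eta)] and [1 + eta <= (1 + eps) * (1 - 2 * eta) ^+ 3]. *)
pose eta := eps / (27 + 6 * eps).
have k0 : 0 < 27 + 6 * eps by rewrite addr_gt0 // mulr_gt0.
have eta0 : 0 < eta by rewrite divr_gt0.
have etaE : 27 * eta + 6 * (eta * eps) = eps by rewrite /eta; field; rewrite gt_eqF.
have ee0 : 0 < eta * eps by rewrite mulr_gt0.
have eta1 : eta < 6^-1 by rewrite /eta ltr_pdivrMr //; lra.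
clearbody eta.
have uJ : J x \in unitmx by rewrite unitmxE unitfE gt_eqF.
have eta4 : eta < 4^-1 by lra.
have [r1 r10 h1] := local_sandwich (hM Ux) uJ w0 eta0 eta4.
have nA : nbhs (\det (J x)) [set v | `|v - D0| < eta * D0].
  by apply/nbhs_normP_lt; exists (eta * D0) => //; rewrite mulr_gt0.
have nB : nbhs x [set y | `|\det (J y) - D0| < eta * D0] := cdet Ux nA.
have nAB : nbhs x [set y | U y /\ `|\det (J y) - D0| < eta * D0].
  exact: (filterI (open_nbhs_nbhs (conj oU Ux)) nB).
have [r2 r20 h2] := (nbhs_normP_lt _ _).1 nAB.
have W0 : 0 < `|w| by apply: lt_le_trans (le_coord_norm w 0); rewrite gtr0_norm.
exists (Num.min r1 (r2 / `|w|)); first by rewrite lt_min r10 divr_gt0.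
move=> c s s0; rewrite lt_min ltr_pdivlMr // => /andP[sr1 sr2] xc.
have [X1 [X2 [[mX1 mX2] X2Q QX1 muX1 muX2]]] := h1 c s s0 sr1 xc.
set Q := box c (c + s *: w) in X2Q QX1 muX1 muX2 *.
have mQ : measurable Q by exact: measurable_box.
have inQ p : Q p -> U (pt3 p) /\ `|\det (J (pt3 p)) - D0| < eta * D0.
  move=> hp; apply: h2; apply: le_lt_trans sr2.
  apply/normr_rV_le; first by rewrite mulr_ge0 // ltW.
  move=> j; have := hp j; have := xc j; move: (pt3 p) => y; rewrite !mxE.
  move=> /andP[a1 a2] /andP[b1 b2].
  have : s * w 0 j <= s * `|w|.
    by rewrite ler_pM2l // (le_trans (ler_norm _)) // le_coord_norm.
  by rewrite ler_norml => h; apply/andP; split; lra.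
have QU : Q `<=` UT by move=> p /inQ[].
have jQ p : Q p -> (1 - eta) * D0 <= jacT p <= (1 + eta) * D0.
  move=> Qp; have [Up] := inQ p Qp; rewrite -[in jacT p](pt3K p) (jacE Up).
  by rewrite ltr_norml => /andP[a1 a2]; apply/andP; split; lra.
have D0n : `|\det (J x)| = D0 by rewrite gtr0_norm.
have mimg : measurable (imgM M Q).
  have -> : imgM M Q = G @^-1` Q `&` V.
    apply/seteqP; split=> p; last first.
      move=> [GA [y Uy My]]; exists y => //; by rewrite -(GM Uy) My pt3K.
    move=> [y Ay py]; have Uy : U y by have := QU _ Ay; rewrite /UT /= unpt3K.
    by split; [rewrite /= -[p]pt3K py GM|exists y].
  by apply: measurableI => //; rewrite -[_ @^-1` _]setTI; exact: mG.
have mu0 : (0 <= mu3 Q)%E by exact: measure_ge0.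
have pos1 : 0 <= (1 - eta) * D0 by rewrite mulr_ge0 ?(ltW D00) //; lra.
have pos2 : 0 <= (1 + eta) * D0 by rewrite mulr_ge0 ?(ltW D00) //; lra.
have kl := kap_ge mQ pos1 (fun p Qp => (andP (jQ p Qp)).1).
have ku := kap_le mQ pos2 (fun p Qp => (andP (jQ p Qp)).2).
rewrite nu_img //; split.
- apply: (@le_trans _ _ (mu3 X1)); first by apply: le_measure; rewrite ?inE.
  rewrite muX1; apply: (@le_trans _ _ ((1 + eps)%:E * (((1 - eta) * D0)%:E * mu3 Q))%E).
    rewrite muleA -EFinM lee_wpmul2r // lee_fin D0n mulrA ler_pM2r //.
    have c1 : eta ^+ 2 <= eta / 6 by rewrite expr2 ler_pM2l // ltW //; lra.
    have c2 : eta ^+ 3 <= eta / 36.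
      rewrite exprS; have := ler_wpM2l (ltW eta0) c1 => h; apply: le_trans h _; lra.
    have -> : (1 + 2 * eta) ^+ 3 = 1 + 6 * eta + 12 * eta ^+ 2 + 8 * eta ^+ 3 by ring.
    have -> : (1 + eps) * (1 - eta) = 1 + eps - eta - eta * eps by ring.
    lra.
  by rewrite lee_pmul2l // lte_fin addr_gt0.
- apply: (le_trans ku); apply: (@le_trans _ _ ((1 + eps)%:E * mu3 X2)%E); last first.
    rewrite lee_pmul2l ?lte_fin ?addr_gt0 //.
    by apply: le_measure; rewrite ?inE.
  rewrite muX2 muleA -EFinM lee_wpmul2r // lee_fin D0n mulrA ler_pM2r //.
  have -> : (1 - 2 * eta) ^+ 3 = 1 - 6 * eta + 4 * eta ^+ 2 * (3 - 2 * eta) by ring.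
  have c1 : 0 <= 4 * eta ^+ 2 * (3 - 2 * eta).
    by rewrite mulr_ge0 ?mulr_ge0 ?exprn_ge0 ?(ltW eta0) //; lra.
  have c2 : 0 <= eps * (4 * eta ^+ 2 * (3 - 2 * eta)) by rewrite mulr_ge0 // ltW.
  move: c1 c2; move: (4 * eta ^+ 2 * (3 - 2 * eta)) => z c1 c2.
  have -> : (1 + eps) * (1 - 6 * eta + z) = 1 - 6 * eta + z + eps - 6 * (eta * eps) + eps * z.
    by ring.
  lra.
Qed.

Let le_of_eps (x y : \bar R) : (0 <= y)%E ->
  (forall eps, 0 < eps -> (x <= (1 + eps)%:E * y)%E) -> (x <= y)%E.
Proof.
case: y => [y| |//]; last by move=> _ _; exact: leey.
rewrite lee_fin => y0 H; apply/lee_addgt0Pr => e e0.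
have k0 : 0 < e / (y + 1) by rewrite divr_gt0 // ltr_wpDl.
apply: (le_trans (H _ k0)); rewrite -EFinM -EFinD lee_fin mulrDl mul1r lerD2l.
by rewrite mulrAC ler_pdivrMr ?ltr_wpDl // ler_pM2l // lerDl.
Qed.

(** Bisection extends the two local inequalities to the whole box for each [eps], and [eps] then
    tends to zero. *)
Let nu_kap_box (a b : E) : (forall j, a 0 j < b 0 j) -> cbox a b `<=` U ->
  nu (box a b) = kap (box a b).
Proof.
move=> ab abU; have w0 j : 0 < (b - a) 0 j by rewrite !mxE subr_gt0.
have sc (m : {measure set T3 -> \bar R}) (eps : R) (e0 : 0 <= 1 + eps) Q :
    mscale (NngNum e0) m Q = ((1 + eps)%:E * m Q)%E by [].
apply/le_anti/andP; split; apply: le_of_eps => //; try exact: measure_ge0.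
- move=> eps eps0; have e0 : 0 <= 1 + eps by rewrite addr_ge0 // ltW.
  rewrite -(sc kap eps e0).
  apply: (@box_le_bisect R nu (mscale (NngNum e0) kap)) => // x /abU Ux.
  have [r r0 hr] := local_cmp w0 Ux eps0; exists r => // c s s0 sr xc.
  by rewrite [leRHS]sc; exact: (hr c s s0 sr xc).1.
- move=> eps eps0; have e0 : 0 <= 1 + eps by rewrite addr_ge0 // ltW.
  rewrite -(sc nu eps e0).
  apply: (@box_le_bisect R kap (mscale (NngNum e0) nu)) => // x /abU Ux.
  have [r r0 hr] := local_cmp w0 Ux eps0; exists r => // c s s0 sr xc.
  by rewrite [leRHS]sc; exact: (hr c s s0 sr xc).2.
Qed.

Let nu_lty A : measurable A -> (nu A < +oo)%E.
Proof.
move=> mA; rewrite nuE //; apply: le_lt_trans Vfin; apply: le_measure; rewrite ?inE //.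
by apply: measurableI => //; rewrite -[_ @^-1` _]setTI; exact: mG.
Qed.

Let nu_kap_in_box (a b : E) : (forall j, a 0 j < b 0 j) -> cbox a b `<=` U ->
  forall A, measurable A -> nu (A `&` box a b) = kap (A `&` box a b).
Proof.
move=> ab abU A mA; have mB := measurable_box a b.
apply: (@box_measure_unique R (mrestr nu mB) (mrestr kap mB) _ _ A mA) => a' b'; last first.
  by apply: nu_lty; apply: measurableI => //; exact: measurable_box.
rewrite /= /mrestr; have [c [d [-> cd]]] := boxI a' b' a b.
case: (pselect (forall j, c 0 j < d 0 j)) => [cd0|ncd].
  apply: nu_kap_box => // x hx; apply: abU => j; have [h1 h2] := cd j.
  by have /andP[h3 h4] := hx j; rewrite (le_trans h1 h3) (le_trans h4 h2).
have -> : box c d = set0.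
  apply/seteqP; split=> // p h; apply: ncd => j.
  by have /andP[h1 h2] := h j; exact: lt_le_trans h1 h2.
by rewrite !measure0.
Qed.

(** [U] is a countable union of boxes on which the two measures agree. Making the pieces disjoint
    and adding up gives every Borel subset of [U]. *)
Lemma measure_change A : measurable A -> A `<=` UT -> nu A = kap A.
Proof.
move=> mA AU; have [F [UE hF]] := open_box_cover oU.
have mF n : measurable (F n).
  by case: (hF n) => [->//|[a [b [_ _ ->]]]]; exact: measurable_box.
have mS n : measurable (seqDU F n).
  by apply: measurableD => //; apply: bigsetU_measurable.
have AE : A = \bigcup_n (A `&` seqDU F n).
  by rewrite -setI_bigcupr -seqDU_bigcup_eq -UE setIidl.
have mAS n : measurable (A `&` seqDU F n) by exact: measurableI.
have tA : trivIset setT (fun n => A `&` seqDU F n).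
  by apply: trivIset_setIl; exact: trivIset_seqDU.
rewrite AE !measure_semi_bigcup //; try exact: bigcupT_measurable.
apply: eq_eseriesr => n _.
have -> : A `&` seqDU F n = (A `&` seqDU F n) `&` F n.
  by rewrite [RHS]setIidl // => p [_ h]; exact: (subset_seqDU h).
case: (hF n) => [->|[a [b [ab abU ->]]]]; first by rewrite setI0 !measure0.
exact: nu_kap_in_box.
Qed.

Let mMT : measurable_fun UT (fun p => unpt3 (M (pt3 p))).
Proof.
have mc j : measurable_fun UT (fun p : T3 => M (pt3 p) 0 j).
  apply: (@continuous_measurable_on _ U (fun y => M y 0 j) oU) => x Ux.
  exact: sd_continuous (hM Ux j).
have mr : measurable_fun setT (unpt3 \o (fun p : T3 => \row_j ((fun q => M (pt3 q) 0 j) \_ UT) p)).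
  apply: measurable_unpt3 => j; under eq_fun do rewrite mxE.
  by apply/(measurable_restrictT _ mUT); exact: mc.
apply: (eq_measurable_fun _ _ (measurable_funTS mr)) => p pU /=; congr unpt3.
by apply/rowP => j; rewrite mxE /patch pU.
Qed.

Lemma ge0_integral_change (f : T3 -> \bar R) : measurable_fun UT f ->
  (forall p, UT p -> 0 <= f p)%E ->
  (\int[mu3]_(p in V) f (G p) = \int[mu3]_(p in UT) (f p * (jacT p)%:E))%E.
Proof.
move=> mf f0; rewrite -(ge0_integral_densm mu3 mjac jac_ge0 mUT mf f0) -/kap.
rewrite -(@eq_measure_integral _ _ _ UT kap nu f) => [|A mA AU]; last exact: measure_change.
have GV p : V p -> UT (G p).
  by move=> [x Ux Mx]; rewrite -[p]pt3K -Mx GM // /UT /= unpt3K.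
have mGU : measurable (G @^-1` UT) by rewrite -[_ @^-1` _]setTI; exact: mG.
have mfG : measurable_fun (G @^-1` UT) (f \o G).
  apply: (measurable_comp mUT _ mf); last exact: measurable_funTS.
  by move=> _ [p hp <-].
rewrite [RHS](ge0_integral_pushm _ mG) // ge0_integral_densm //; last first.
  by move=> p hp; exact: f0.
have VE : V = G @^-1` UT `&` V by rewrite setIidr // => p /GV.
rewrite {1}VE integral_mkcondr; apply: eq_integral => p _.
by rewrite /patch indicE; case: ifP; rewrite ?mule1 ?mule0.
Qed.

Let maxeM (a c : R) : 0 <= c -> (maxe a%:E 0 * c%:E = maxe (a * c)%:E 0)%E.
Proof. by move=> c0; rewrite -[0%E]/(0%:E) -!EFin_max -EFinM maxr_pMl // mul0r. Qed.

(** Positive and negative parts are transported separately, so both sides come from the same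
    difference of extended reals. *)
Lemma Rintegral_change (f : T3 -> R) : measurable_fun UT f ->
  \int[mu3]_(p in V) f (G p) = \int[mu3]_(p in UT) (f p * jacT p).
Proof.
move=> mf; rewrite /Rintegral; congr fine.
have mE : measurable_fun UT (EFin \o f) by exact/measurable_EFinP.
rewrite integralE [RHS]integralE; congr (_ - _)%E.
- transitivity (\int[mu3]_(p in V) ((EFin \o f)^\+ (G p)))%E.
    by apply: eq_integral => p _; rewrite ?funeposE ?funenegE.
  rewrite ge0_integral_change //; last exact: measurable_funepos.
  by apply: eq_integral => p _; rewrite !funeposE /= maxeM.
- transitivity (\int[mu3]_(p in V) ((EFin \o f)^\- (G p)))%E.
    by apply: eq_integral => p _; rewrite ?funeposE ?funenegE.
  rewrite ge0_integral_change //; last exact: measurable_funeneg.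
  by apply: eq_integral => p _; rewrite !funenegE /= maxeM // mulNr.
Qed.

Lemma change_negligible (A : set T3) : measurable A -> A `<=` UT ->
  mu3 A = 0 -> mu3 (imgM M A) = 0.
Proof.
move=> mA AU A0; rewrite -nu_img // measure_change //.
apply: null_set_integral => //; exact/measurable_EFinP/measurable_funTS.
Qed.

End ChangeOfVariables.

(** * Measurability of the inverse; Lipschitz images of null sets *)

(*@@P12*)
Section Inverse.
Context {R : realType}.
Local Notation E := 'rV[R]_3.
Local Notation R' := (measurableTypeR R).
Local Notation T3 := (R' * R' * R')%type.
Local Notation mu3 := (@mu3 R).

Lemma compactE_closed (A : set E) : compact A -> closed A.
Proof. by apply: compact_closed; exact: norm_hausdorff. Qed.

Lemma compactE_bounded (A : set E) : compact A -> exists2 B, 0 < B & forall x, A x -> `|x| <= B.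
Proof.
move=> /compact_bounded[B [_ hB]]; exists (`|B| + 1); first by rewrite ltr_wpDl.
by move=> x Ax; apply: (hB (`|B| + 1)) => //; rewrite (le_lt_trans (ler_norm B)) // ltrDl.
Qed.

Lemma compactE (A : set E) B : (forall x, A x -> `|x| <= B) -> closed A -> compact A.
Proof.
move=> hB; apply: bounded_closed_compact; exists B; split; first exact: num_real.
by move=> y By x /hB /le_trans; apply; exact: ltW.
Qed.

Lemma measurable_compact (A : set E) : compact A -> measurable (pt3 @^-1` A : set T3).
Proof. by move=> /compactE_closed; exact: measurable_closed. Qed.

Lemma closed_ball0 (r : R) : closed [set x : E | `|x| <= r].
Proof.
apply: (@closed_comp _ _ (fun x : E => `|x|) [set t | t <= r]); last exact: closed_le.
by move=> x _; exact: norm_continuous.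
Qed.

Lemma mu3_bounded (A : set E) B : measurable (pt3 @^-1` A : set T3) ->
  (forall x, A x -> `|x| <= B) -> (mu3 (pt3 @^-1` A) < +oo)%E.
Proof.
move=> mA hB; apply: (@le_lt_trans _ _ (mu3 (box (const_mx (- (B + 1))) (const_mx (B + 1))))).
  apply: le_measure; rewrite ?inE //; first exact: measurable_box.
  move=> p /hB hp j; have := le_trans (le_coord_norm _ j) hp; move: (pt3 p) => x.
  by rewrite ler_norml !mxE => /andP[h1 h2]; apply/andP; split; lra.
exact: mu3_box_lty.
Qed.

Lemma closed_coord_ge (j : 'I_3) (r : R) : closed [set x : E | r <= x 0 j].
Proof.
apply: (@closed_comp _ _ (fun x : E => x 0 j) [set t | r <= t]); last exact: closed_ge.
by move=> x _; exact: sd_continuous (sd_coord j x).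
Qed.

Lemma compact_image (K : set E) (M : E -> E) (F : set E) :
  compact K -> {within K, continuous M} -> closed F -> compact (M @` (K `&` F)).
Proof.
move=> cK cM cF; apply: continuous_compact; last exact: compact_closedI.
by apply: continuous_subspaceW cM; exact: subIsetl.
Qed.

Variables (K : set E) (M : E -> E).
Hypotheses (cK : compact K) (cM : {within K, continuous M}) (iM : {in K &, injective M}).

Definition inv_on : E -> E := 'pinv_(fun=> 0) K M.

Lemma inv_onK x : K x -> inv_on (M x) = x.
Proof. by move=> Kx; rewrite /inv_on pinvKV ?inE. Qed.

Definition invT (p : T3) : T3 :=
  unpt3 (\row_j ((fun q : T3 => inv_on (pt3 q) 0 j) \_ (pt3 @^-1` (M @` K))) p).

Lemma invTK x : K x -> invT (unpt3 (M x)) = unpt3 x.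
Proof.
move=> Kx; congr unpt3; apply/rowP => j; rewrite mxE /patch mem_set.
  by rewrite unpt3K inv_onK.
by rewrite /= unpt3K; exists x.
Qed.

(** Under the inverse, the preimage of a closed half-space is the image under [M] of a compact piece
    of [K], hence compact. *)
Lemma measurable_invT : measurable_fun setT invT.
Proof.
have cMK : compact (M @` K) by exact: continuous_compact.
have mMK := measurable_compact cMK.
apply: measurable_unpt3 => j; under eq_fun do rewrite mxE.
apply/(measurable_restrictT _ mMK) => _.
move=> A mA; have : measurable_fun (pt3 @^-1` (M @` K) : set T3) (fun q : T3 => inv_on (pt3 q) 0 j : R').
  apply: (measurability _ (RGenCInfty.measurableE R)) => _ [_ [r ->] <-].
  have -> : pt3 @^-1` (M @` K) `&` (fun q : T3 => inv_on (pt3 q) 0 j) @^-1` `[r, +oo[ =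
      pt3 @^-1` (M @` (K `&` [set x | r <= x 0 j])) :> set T3.
    apply/seteqP; split=> p.
      move=> [[x Kx Mx]]; rewrite /= in_itv /= andbT -Mx inv_onK // => h.
      by exists x.
    move=> [x [Kx h] Mx]; split; first by exists x.
    by rewrite /= in_itv /= andbT -Mx inv_onK.
  by apply: measurable_compact; apply: compact_image => //; exact: closed_coord_ge.
by apply.
Qed.

(** The measure A -> volume of M(A and N) is compared by bisection with a constant times Lebesgue
    measure restricted to the neighbourhood of [N] of radius 1 / (n + 1). As n grows, these
    neighbourhoods shrink to the closed set [N], which is null. *)
Lemma lipschitz_image_null (N : set E) (L : R) : N `<=` K -> closed N ->
  mu3 (pt3 @^-1` N) = 0 -> 0 < L ->
  (forall y z, N y -> N z -> `|M y - M z| <= L * `|y - z|) ->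
  mu3 (pt3 @^-1` (M @` N)) = 0.
Proof.
move=> NK cN N0 L0 hL.
have cN' : compact N by exact: subclosed_compact cK NK.
have NE : N = K `&` N by rewrite setIidr.
have cMN : compact (M @` N) by rewrite NE; exact: compact_image.
have mMN := measurable_compact cMN; have mN := measurable_compact cN'.
have mI : measurable_fun setT (\1_(pt3 @^-1` (M @` N)) : T3 -> R) by exact: measurable_indic.
have I0 p : 0 <= (\1_(pt3 @^-1` (M @` N)) : T3 -> R) p by rewrite indicE.
pose m1 := pushm (densm mu3 mI I0) measurable_invT.
have m1E A : measurable A -> m1 A = mu3 (imgM M (A `&` pt3 @^-1` N)).
  move=> mA; have mGA : measurable (invT @^-1` A).
    by rewrite -[_ @^-1` _]setTI; exact: measurable_invT.
  transitivity (mu3 (pt3 @^-1` (M @` N) `&` invT @^-1` A)).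
    by rewrite -[RHS](integral_indic _ mGA).
  congr (mu3 _); apply/seteqP; split=> p.
    move=> [[x Nx Mx] hA]; exists x => //; split; last by rewrite /= unpt3K.
    by rewrite -invTK; [rewrite Mx pt3K|exact: NK].
  move=> [x [Ax]]; rewrite /= unpt3K => Nx px; split; first by exists x.
  by rewrite /= -[p]pt3K px invTK //; exact: NK.
have [B B0 hB] := compactE_bounded cN'.
pose a : E := const_mx (- (B + 1)); pose b : E := const_mx (B + 1).
have ab j : a 0 j < b 0 j by rewrite !mxE; lra.
pose Nr n : set E := [set y | exists2 x, N x & `|y - x| < n.+1%:R^-1].
have oNr n : open (Nr n).
  rewrite openE => y [x Nx yx]; apply/nbhs_normP_lt.
  exists (n.+1%:R^-1 - `|y - x|); first by rewrite subr_gt0.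
  move=> z zy; exists x => //; rewrite -(subrK y z) -addrA (le_lt_trans (ler_normD _ _)) //.
  by rewrite -ltrBrDr.
have mNr n := measurable_open (oNr n).
pose F n : set T3 := box a b `&` pt3 @^-1` Nr n.
have mF n : measurable (F n) by apply: measurableI => //; exact: measurable_box.
have C0 : 0 <= (2 * L * 2) ^+ 3 by rewrite exprn_ge0 // !mulr_ge0 // ltW.
have NB p : N (pt3 p) -> box a b p.
  move=> /hB hp j; have := le_trans (le_coord_norm _ j) hp; move: (pt3 p) => x.
  by rewrite ler_norml !mxE => /andP[h1 h2]; apply/andP; split; lra.
(* With D equal to [L] times the side of a small cube, the image of the part of [N] in that cube
   lies in a cube of half side 2 * D about one image point. Its side is 4 * L times the original
   one, whence the constant; the spare factor 2 accommodates the half-open faces. *)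
have key n : (m1 (box a b) <= ((2 * L * 2) ^+ 3)%:E * mu3 (F n))%E.
  have -> : (((2 * L * 2) ^+ 3)%:E * mu3 (F n))%E =
      mscale (NngNum C0) (mrestr mu3 (mNr n)) (box a b) by [].
  apply: (@box_le_bisect R m1 (mscale (NngNum C0) (mrestr mu3 (mNr n)))) => // x _.
  have scE Q : mscale (NngNum C0) (mrestr mu3 (mNr n)) Q =
    (((2 * L * 2) ^+ 3)%:E * mu3 (Q `&` pt3 @^-1` Nr n))%E by [].
  have dj j : (b - a) 0 j = 2 * (B + 1) by rewrite !mxE; ring.
  have cE (c : E) s j : (c + s *: (b - a)) 0 j = c 0 j + s * (2 * (B + 1)).
    by rewrite mxE [X in _ + X]mxE dj.
  have inb c s y z : 0 < s -> cbox c (c + s *: (b - a)) y -> cbox c (c + s *: (b - a)) z ->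
      `|y - z| <= s * (2 * (B + 1)).
    move=> s0 hy hz; apply/normr_rV_le; first by rewrite !mulr_ge0 ?ltW //; lra.
    move=> j; have := hy j; have := hz j.
    rewrite cE.
    by rewrite !mxE ler_norml => /andP[h1 h2] /andP[h3 h4]; apply/andP; split; lra.
  have bc c s y : box c (c + s *: (b - a)) (unpt3 y) -> cbox c (c + s *: (b - a)) y.
    by move=> h j; have := h j; rewrite unpt3K => /andP[/ltW -> ->].
  have B10 : 0 < 2 * (B + 1) by lra.
  (* Near a point of [N] a small box lies entirely in the neighbourhood, so restricting changes
     nothing. Near any other point a small box misses the closed set [N] and its image is empty. *)
  have [Nx|Nx] := pselect (N x).
    exists (n.+1%:R^-1 / (2 * (B + 1))); first by rewrite divr_gt0.
    move=> c s s0; rewrite ltr_pdivlMr // => sr xc; rewrite [leRHS]scE m1E; last exact: measurable_box.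
    set Q := box c _.
    have -> : Q `&` pt3 @^-1` Nr n = Q.
      rewrite setIidl // => p Qp; exists x => //; apply: le_lt_trans sr.
      by apply: (inb c s) => //; apply: bc; rewrite pt3K.
    have sL : 0 < s * (2 * (B + 1)) * L by apply: mulr_gt0 => //; exact: mulr_gt0.
    case: (pselect (exists y, Q (unpt3 y) /\ N y)) => [[y [Qy Ny]]|nQ]; last first.
      rewrite (_ : imgM _ _ = set0) ?measure0 ?mule_ge0 //.
      apply/seteqP; split=> // p [y [Qy]]; rewrite /= unpt3K => Ny _.
      by apply: nQ; exists y.
    pose D := s * (2 * (B + 1)) * L.
    apply: (@le_trans _ _ (mu3 (box (M y - const_mx (2 * D)) (M y + const_mx (2 * D))))).
      apply: le_measure; rewrite ?inE; last first.
      - move=> p [z [Qz]]; rewrite /= unpt3K => Nz pz j; rewrite pz.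
        have h := hL z y Nz Ny; have h2 := inb c s z y s0 (bc _ _ _ Qz) (bc _ _ _ Qy).
        have := le_trans (le_coord_norm _ j) (le_trans h (ler_wpM2l (ltW L0) h2)).
        rewrite mulrC -/D !mxE ler_norml => /andP[h3 h4]; have D0 : 0 < D by [].
        by apply/andP; split; lra.
      - exact: measurable_box.
      - have -> : imgM M (Q `&` pt3 @^-1` N) = pt3 @^-1` (M @` N) `&` invT @^-1` Q.
          apply/seteqP; split=> p.
            move=> [z [Qz]]; rewrite /= unpt3K => Nz pz; split; first by exists z.
            by rewrite /= -[p]pt3K pz invTK //; exact: NK.
          move=> [[z Nz Mz] hQ]; exists z => //; split; last by rewrite /= unpt3K.
          by rewrite -invTK; [rewrite Mz pt3K|exact: NK].
        apply: measurableI => //; rewrite -[_ @^-1` _]setTI.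
        by apply: measurable_invT => //; exact: measurable_box.
    rewrite !mu3_box; last first.
    - by move=> j; rewrite !mxE; have : 0 < D by []; lra.
    - by move=> j; rewrite cE lerDl mulr_ge0 // ltW.
    rewrite -EFinM lee_fin !prod_ord3 !cE !mxE /D le_eqVlt; apply/orP; left; apply/eqP; ring.
  have /nbhs_normP_lt[r r0 hr] : nbhs x (~` N).
    by apply: open_nbhs_nbhs; split => //; rewrite openC.
  exists (r / (2 * (B + 1))); first by rewrite divr_gt0.
  move=> c s s0; rewrite ltr_pdivlMr // => sr xc; rewrite m1E; last exact: measurable_box.
  rewrite (_ : imgM _ _ = set0) ?measure0 ?[leRHS]scE ?mule_ge0 //.
  apply/seteqP; split=> // p [y [Qy]]; rewrite /= unpt3K => Ny _.
  by apply: (hr y) => //; apply: le_lt_trans sr; apply: (inb c s) => //; exact: bc.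
have capF : \bigcap_n F n = pt3 @^-1` N.
  apply/seteqP; split=> [p hp|p Np n _]; last first.
    by split; [exact: NB|exists (pt3 p) => //; rewrite subrr normr0].
  apply: cN => A /nbhs_normP_lt[e e0 hA].
  have [n hn] : exists n, n.+1%:R^-1 < e :> R.
    exists (Num.truncn e^-1); rewrite -[ltRHS]invrK ltf_pV2 ?posrE ?invr_gt0 //.
    exact: truncnS_gt.
  have [_ [x Nx hx]] := hp n I; exists x; split => //; apply: hA.
  by rewrite distrC (lt_trans hx).
have cvF : mu3 \o F @ \oo --> mu3 (\bigcap_n F n).
  apply: nonincreasing_cvg_mu => //.
  - apply: (@le_lt_trans _ _ (mu3 (box a b))); last exact: mu3_box_lty.
    by apply: le_measure; rewrite ?inE; [exact: mF|exact: measurable_box|move=> p []].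
  - by rewrite capF.
  - move=> m n mn; apply/subsetPset => p [h [x Nx hx]]; split => //; exists x => //.
    by apply: lt_le_trans hx _; rewrite lef_pV2 ?posrE // ler_nat ltnS.
have m10 : m1 (box a b) = 0.
  apply/le_anti/andP; split; last exact: measure_ge0.
  rewrite capF N0 in cvF.
  have -> : 0%E = (((2 * L * 2) ^+ 3)%:E * 0)%E :> \bar R by rewrite mule0.
  have cv : (((2 * L * 2) ^+ 3)%:E * (mu3 \o F) n)%E @[n --> \oo] --> (((2 * L * 2) ^+ 3)%:E * 0)%E.
    by apply: cvgeZl.
  by rewrite -(cvg_lim _ cv) //; apply: lime_ge; [apply/cvg_ex; eexists; exact: cv|exact: nearW].
rewrite -m10 m1E; last exact: measurable_box.
congr (mu3 _); apply/seteqP; split=> p.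
  move=> [x Nx Mx]; exists x => //; split; last by rewrite /= unpt3K.
  by apply: NB; rewrite unpt3K.
by move=> [x [_]]; rewrite /= unpt3K => Nx px; exists x.
Qed.

End Inverse.

(** * Simplices: compactness and null boundary *)

(*@@P13*)
Section Cells.
Context {R : realType}.
Local Notation E := 'rV[R]_3.
Local Notation R' := (measurableTypeR R).
Local Notation T3 := (R' * R' * R')%type.
Local Notation mu3 := (@mu3 R).
Variable v : 'I_4 -> E.
Hypothesis nd : Defs.nondegenerate v.

Let S : set E := Defs.hull v [set: 'I_4]%SET.
Let W : 'M[R]_3 := \matrix_(a < 3) (v (lift ord0 a) - v ord0).
(** The barycentric coordinates of x for the three vertices other than [v ord0]. *)
Let bary (x : E) : E := (x - v ord0) *m invmx W.

Let uW : W \in unitmx. Proof. by rewrite unitmxE unitfE. Qed.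

Let rowW (w : E) : w *m W = \sum_a w 0 a *: (v (lift ord0 a) - v ord0).
Proof.
rewrite mulmx_sum_row; apply: eq_bigr => a _; congr (_ *: _).
by apply/rowP => j; rewrite !mxE.
Qed.

Lemma simplexP x : S x <-> (forall a, 0 <= bary x 0 a) /\ \sum_a bary x 0 a <= 1.
Proof.
split=> [[c [c0 _ c1 xE]]|[w0 w1]].
  have -> : bary x = \row_a c (lift ord0 a).
    have xv : x - v ord0 = \sum_l c l *: (v l - v ord0).
      rewrite xE; under [RHS]eq_bigr do rewrite scalerBr.
      by rewrite sumrB -scaler_suml c1 scale1r.
    apply: (can_inj (mulmxK uW)); rewrite mulmxKV // rowW xv big_ord_recl subrr scaler0 add0r.
    by apply: eq_bigr => a _; rewrite mxE.
  split=> [a|]; first by rewrite mxE.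
  under eq_bigr do rewrite mxE.
  by move: c1; rewrite big_ord_recl /= => <-; rewrite lerDr.
exists (fun l => if unlift ord0 l is Some a then bary x 0 a else 1 - \sum_a bary x 0 a).
split=> [l|l||].
- by case: unliftP => [a _|_] //; rewrite subr_ge0.
- by rewrite inE.
- rewrite big_ord_recl unlift_none [X in _ + X](eq_bigr (fun a => bary x 0 a)) ?subrK //.
  by move=> a _; rewrite liftK.
- rewrite big_ord_recl unlift_none.
  rewrite [X in _ + X](eq_bigr (fun a => bary x 0 a *: v (lift ord0 a))); last first.
    by move=> a _; rewrite liftK.
  have h : \sum_a bary x 0 a *: v (lift ord0 a) - (\sum_a bary x 0 a) *: v ord0 = x - v ord0.
    rewrite scaler_suml -sumrB -[RHS](mulmxKV uW) -/(bary x) rowW.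
    by apply: eq_bigr => a _; rewrite scalerBr.
  by rewrite scalerBl scale1r addrAC -addrA h addrC subrK.
Qed.

Let sdbary a x : sd (fun x => bary x 0 a) x (\row_i invmx W i a).
Proof.
move=> e e0; exists 1 => // y z _ _.
suff -> : bary y 0 a - bary z 0 a = dot (y - z) (\row_i invmx W i a).
  by rewrite subrr normr0 mulr_ge0 // ltW.
rewrite !mxE -sumrB; apply: eq_bigr => i _; rewrite !mxE -mulrBl; congr (_ * _).
by ring.
Qed.

Lemma simplex_closed : closed S.
Proof.
have -> : S = (\bigcap_(a in setT) [set x | 0 <= bary x 0 a]) `&`
    [set x | \sum_a bary x 0 a <= 1].
  apply/seteqP; split=> x.
    by move=> /simplexP[h1 h2]; split => // a _; exact: h1.
  by move=> [h1 h2]; apply/simplexP; split => // a; exact: h1.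
apply: closedI.
  apply: closed_bigI => a _.
  apply: (@closed_comp _ _ (fun x : E => bary x 0 a) [set t | 0 <= t]); last exact: closed_ge.
  by move=> x _; exact: sd_continuous (sdbary a x).
apply: (@closed_comp _ _ (fun x : E => \sum_a bary x 0 a) [set t | t <= 1]); last exact: closed_le.
move=> x _; have [g hg] : exists g, sd (fun x => \sum_a bary x 0 a) x g.
  by apply: sd_sum => a; eexists; exact: sdbary.
exact: sd_continuous hg.
Qed.

Lemma simplex_bounded : exists B, forall x, S x -> `|x| <= B.
Proof.
exists (\sum_l `|v l|) => x [c [c0 _ c1 ->]].
rewrite (le_trans (ler_norm_sum _ _ _)) //; apply: ler_sum => l _.
rewrite normrZ ger0_norm // ler_piMl // -c1 (bigD1 l) //= lerDl.
exact: sumr_ge0.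
Qed.

Lemma simplex_compact : compact S.
Proof. by have [B hB] := simplex_bounded; apply: (compactE hB); exact: simplex_closed. Qed.

Lemma hull_convex (x y : E) t : S x -> S y -> 0 <= t -> t <= 1 -> S (t *: x + (1 - t) *: y).
Proof.
move=> [c [c0 cA c1 xE]] [c' [c'0 c'A c'1 yE]] t0 t1.
exists (fun l => t * c l + (1 - t) * c' l); split=> [l|l|/=|].
- by rewrite addr_ge0 // mulr_ge0 // subr_ge0.
- by rewrite inE.
- by rewrite big_split /= -!mulr_sumr c1 c'1; ring.
- rewrite xE yE !scaler_sumr -big_split; apply: eq_bigr => l _.
  by rewrite /= !scalerA scalerDl.
Qed.

(** The barycentre, all of whose barycentric coordinates are 1 / 4. *)
Let center : E := v ord0 + const_mx 4^-1 *m W.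

Lemma simplex_inner_ball : exists2 r, 0 < r & forall y, `|y| <= r -> S (center + y).
Proof.
have [c c0 hc] := mx_bound (invmx W).
have k0 : 0 < 12 * (3 * c + 1) by rewrite mulr_gt0 // ltr_wpDl ?mulr_ge0.
exists (12 * (3 * c + 1))^-1; first by rewrite invr_gt0.
(* A perturbation by at most 1 / 12 keeps the three coordinates positive and their sum at most 3 *
   (1 / 4 + 1 / 12) = 1. *)
move=> y hy; have small a : `|(y *m invmx W) 0 a| <= 12^-1.
  rewrite (le_trans (le_coord_norm _ a)) // (le_trans (norm_mulmx_le _ c0 hc)) //.
  apply: (@le_trans _ _ ((3 * c + 1) * (12 * (3 * c + 1))^-1)).
    by rewrite ler_pM ?mulr_ge0 // lerDl.
  rewrite invfM mulrCA divff ?mulr1 // gt_eqF // ltr_wpDl ?mulr_ge0 //.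
have bE a : bary (center + y) 0 a = 4^-1 + (y *m invmx W) 0 a.
  rewrite /bary.
  have -> : center + y - v ord0 = const_mx 4^-1 *m W + y.
    by rewrite /center addrAC [v ord0 + _]addrC addrK.
  by rewrite mulmxDl mulmxK // !mxE.
apply/simplexP; split=> [a|].
  by rewrite bE; have := small a; rewrite ler_norml => /andP[h _]; lra.
rewrite sum_ord3 !bE; move: (small 0) (small 1) (small 2); rewrite !ler_norml.
by move=> /andP[_ h0] /andP[_ h1] /andP[_ h2]; lra.
Qed.

Let shrink t x : 0 <= t -> t < 1 -> S x -> S° (center + t *: (x - center)).
Proof.
move=> t0 t1 Sx; have [r r0 hr] := simplex_inner_ball.
apply/nbhs_normP_lt; exists ((1 - t) * r); first by rewrite mulr_gt0 // subr_gt0.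
move=> y hy; have s0 : 0 < 1 - t by rewrite subr_gt0.
pose z := (1 - t)^-1 *: (y - (center + t *: (x - center))).
have hz : `|z| <= r.
  by rewrite normrZ normfV gtr0_norm // mulrC ler_pdivrMr // mulrC ltW.
have -> : y = t *: x + (1 - t) *: (center + z).
  rewrite scalerDr /z scalerA divff ?scale1r ?gt_eqF //.
  by apply/rowP => j; rewrite !mxE; ring.
by apply: hull_convex (hr z hz) t0 (ltW t1).
Qed.

(** The limit t -> 1, carried out with one explicit value of t. *)
Lemma cube_scaling_le (m m' : R) :
  (forall t, 0 < t -> t < 1 -> m * t ^+ 3 <= m') -> 0 <= m' -> m <= m'.
Proof.
move=> key' m'0.
rewrite leNgt; apply/negP => mm'.
have mp : 0 < m by exact: le_lt_trans mm'.
(* By Bernoulli, m * (1 - u) ^ 3 >= m - 3 * m * u, and with this [u] the loss is half of the gap m -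
   m'. *)
pose u := (m - m') / (6 * m).
have u0 : 0 < u by rewrite divr_gt0 ?subr_gt0 // mulr_gt0.
have u1 : u < 1 by rewrite /u ltr_pdivrMr ?mulr_gt0 // mul1r; lra.
have uE : m * u = (m - m') / 6 by rewrite /u; field; rewrite gt_eqF.
have t0 : 0 < 1 - u by rewrite subr_gt0.
have t1 : 1 - u < 1 by rewrite ltrBlDr ltrDl.
have := key' _ t0 t1.
have -> : m * (1 - u) ^+ 3 = m - 3 * (m * u) + m * u * u * (2 + (1 - u)) by ring.
have : 0 <= m * u * u * (2 + (1 - u)) 
  by rewrite mulr_ge0 ?(mulr_ge0 (mulr_ge0 (ltW mp) (ltW u0)) (ltW u0)) //; lra.
by rewrite uE => h1 h2; lra.
Qed.

(** Contracting the simplex towards its barycentre by a factor t < 1 maps it into its interior, so t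
    ^ 3 times its volume is at most that of the interior. Letting t tend to 1 shows that the two
    volumes agree. *)
Lemma simplex_boundary_null : mu3 (pt3 @^-1` (S `\` S°)) = 0.
Proof.
have mS := measurable_compact simplex_compact.
have oS : open S° by exact: open_interior.
have mSi := measurable_open oS.
have [B hB] := simplex_bounded.
have Sfin := mu3_bounded mS hB.
have SiS : S° `<=` S by exact: interior_subset.
have le1 : (mu3 (pt3 @^-1` S°) <= mu3 (pt3 @^-1` S))%E.
  by apply: le_measure; rewrite ?inE // => p; exact: SiS.
have unshrink t (y : E) : 0 < t ->
    center + t *: (t^-1 *: (y - center) + center - center) = y.
  by move=> t0; rewrite addrK scalerA divff ?gt_eqF // scale1r addrC subrK.
have key t : 0 < t -> t < 1 -> (mu3 (pt3 @^-1` S) * (t ^+ 3)%:E <= mu3 (pt3 @^-1` S°))%E.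
  move=> t0 t1; pose A : 'M[R]_3 := (t^-1)%:M.
  have dA : `|\det A| = t ^- 3 by rewrite det_scalar exprVn gtr0_norm // invr_gt0 exprn_gt0.
  have uA : A \in unitmx by rewrite unitmxE unitfE -normr_eq0 dA invr_neq0 // expf_neq0 // gt_eqF.
  pose B' : set T3 := transp center @^-1` (pt3 @^-1` S).
  have mB' : measurable B' by rewrite -[B']setTI; exact: measurable_transp.
  have := mu3_affine (- center) uA mB'; rewrite (mu3_trans center mS) dA => <-.
  rewrite -muleA -EFinM mulVf ?expf_neq0 ?gt_eqF // mule1.
  apply: le_measure; rewrite ?inE //.
    have -> : (fun p : T3 => unpt3 ((pt3 p + - center) *m A)) = mulp A \o transp (- center).
      by apply/funext => p; rewrite /mulp /transp /= unpt3K.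
    by rewrite -[_ @^-1` _]setTI; apply: (measurableT_comp (measurable_mulp A) (measurable_transp _)).
  move=> p; rewrite /B' /transp /= !unpt3K mul_mx_scalar => h.
  by have := shrink (ltW t0) t1 h; rewrite unshrink.
have eqm : mu3 (pt3 @^-1` S) = mu3 (pt3 @^-1` S°).
  apply/le_anti; rewrite le1 andbT.
  have fS : mu3 (pt3 @^-1` S) \is a fin_num by rewrite ge0_fin_numE.
  have fSi : mu3 (pt3 @^-1` S°) \is a fin_num.
    by rewrite ge0_fin_numE //; exact: le_lt_trans Sfin.
  have keyR t : 0 < t -> t < 1 ->
      fine (mu3 (pt3 @^-1` S)) * t ^+ 3 <= fine (mu3 (pt3 @^-1` S°)).
    by move=> t0 t1; rewrite -lee_fin EFinM (fineK fS) (fineK fSi) key.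
  have m'0 : 0 <= fine (mu3 (pt3 @^-1` S°)) by exact: fine_ge0.
  rewrite -(fineK fS) -(fineK fSi) lee_fin.
  exact: cube_scaling_le keyR m'0.
have -> : pt3 @^-1` (S `\` S°) = pt3 @^-1` S `\` pt3 @^-1` S° :> set T3 by [].
transitivity (mu3 (pt3 @^-1` S) - mu3 (pt3 @^-1` S°))%E; last first.
  by rewrite -eqm subee // ge0_fin_numE.
by rewrite [LHS]measureD // setIidr // => p; exact: SiS.
Qed.

End Cells.

(** * Dominated convergence and affine substitution for real-valued integrals *)

(*@@P14*)
Lemma Rdct d (T : measurableType d) (R : realType) (mu : {measure set T -> \bar R})
    (f_ : nat -> T -> R) (f g : T -> R) :
  (forall n, measurable_fun setT (f_ n)) -> measurable_fun setT f ->
  {ae mu, forall x, f_ ^~ x @ \oo --> f x} -> mu.-integrable setT (EFin \o g) ->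
  {ae mu, forall x n, `|f_ n x| <= g x} ->
  mu.-integrable setT (EFin \o f) /\
  (\int[mu]_x f_ n x) @[n --> \oo] --> \int[mu]_x f x.
Proof.
move=> mf_ mf ff ig fg.
have mE n : measurable_fun setT (EFin \o f_ n) by exact/measurable_EFinP.
have mE' : measurable_fun setT (EFin \o f) by exact/measurable_EFinP.
have ffE : {ae mu, forall x, setT x -> (EFin \o f_ n) x @[n --> \oo] --> (EFin \o f) x}.
  by apply: filterS ff => x h _; apply: cvg_EFin h; exact: nearW.
have fgE : {ae mu, forall x n, setT x -> (`|(EFin \o f_ n) x| <= (EFin \o g) x)%E}.
  by apply: filterS fg => x h n _; rewrite /= lee_fin.
have [if_ _ h] := dominated_convergence measurableT mE mE' ffE ig fgE.
split=> //; apply: fine_cvg; rewrite /Rintegral fineK //.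
exact: integrable_fin_num.
Qed.

Section Mollify.
Context {R : realType}.
Local Notation E := 'rV[R]_3.
Local Notation R' := (measurableTypeR R).
Local Notation T3 := (R' * R' * R')%type.
Local Notation mu3 := (@mu3 R).
Implicit Types (f g : E -> R) (x y z v : E).

Lemma measurable_ball0 (r : R) : measurable (pt3 @^-1` [set x : E | `|x| <= r] : set T3).
Proof. by apply: measurable_closed; exact: closed_ball0. Qed.

Lemma integrable_bounded_support (h : T3 -> R) B r : measurable_fun setT h ->
  (forall p, `|h p| <= B) -> (forall p, r < `|pt3 p| -> h p = 0) ->
  mu3.-integrable setT (EFin \o h).
Proof.
move=> mh hB h0; have mQ := measurable_ball0 r.
have -> : EFin \o h = (EFin \o h) \_ (pt3 @^-1` [set x : E | `|x| <= r]).
  apply/funext => p; rewrite patchE; case: ifPn => //.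
  by rewrite notin_setE /= => /negP; rewrite -ltNge => /h0 /= ->.
apply/(integrable_mkcond _ mQ).1.
apply: measurable_bounded_integrable => //.
- exact: (@mu3_bounded _ _ r).
- exact: measurable_funTS.
- exists B; split; first exact: num_real.
  by move=> M BM p _; rewrite /= (le_trans (hB p)) // ltW.
Qed.

Definition affT (A : 'M[R]_3) v (p : T3) : T3 := unpt3 ((pt3 p + v) *m A).

Lemma measurable_affT A v : measurable_fun setT (affT A v).
Proof.
rewrite (_ : affT A v = mulp A \o transp v).
  by apply: measurableT_comp; [exact: measurable_mulp|exact: measurable_transp].
by apply/funext => p; rewrite /affT /= /mulp /transp unpt3K.
Qed.

Lemma ge0_integral_affT (A : 'M[R]_3) v (h : T3 -> \bar R) : A \in unitmx ->
  measurable_fun setT h -> (forall p, 0 <= h p)%E ->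
  (\int[mu3]_p h p = `|\det A|%:E * \int[mu3]_p h (affT A v p))%E.
Proof.
move=> uA mh h0; have mf := measurable_affT A v.
have -> : (\int[mu3]_p h (affT A v p) = \int[pushm mu3 mf]_p h p)%E.
  by rewrite ge0_integral_pushm.
rewrite -(ge0_integral_mscale (pushm mu3 mf) measurableT (NngNum (normr_ge0 (\det A)))) //.
apply: eq_measure_integral => B mB _ /=.
by rewrite /mscale /= muleC; exact/esym/(mu3_affine v uA mB).
Qed.

Lemma Rintegral_affT (A : 'M[R]_3) v (h : T3 -> R) : A \in unitmx ->
  mu3.-integrable setT (EFin \o h) ->
  mu3.-integrable setT (EFin \o (h \o affT A v)) /\
  \int[mu3]_p h p = `|\det A| * \int[mu3]_p h (affT A v p).
Proof.
move=> uA ih; have mf := measurable_affT A v.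
have mE := measurable_int _ ih.
have mh : measurable_fun setT h by exact/measurable_EFinP.
have d0 : 0 < `|\det A| by rewrite normr_gt0 -unitfE.
have mh' : measurable_fun setT (EFin \o (h \o affT A v)).
  by apply/measurable_EFinP; exact: measurableT_comp.
have ih' : mu3.-integrable setT (EFin \o (h \o affT A v)).
  apply/integrableP; split=> //.
  have /integrableP[_] := ih.
  rewrite (ge0_integral_affT v uA) //; last exact: measurableT_comp.
  set X := (\int[_]_p _)%E => hX; rewrite -/X ltNge leye_eq; apply/eqP => Xoo.
  by move: hX; rewrite -/X Xoo gt0_muley.
split=> //; rewrite /Rintegral integralE [in RHS]integralE.
have mp : measurable_fun setT ((EFin \o h)^\+)%E by exact: measurable_funepos.
have mn : measurable_fun setT ((EFin \o h)^\-)%E by exact: measurable_funeneg.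
rewrite (ge0_integral_affT v uA mp) // (ge0_integral_affT v uA mn) //.
have -> : (\int[mu3]_p ((fun p => (h (affT A v p))%:E)^\+ p) =
  \int[mu3]_p ((EFin \o h)^\+ (affT A v p)))%E.
  by apply: eq_integral => p _; rewrite !funeposE.
have -> : (\int[mu3]_p ((fun p => (h (affT A v p))%:E)^\- p) =
  \int[mu3]_p ((EFin \o h)^\- (affT A v p)))%E.
  by apply: eq_integral => p _; rewrite !funenegE.
have fp := integrable_pos_fin_num measurableT ih'.
have fn := integrable_neg_fin_num measurableT ih'.
have -> : (\int[mu3]_p ((EFin \o h)^\+ (affT A v p)) =
  \int[mu3]_p ((EFin \o (h \o affT A v))^\+ p))%E.
  by apply: eq_integral => p _; rewrite !funeposE.
have -> : (\int[mu3]_p ((EFin \o h)^\- (affT A v p)) =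
  \int[mu3]_p ((EFin \o (h \o affT A v))^\- p))%E.
  by apply: eq_integral => p _; rewrite !funenegE.
by rewrite -(fineK fp) -(fineK fn) -!EFinM -!EFinB /= mulrBr.
Qed.

End Mollify.

(** * Integration by parts through difference quotients *)

(*@@P15*)
Section IBP.
Context {R : realType}.
Local Notation E := 'rV[R]_3.
Local Notation R' := (measurableTypeR R).
Local Notation T3 := (R' * R' * R')%type.
Local Notation mu3 := (@mu3 R).
Implicit Types (x y z v : E).

(** The denominators start at 2, so that every step is strictly below [t0]. *)
Definition step (t0 : R) (m : nat) : R := t0 / m.+2%:R.

Lemma step_gt0 t0 m : 0 < t0 -> 0 < step t0 m.
Proof. by move=> t00; rewrite divr_gt0. Qed.

Lemma step_lt t0 m : 0 < t0 -> step t0 m < t0.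
Proof. by move=> t00; rewrite ltr_pdivrMr // ltr_pMr // ltr1n. Qed.

Lemma step_cvg0 t0 : step t0 @ \oo --> (0 : R).
Proof.
rewrite -[X in _ --> X](mulr0 t0); apply: cvgM; first exact: cvg_cst.
apply: (@cvg_comp _ _ _ S (fun n : nat => n.+1%:R^-1)); last exact: cvg_harmonic.
by move=> A [n _ h]; exists n => // m nm; apply: h => /=; exact: leqW.
Qed.

Lemma cvg_step (f : R -> R) (a c t0 : R) : 0 < t0 -> c != 0 -> f @ 0^' --> a ->
  f (c * step t0 m) @[m --> \oo] --> a.
Proof.
move=> t00 c0; apply: (@cvg_comp _ _ _ (fun m => c * step t0 m)) => A A0.
have /(_ _ A0) : (fun m => c * step t0 m) @ \oo --> (0 : R).
  by rewrite -[X in _ --> X](mulr0 c); apply: cvgM; [exact: cvg_cst|exact: step_cvg0].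
move=> [n _ h]; exists n => // m nm; apply: (h m nm).
by rewrite mulf_neq0 // gt_eqF // step_gt0.
Qed.

Definition quot (psi : E -> R) (l : 'I_3) x (t : R) : R :=
  t^-1 * (psi (x + t *: dir l) - psi x).

Lemma quot_bound (psi : E -> R) l x (t L : R) : t != 0 ->
  `|psi (x + t *: dir l) - psi x| <= L * `|t| -> `|quot psi l x t| <= L.
Proof.
move=> t0 h; rewrite /quot normrM normfV mulrC ler_pdivrMr ?normr_gt0 //.
Qed.

Lemma derivable_quot (f : E -> R) (l : 'I_3) x : derivable f x (dir l) ->
  quot f l x @ 0^' --> partial l f x.
Proof.
move=> df; rewrite (_ : quot f l x = (fun h => h^-1 *: ((f \o shift x) (h *: dir l) - f x))).
  exact: df.
by apply/funext => h; rewrite /quot /= [h *: _ + x]addrC.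
Qed.

Lemma transp_affT v : transp v = @affT R 1%:M v.
Proof. by apply/funext => p; rewrite /affT mulmx1. Qed.

Lemma Rintegral_transp v (h : T3 -> R) : mu3.-integrable setT (EFin \o h) ->
  \int[mu3]_p h p = \int[mu3]_p h (transp v p).
Proof.
move=> ih; have u1 : (1%:M : 'M[R]_3) \in unitmx by exact: unitmx1.
by have [_ ->] := Rintegral_affT v u1 ih; rewrite det1 normr1 mul1r transp_affT.
Qed.

(** Translation invariance moves the difference quotient from [theta] to [psi], and dominated
    convergence passes to the limit on both sides. Hence [psi] only has to satisfy a Lipschitz bound
    for short steps and be differentiable in direction [l] almost everywhere. *)
Lemma integral_by_parts (psi theta dtheta : E -> R) (dpsi : T3 -> R) (l : 'I_3)
    (B Bt L Lt r t0 : R) :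
  0 < t0 -> measurable_on setT psi -> measurable_on setT theta ->
  measurable_on setT dtheta -> measurable_fun setT dpsi ->
  (forall x, `|psi x| <= B) -> (forall x, r < `|x| -> psi x = 0) ->
  (forall x, `|theta x| <= Bt) ->
  (forall x t, `|t| < t0 -> `|psi (x + t *: dir l) - psi x| <= L * `|t|) ->
  (forall x t, `|theta (x + t *: dir l) - theta x| <= Lt * `|t|) ->
  {ae mu3, forall p, quot psi l (pt3 p) @ 0^' --> dpsi p} ->
  (forall x, quot theta l x @ 0^' --> dtheta x) ->
  \int[mu3]_p (psi (pt3 p) * dtheta (pt3 p)) = - \int[mu3]_p (dpsi p * theta (pt3 p)).
Proof.
rewrite /measurable_on !preimage_setT => t00 mpsi mtheta mdt mdpsi hB psi0 hBt Lpsi Ltheta dpsiE dthetaE.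
have B0 : 0 <= B by exact: le_trans (normr_ge0 _) (hB 0).
have Bt0 : 0 <= Bt by exact: le_trans (normr_ge0 _) (hBt 0).
have L0 : 0 <= L.
  have := le_trans (normr_ge0 _) (Lpsi 0 (step t0 0) _).
  by rewrite gtr0_norm ?step_gt0 // step_lt // => /(_ isT); rewrite pmulr_lge0 ?step_gt0.
have Lt0 : 0 <= Lt.
  have := le_trans (normr_ge0 _) (Ltheta 0 (step t0 0)).
  by rewrite gtr0_norm ?step_gt0 // pmulr_lge0 ?step_gt0.
have mtr (f : E -> R) v : measurable_fun setT (f \o pt3) ->
    measurable_fun setT (fun p : T3 => f (pt3 p + v)).
  move=> mf; rewrite (_ : (fun p => _) = (f \o pt3) \o transp v); last first.
    by apply/funext => p /=; rewrite /transp unpt3K.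
  by apply: measurableT_comp => //; exact: measurable_transp.
(* Forward quotients of [theta] correspond to backward quotients of [psi], whence the factor [- 1]
   in [H]. *)
pose F m (p : T3) := psi (pt3 p) * quot theta l (pt3 p) (1 * step t0 m).
pose H m (p : T3) := quot psi l (pt3 p) (- 1 * step t0 m) * theta (pt3 p).
have st0 m : step t0 m != 0 by rewrite gt_eqF ?step_gt0.
have bsup c h (b : R) : measurable_fun setT (h : T3 -> R) -> 0 <= b ->
    (forall p, `|h p| <= c) -> mu3.-integrable setT
      (EFin \o (fun p => h p * (if `|pt3 p| <= b then 1 else 0))).
  move=> mh b0 hc; apply: (@integrable_bounded_support _ _ c b).
  - apply: measurable_funM => //.
    rewrite (_ : (fun _ => _) = \1_(pt3 @^-1` [set x : E | `|x| <= b])).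
      by apply: measurable_indic; exact: measurable_ball0.
    apply/funext => p; rewrite indicE; case: ifPn => hp; first by rewrite mem_set.
    by rewrite memNset //=; exact/negP.
  - move=> p; case: ifP => _; first by rewrite mulr1.
    by rewrite mulr0 normr0 (le_trans (normr_ge0 _) (hc p)).
  - by move=> p bp; rewrite leNgt bp /= mulr0.
have iB (f g : T3 -> R) : mu3.-integrable setT (EFin \o f) ->
    mu3.-integrable setT (EFin \o g) -> mu3.-integrable setT (EFin \o (fun p => f p - g p)).
  by move=> hf hg; exact: (integrableB measurableT hf hg).
have FH m : \int[mu3]_p F m p = \int[mu3]_p - H m p.
  pose s := step t0 m.
  have i1 : mu3.-integrable setT (EFin \o (fun p => psi (pt3 p) * theta (pt3 p))).
    apply: (@integrable_bounded_support _ _ (B * Bt) r); first exact: measurable_funM.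
      by move=> p; rewrite normrM ler_pM.
    by move=> p rp; rewrite psi0 // mul0r.
  have i2 : mu3.-integrable setT (EFin \o (fun p => psi (pt3 p) * theta (pt3 p + s *: dir l))).
    apply: (@integrable_bounded_support _ _ (B * Bt) r).
    - by apply: measurable_funM => //; exact: mtr.
    - by move=> p; rewrite normrM ler_pM.
    - by move=> p rp; rewrite psi0 // mul0r.
  have i3 : mu3.-integrable setT (EFin \o (fun p => psi (pt3 p - s *: dir l) * theta (pt3 p))).
    apply: (@integrable_bounded_support _ _ (B * Bt) (r + `|s *: (dir l : E)|)).
    - by apply: measurable_funM => //; exact: mtr.
    - by move=> p; rewrite normrM ler_pM.
    - move=> p rp; rewrite psi0 ?mul0r // -(ltrD2r `|s *: (dir l : E)|) (lt_le_trans rp) //.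
      by rewrite (le_trans _ (ler_normD _ _)) // subrK.
  transitivity (s^-1 * (\int[mu3]_p (psi (pt3 p) * theta (pt3 p + s *: dir l)) -
      \int[mu3]_p (psi (pt3 p) * theta (pt3 p)))).
    rewrite -RintegralB // -RintegralZl //; last exact: iB.
    by apply: eq_Rintegral => p _; rewrite /F /quot mul1r mulrCA mulrBr.
  rewrite [X in X - _](Rintegral_transp (- (s *: dir l)) i2) /=.
  transitivity (s^-1 * (\int[mu3]_p (psi (pt3 p - s *: dir l) * theta (pt3 p)) -
      \int[mu3]_p (psi (pt3 p) * theta (pt3 p)))).
    by congr (_ * (_ - _)); apply: eq_Rintegral => p _; rewrite /transp unpt3K subrK.
  rewrite -RintegralB // -RintegralZl //; last exact: iB.
  apply: eq_Rintegral => p _; rewrite /H /quot mulN1r scaleNr invrN -/s.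
  by rewrite !mulNr opprK -mulrBl mulrA.
have [_ cF] : mu3.-integrable setT (EFin \o (fun p => psi (pt3 p) * dtheta (pt3 p))) /\
    (\int[mu3]_p F m p) @[m --> \oo] --> \int[mu3]_p (psi (pt3 p) * dtheta (pt3 p)).
  apply: (@Rdct _ _ _ mu3 F _ (fun p => (B * Lt) * (if `|pt3 p| <= `|r| then 1 else 0))).
  - move=> m; apply: measurable_funM => //; apply: measurable_funM => //.
    by apply: measurable_funB => //; exact: mtr.
  - exact: measurable_funM.
  - by apply: aeW => p; apply: cvgM; [exact: cvg_cst|exact: cvg_step].
  - by apply: (@bsup (B * Lt)) => // p; rewrite normrM !ger0_norm.
  - apply: aeW => p m; case: ifPn => [_|].
      by rewrite mulr1 normrM ler_pM // quot_bound // mul1r.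
    rewrite -ltNge => /(le_lt_trans (ler_norm r)) rp.
    by rewrite /F psi0 // mul0r mulr0 normr0.
have [idt cH] : mu3.-integrable setT (EFin \o (fun p => - (dpsi p * theta (pt3 p)))) /\
    (\int[mu3]_p - H m p) @[m --> \oo] --> \int[mu3]_p - (dpsi p * theta (pt3 p)).
  apply: (@Rdct _ _ _ mu3 (fun m p => - H m p) _
    (fun p => (L * Bt) * (if `|pt3 p| <= `|r| + t0 then 1 else 0))).
  - move=> m; apply: measurableT_comp => //; apply: measurable_funM => //; apply: measurable_funM => //.
    by apply: measurable_funB => //; exact: mtr.
  - by apply: measurableT_comp => //; exact: measurable_funM.
  - apply: filterS dpsiE => p dp; apply: cvgN; apply: cvgM; last exact: cvg_cst.
    by apply: cvg_step => //; rewrite oppr_eq0 oner_eq0.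
  - by apply: (@bsup (L * Bt)) => // [|p]; [rewrite addr_ge0 // ltW|rewrite normrM !ger0_norm].
  - apply: aeW => p m; rewrite normrN; case: ifPn => [_|].
      rewrite mulr1 normrM ler_pM // quot_bound ?mulN1r ?oppr_eq0 //.
      by apply: Lpsi; rewrite normrN gtr0_norm ?step_gt0 // step_lt.
    rewrite -ltNge => rp; have rp' : r < `|pt3 p|.
      by rewrite (le_lt_trans (ler_norm r)) // (lt_trans _ rp) // ltrDl.
    rewrite /H /quot (psi0 _ rp') psi0 ?subrr ?mulr0 ?mul0r ?normr0 //.
    rewrite (le_lt_trans (ler_norm r)) // -(ltrD2r t0) (lt_le_trans rp) //.
    rewrite mulN1r scaleNr -lerBlDr.
    rewrite (le_trans _ (lerB_normD _ _)) // normrN lerB // normrZ norm_dir mulr1.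
    by rewrite gtr0_norm ?step_gt0 // ltW // step_lt.
have -> : - (\int[mu3]_p (dpsi p * theta (pt3 p))) = \int[mu3]_p - (dpsi p * theta (pt3 p)).
  apply/eqP; rewrite eqr_oppLR -mulN1r -RintegralZl //; apply/eqP.
  by apply: eq_Rintegral => p _; rewrite mulN1r opprK.
apply: (cvg_unique _ cF); first exact: Rhausdorff.
by rewrite (funext FH); exact: cH.
Qed.

End IBP.

(** * Linearity and Fubini for real-valued integrals *)

(*@@P16*)
Section RealIntegrals.
Context d (T : measurableType d) (R : realType) (mu : {measure set T -> \bar R}).
Implicit Types (f g h : T -> R) (D : set T).

Lemma integrableDR D f g : measurable D -> mu.-integrable D (EFin \o f) ->
  mu.-integrable D (EFin \o g) -> mu.-integrable D (EFin \o (fun x => f x + g x)).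
Proof. by move=> mD hf hg; exact: (integrableD mD hf hg). Qed.

Lemma integrableBR D f g : measurable D -> mu.-integrable D (EFin \o f) ->
  mu.-integrable D (EFin \o g) -> mu.-integrable D (EFin \o (fun x => f x - g x)).
Proof. by move=> mD hf hg; exact: (integrableB mD hf hg). Qed.

Lemma integrableZR D f (a : R) : measurable D -> mu.-integrable D (EFin \o f) ->
  mu.-integrable D (EFin \o (fun x => a * f x)).
Proof. by move=> mD hf; exact: (integrableZl mD a hf). Qed.

Lemma integrable_sumR D (I : Type) (s : seq I) (f : I -> T -> R) : measurable D ->
  (forall i, mu.-integrable D (EFin \o f i)) ->
  mu.-integrable D (EFin \o (fun x => \sum_(i <- s) f i x)).
Proof.
move=> mD hf; elim: s => [|i s IH].
  rewrite (_ : EFin \o _ = cst 0%E); last by apply/funext => x; rewrite /= big_nil.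
  exact: integrable0.
rewrite (_ : (fun x => _) = (fun x => f i x + \sum_(j <- s) f j x)).
  exact: integrableDR.
by apply/funext => x; rewrite big_cons.
Qed.

Lemma Rintegral_sum D (I : Type) (s : seq I) (f : I -> T -> R) : measurable D ->
  (forall i, mu.-integrable D (EFin \o f i)) ->
  \int[mu]_(x in D) (\sum_(i <- s) f i x) = \sum_(i <- s) \int[mu]_(x in D) f i x.
Proof.
move=> mD hf; elim: s => [|i s IH].
  rewrite big_nil (eq_Rintegral _ (g := cst 0)) ?Rintegral_cst ?mul0r //.
  by move=> x _; rewrite big_nil.
rewrite big_cons -IH -RintegralD //; last exact: integrable_sumR.
by apply: eq_Rintegral => x _; rewrite big_cons.
Qed.

Lemma integrable_mul_bounded D f h (B : R) : measurable D ->
  mu.-integrable D (EFin \o f) -> measurable_fun D h ->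
  (forall x, D x -> `|h x| <= B) -> mu.-integrable D (EFin \o (fun x => f x * h x)).
Proof.
move=> mD hf mh hB; apply: (le_integrable mD _ _ (integrableZR B mD hf)).
  apply/measurable_EFinP; apply: measurable_funM => //.
  by apply/measurable_EFinP; exact: measurable_int hf.
by move=> x Dx; rewrite /= lee_fin !normrM mulrC ler_wpM2r // (le_trans (hB x Dx)) // ler_norm.
Qed.

End RealIntegrals.

Section RealFubini.
Context d1 d2 (T1 : measurableType d1) (T2 : measurableType d2) (R : realType).
Variables (m1 : {sigma_finite_measure set T1 -> \bar R}).
Variables (m2 : {sigma_finite_measure set T2 -> \bar R}).
Local Notation m12 := (m1 \x m2)%E.

Lemma integrable_prod (u : T1 -> R) (v : T2 -> R) :
  m1.-integrable setT (EFin \o u) -> m2.-integrable setT (EFin \o v) ->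
  m12.-integrable setT (EFin \o (fun pq : T1 * T2 => u pq.1 * v pq.2)).
Proof.
move=> iu iv.
have mu : measurable_fun setT u by apply/measurable_EFinP; exact: measurable_int iu.
have mv : measurable_fun setT v by apply/measurable_EFinP; exact: measurable_int iv.
apply/integrable12ltyP.
  by apply/measurable_EFinP; apply: measurable_funM; exact: measurableT_comp.
have /integrableP[_ iv'] := iv; have /integrableP[_ iu'] := iu.
have f0 : (0 <= \int[m2]_y `|(EFin \o v) y|)%E by exact: integral_ge0.
have mv' : measurable_fun setT (fun y => `|(EFin \o v) y|)%E.
  by apply: measurableT_comp => //; exact/measurable_EFinP.
have mu' : measurable_fun setT (fun y => `|(EFin \o u) y|)%E.
  by apply: measurableT_comp => //; exact/measurable_EFinP.
rewrite (eq_integral (fun x => `|(u x)%:E| * \int[m2]_y `|(v y)%:E|)%E); last first.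
  move=> x _; rewrite -ge0_integralZl //.
  by apply: eq_integral => y _; rewrite /= normrM EFinM.
rewrite ge0_integralZr //; apply: lte_mul_pinfty => //; first exact: integral_ge0.
by rewrite ge0_fin_numE //; exact: integral_ge0.
Qed.

(** Integrability of every slice lets the real-valued inner integral stand for the extended one. *)
Lemma Rintegral12 (f : T1 * T2 -> R) : m12.-integrable setT (EFin \o f) ->
  (forall x, m2.-integrable setT (EFin \o (fun y => f (x, y)))) ->
  \int[m1]_x \int[m2]_y f (x, y) = \int[m12]_z f z.
Proof.
move=> hf hx; rewrite /Rintegral; congr fine.
rewrite -(integral12_prod_meas1 hf); apply: eq_integral => x _.
by rewrite fineK //; exact: (integrable_fin_num measurableT (hx x)).
Qed.

Lemma Rintegral21 (f : T1 * T2 -> R) : m12.-integrable setT (EFin \o f) ->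
  (forall y, m1.-integrable setT (EFin \o (fun x => f (x, y)))) ->
  \int[m2]_y \int[m1]_x f (x, y) = \int[m12]_z f z.
Proof.
move=> hf hy; rewrite /Rintegral; congr fine.
rewrite -(integral21_prod_meas1 hf); apply: eq_integral => y _.
by rewrite fineK //; exact: (integrable_fin_num measurableT (hy y)).
Qed.

End RealFubini.

(** * Smooth functions of bounded support *)

(*@@P17*)
Section Smooth.
Context {R : realType}.
Local Notation E := 'rV[R]_3.
Implicit Types (f g : E -> R) (x y z : E).

Definition smooth f := forall n, Ck_on setT n f.

Lemma smooth_continuous f x : smooth f -> {for x, continuous f}.
Proof. by move=> /(_ 0%N)[+ _]; apply. Qed.

Lemma smooth_partial f l : smooth f -> smooth (partial l f).
Proof. by move=> sf n; have [_ /(_ l)[]] := sf n.+1. Qed.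

Lemma smooth_sd f x : smooth f -> sd f x (grad f x).
Proof. by move=> sf; exact: C1_sd. Qed.

Lemma smooth_derivable f x l : smooth f -> derivable f x (dir l).
Proof. by move=> /smooth_sd h; have [] := sd_partial l (h x). Qed.

Lemma sd_affine f (c : R) y x (g : E) : sd f (c *: (x - y)) g ->
  sd (fun z => f (c *: (z - y))) x (c *: g).
Proof.
move=> h; have hM : sdm (fun z => c *: (z - y)) x c%:M.
  move=> j; rewrite (_ : (fun z => _) = (fun z => c * (z 0 j + (- y 0 j)))); last first.
    by apply/funext => z; rewrite !mxE.
  have := sd_Z c (sdD (sd_coord j x) (sd_cst (- y 0 j) x)).
  rewrite addr0 (_ : c *: _ = \row_i (c%:M : 'M[R]_3) i j) //.
  by apply/rowP => i; rewrite !mxE eqxx /= mulr_natr.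
have := sd_comp hM h; rewrite (_ : g *m _ = c *: g) //.
by rewrite tr_scalar_mx mul_mx_scalar.
Qed.

Lemma partial_affine f (c : R) y x l : smooth f ->
  partial l (fun z => f (c *: (z - y))) x = c * partial l f (c *: (x - y)).
Proof.
move=> sf; have [_ ->] := sd_partial l (sd_affine (smooth_sd (c *: (x - y)) sf)).
by rewrite !mxE.
Qed.

Lemma smooth_affine f (c : R) y : smooth f -> smooth (fun x => f (c *: (x - y))).
Proof.
(* A scalar factor is inserted and then generalised, since each differentiation multiplies it by
   [c]. *)
move=> sf n; rewrite (_ : (fun x => _) = (fun x => 1 * f (c *: (x - y)))); last first.
  by apply/funext => x; rewrite mul1r.
elim: n f sf 1 => [|n IH] f sf a; (split; [move=> x _|]); rewrite //.
- exact: sd_continuous (sd_Z a (sd_affine (smooth_sd _ sf))).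
- exact: sd_continuous (sd_Z a (sd_affine (smooth_sd _ sf))).
move=> l; split=> [x _|].
  by have [] := sd_partial l (sd_Z a (sd_affine (smooth_sd (c *: (x - y)) sf))).
rewrite (_ : partial l _ = (fun x => (a * c) * partial l f (c *: (x - y)))).
  exact/IH/smooth_partial.
apply/funext => x.
have [_ ->] := sd_partial l (sd_Z a (sd_affine (smooth_sd (c *: (x - y)) sf))).
by rewrite !mxE mulrA.
Qed.

Lemma Ck_onD n f g : Ck_on setT n f -> Ck_on setT n g -> Ck_on setT n (fun x => f x + g x).
Proof.
elim: n f g => [|n IH] f g [cf hf] [cg hg]; (split; [move=> x _|]); rewrite //.
- exact: (continuousD (cf x I) (cg x I)).
- exact: (continuousD (cf x I) (cg x I)).
move=> l; have [df Cf] := hf l; have [dg Cg] := hg l; split.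
  by move=> x _; apply: derivableD; [exact: df|exact: dg].
rewrite (_ : partial l _ = (fun x => partial l f x + partial l g x)); first exact: IH.
by apply/funext => x; rewrite /partial deriveD //; [exact: df|exact: dg].
Qed.

Lemma smoothM f g : smooth f -> smooth g -> smooth (fun x => f x * g x).
Proof.
move=> + + n; elim: n f g => [|n IH] f g sf sg; (split; [move=> x _|]); rewrite //.
- by apply: continuousM; exact: smooth_continuous.
- by apply: continuousM; exact: smooth_continuous.
move=> l; split.
  by move=> x _; apply: derivableM; exact: smooth_derivable.
rewrite (_ : partial l _ = (fun x => f x * partial l g x + g x * partial l f x)).
  by apply: Ck_onD; apply: IH => //; exact: smooth_partial.
by apply/funext => x; rewrite /partial deriveM //; exact: smooth_derivable.
Qed.

Lemma continuous_bounded_support f r : continuous f -> (forall x, r < `|x| -> f x = 0) ->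
  exists2 B, 0 <= B & forall x, `|f x| <= B.
Proof.
move=> cf f0; have cK : compact [set x : E | `|x| <= r].
  by apply: (compactE (B := r)) => //; exact: closed_ball0.
have : compact (f @` [set x : E | `|x| <= r]).
  by apply: continuous_compact => //; exact: continuous_subspaceT.
move=> /compact_bounded[B [_ hB]]; exists (`|B| + 1); first by rewrite addr_ge0.
move=> x; have [xr|rx] := leP `|x| r; last by rewrite f0 // normr0 addr_ge0.
by apply: (hB (`|B| + 1)); [rewrite (le_lt_trans (ler_norm B)) // ltrDl|exists x].
Qed.

Lemma partial_support f l r : (forall x, r < `|x| -> f x = 0) ->
  forall x, r < `|x| -> partial l f x = 0.
Proof.
move=> f0 x rx; have : sd f x 0.
  apply: (sd_local (r := `|x| - r) _ _ (sd_cst 0 x)); first by rewrite subr_gt0.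
  move=> y yx; rewrite /cst f0 //.
  rewrite ltrBrDr -ltrBrDl in yx; apply: lt_le_trans yx _.
  by rewrite lerBlDr distrC -{1}(subrK y x) addrC ler_normD.
by move=> /(sd_partial l)[_ ->]; rewrite mxE.
Qed.

Lemma smooth_support_bounds f r : smooth f -> (forall x, r < `|x| -> f x = 0) ->
  exists2 B, 0 <= B & [/\ forall x, `|f x| <= B, forall x l, `|partial l f x| <= B &
    forall x y, `|f x - f y| <= B * `|x - y|].
Proof.
move=> sf f0.
have [B B0 hB] : exists2 B, 0 <= B & forall x, `|f x| <= B.
  by apply: (@continuous_bounded_support f r) => // x; exact: smooth_continuous.
have hp l : exists2 B, 0 <= B & forall x, `|partial l f x| <= B.
  apply: (@continuous_bounded_support _ r); last exact: partial_support.
  by move=> x; apply: smooth_continuous; exact: smooth_partial.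
have [Bp Bp0 hBp] : exists2 B, 0 <= B & forall x l, `|partial l f x| <= B.
  have [B0' p0 h0] := hp 0; have [B1 p1 h1] := hp 1; have [B2 p2 h2] := hp 2.
  exists (B0' + B1 + B2); first by rewrite !addr_ge0.
  move=> x; apply: ord3P.
  - by rewrite (le_trans (h0 x)) // -addrA lerDl addr_ge0.
  - by rewrite (le_trans (h1 x)) // addrAC lerDr addr_ge0.
  - by rewrite (le_trans (h2 x)) // lerDr addr_ge0.
exists (B + 3 * Bp); first by rewrite addr_ge0 // mulr_ge0.
split=> [x|x l|x y].
- by rewrite (le_trans (hB x)) // lerDl mulr_ge0.
- by rewrite (le_trans (hBp x l)) // ler_wpDl // ler_peMl // ler1n.
have : `|f x - f y| <= 3 * Bp * `|x - y|.
  by apply: bounded_partial_lip => // w l; split; [exact: smooth_derivable|exact: hBp].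
by move=> /le_trans; apply; rewrite ler_wpM2r // lerDr.
Qed.

(** Compactness gives a uniform distance between [K] and the complement of [P]; it keeps translated
    kernels and short segments inside [P]. *)
Lemma compact_margin (K P : set E) : compact K -> open P -> K `<=` P ->
  exists2 e, 0 < e & forall y x, K y -> `|x - y| <= e -> P x.
Proof.
move=> /compact_near_coveringP cK oP KP.
have : \forall e \near (0 : R)^'+, K `<=` (fun y => forall x, `|x - y| <= e -> P x).
  apply: cK => y Ky; have /nbhs_normP_lt[r r0 hr] : nbhs y P by apply: open_nbhs_nbhs; split=> //; exact: KP.
  have r20 : 0 < r / 2 by rewrite divr_gt0.
  exists ([set z | `|z - y| < r / 2], [set e : R | e < r / 2]).
    split => /=; first by apply/nbhs_normP_lt; exists (r / 2).
    exact: nbhs_right_lt.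
  move=> [z e] [/= zy er] x xz; apply: hr.
  rewrite (splitr r) -(subrK z x) -addrA (le_lt_trans (ler_normD _ _)) //.
  by rewrite ltrD // (le_lt_trans xz).
move=> h; near (0 : R)^'+ => e; exists e; first by near: e; exact: nbhs_right_gt.
by move=> y x Ky; apply: (near h e).
Unshelve. all: by end_near. Qed.

Lemma test_fun_bump (P : set E) f (c r : R) y : smooth f ->
  (forall x, r < `|x| -> f x = 0) -> 0 < c ->
  (forall x, `|x - y| <= r / c -> P x) -> test_fun P (fun x => f (c *: (x - y))).
Proof.
move=> sf f0 c0 hP.
have clF : closed [set x | `|x - y| <= r / c].
  apply: (@closed_comp _ _ (fun x : E => `|x - y|) [set t | t <= r / c]); last exact: closed_le.
  move=> x _; apply: (@continuous_comp _ _ _ (fun x : E => x - y) Num.norm).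
    apply: (@continuousB _ _ _ (fun x : E => x) (fun=> y)); first exact: cvg_id.
    exact: cst_continuous.
  exact: norm_continuous.
have sub : closure [set x | f (c *: (x - y)) != 0] `<=` [set x | `|x - y| <= r / c].
  rewrite [X in _ `<=` X](closure_id _).1 //; apply: closure_subset => x /=.
  apply: contraNT; rewrite -ltNge ltr_pdivrMr // => h; apply/eqP/f0.
  by rewrite normrZ gtr0_norm // mulrC.
split; first exact: smooth_affine.
  apply: (@compactE _ _ (r / c + `|y|)); last exact: closed_closure.
  by move=> x /sub /= h; rewrite -[x](subrK y) (le_trans (ler_normD _ _)) // lerD2r.
by move=> x /sub; exact: hP.
Qed.

End Smooth.

(** * The divergence identity for Lipschitz test functions *)

(*@@P18*)
Section LipschitzTest.
Context {R : realType}.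
Local Notation E := 'rV[R]_3.
Local Notation R' := (measurableTypeR R).
Local Notation T3 := (R' * R' * R')%type.
Local Notation mu3 := (@mu3 R).
Local Notation mu33 := (mu3 \x mu3)%E.
Implicit Types (f : E -> R) (x y z : E).

(** On a set of finite measure 1 + f ^ 2 is an integrable bound for the absolute value of f. *)
Lemma L2_integrable (A : set E) f : measurable (pt3 @^-1` A : set T3) ->
  (mu3 (pt3 @^-1` A) < +oo)%E -> L2 A f -> mu3.-integrable (pt3 @^-1` A) (EFin \o (f \o pt3)).
Proof.
move=> mA Afin [mf]; rewrite [X in (X < _)%E -> _](_ : _ =
  \int[mu3]_(p in pt3 @^-1` A) ((f (pt3 p)) ^+ 2)%:E)%E // => f2.
have i2 : mu3.-integrable (pt3 @^-1` A) (EFin \o (fun p => f (pt3 p) ^+ 2)).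
  apply/integrableP; split; first by apply/measurable_EFinP; exact: measurable_funX.
  by under eq_integral do rewrite /= ger0_norm ?sqr_ge0 //.
have i1 : mu3.-integrable (pt3 @^-1` A) (EFin \o (fun=> 1 : R)).
  apply: measurable_bounded_integrable => //; exact: bounded_cst.
apply: (le_integrable mA _ _ (integrableDR mA i1 i2)).
  exact/measurable_EFinP.
move=> p Ap; rewrite /= lee_fin [leRHS]ger0_norm ?addr_ge0 ?sqr_ge0 //.
rewrite -(real_normK (num_real (f (pt3 p)))) -subr_ge0.
by have := sqr_ge0 (`|f (pt3 p)| - 1); have := normr_ge0 (f (pt3 p)); nra.
Qed.

Lemma continuous_measurable f : continuous f -> measurable_on setT f.
Proof. by move=> cf; apply: continuous_measurable_on; [exact: openT|move=> x _; exact: cf]. Qed.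

Lemma smooth_measurable f : smooth f -> measurable_on setT f.
Proof. by move=> sf; apply: continuous_measurable => x; exact: smooth_continuous. Qed.

Lemma measurable_on_patch (A : set E) f : measurable (pt3 @^-1` A : set T3) ->
  measurable_on A f -> measurable_on setT (f \_ A).
Proof.
move=> mA mf; rewrite /measurable_on preimage_setT.
rewrite (_ : _ \o _ = (f \o pt3) \_ (pt3 @^-1` A)); first exact/(measurable_restrictT _ mA).
apply/funext => p; rewrite /= !patchE.
by rewrite (_ : (p \in pt3 @^-1` A) = (pt3 p \in A)).
Qed.

Lemma measurable_comb f (a : R) : measurable_on setT f ->
  measurable_fun setT (fun pz : T3 * T3 => f (pt3 pz.1 + a *: pt3 pz.2)).
Proof.
rewrite /measurable_on preimage_setT => mf.
pose h (pz : T3 * T3) : E := pt3 pz.1 + a *: pt3 pz.2.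
rewrite (_ : (fun pz => _) = (f \o pt3) \o (unpt3 \o h)); last first.
  by apply/funext => pz /=; rewrite unpt3K.
apply: measurableT_comp => //; apply: measurable_unpt3 => j.
rewrite [X in measurable_fun _ X](_ : _ = (fun pz : T3 * T3 => pt3 pz.1 0 j + a * pt3 pz.2 0 j)); last first.
  by apply/funext => pz; rewrite /h; move: (pt3 pz.1) (pt3 pz.2) => x y; rewrite !mxE.
apply: measurable_funD; last apply: measurable_funM => //.
  by apply: (measurableT_comp (measurable_coord j)).
by apply: (measurableT_comp (measurable_coord j)).
Qed.

Lemma Rintegral_null_diff (A B : set T3) (f : T3 -> R) : measurable A -> measurable B ->
  A `<=` B -> mu3 (B `\` A) = 0%E -> mu3.-integrable B (EFin \o f) ->
  \int[mu3]_(p in B) f p = \int[mu3]_(p in A) f p.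
Proof.
move=> mA mB AB BA0 hf; rewrite /Rintegral; congr fine.
rewrite (negligible_integral (N := B `\` A)) //; first last.
  exact: measurableD.
by rewrite setDD setIidr.
Qed.

(** The setting: the field [d] has weak divergence [g] on [P]; [psi] vanishes off the compact set
    [K], satisfies a Lipschitz bound along the axes, and has gradient [G] on the open set [U] of
    full measure in [P]; [rho] is a mollifier that need not be normalised. Below, [F] and [Gp] are
    [d] and [g] extended by zero off [U]. *)
Variables (P U K : set E) (bP bK : R) (d : E -> E) (g psi : E -> R) (G : E -> E).
Variables (t0 L : R) (rho : E -> R) (r : R).
Hypotheses (oP : open P) (hbP : forall x, P x -> `|x| <= bP).
Hypotheses (oU : open U) (UP : U `<=` P) (PU0 : mu3 (pt3 @^-1` (P `\` U)) = 0%E).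
Hypotheses (hd : L2v P d) (hg : is_div P d g).
Hypotheses (cK : compact K) (hbK : forall x, K x -> `|x| <= bK) (KP : K `<=` P).
Hypotheses (cpsi : continuous psi) (psi0 : forall x, ~ K x -> psi x = 0).
Hypotheses (t00 : 0 < t0) (Lpsi : forall l x t, `|t| < t0 ->
  `|psi (x + t *: dir l) - psi x| <= L * `|t|).
Hypothesis hG : forall x, U x -> sd psi x (G x).
Hypotheses (srho : smooth rho) (rho0 : forall x, r < `|x| -> rho x = 0).

Let UT : set T3 := pt3 @^-1` U.
Let PT : set T3 := pt3 @^-1` P.
Let mUT : measurable UT. Proof. exact: measurable_open. Qed.
Let mPT : measurable PT. Proof. exact: measurable_open. Qed.
Let PTfin : (mu3 PT < +oo)%E. Proof. exact: mu3_bounded hbP. Qed.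

Let F l (p : T3) : R := ((fun p => d (pt3 p) 0 l) \_ UT) p.
Let Gp (p : T3) : R := ((fun p => g (pt3 p)) \_ UT) p.

Let iF l : mu3.-integrable setT (EFin \o F l).
Proof.
rewrite (_ : EFin \o _ = (EFin \o (fun p => d (pt3 p) 0 l)) \_ UT); last first.
  by apply/funext => p; rewrite /F /= !patchE; case: ifP.
apply/(integrable_mkcond _ mUT).1/(integrableS mPT mUT) => [p|]; first exact: UP.
exact: L2_integrable (hd l).
Qed.

Let iG : mu3.-integrable setT (EFin \o Gp).
Proof.
rewrite (_ : EFin \o _ = (EFin \o (fun p => g (pt3 p))) \_ UT); last first.
  by apply/funext => p; rewrite /Gp /= !patchE; case: ifP.
apply/(integrable_mkcond _ mUT).1/(integrableS mPT mUT) => [p|]; first exact: UP.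
exact: L2_integrable (hg.1).
Qed.

Let dpsi l : E -> R := (fun x => G x 0 l) \_ U.

Let cG l x : U x -> {for x, continuous (fun y => G y 0 l)}.
Proof.
move=> Ux A /nbhs_normP_lt[e e0 hA]; have e20 : 0 < e / 2 by rewrite divr_gt0.
have nU : nbhs x U by exact: open_nbhs_nbhs.
have near_sd : \near x, sd psi x (G x) by apply: filterS nU => y; exact: hG.
have := sd_grad_near e20 (hG Ux) near_sd; apply: filterS => y h; apply: hA.
have := le_coord_norm (G y - G x) l; rewrite !mxE => h'.
by rewrite (le_lt_trans h') // (le_lt_trans h) // ltr_pdivrMr // ltr_pMr // ltr1n.
Qed.

Let cdpsi l x : U x -> {for x, continuous (dpsi l)}.
Proof.
move=> Ux; have nU : nbhs x U by exact: open_nbhs_nbhs.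
have E1 y : U y -> dpsi l y = G y 0 l by move=> Uy; rewrite /dpsi patchE mem_set.
suff : dpsi l y @[y --> x] --> dpsi l x by [].
rewrite E1 //; have h : G y 0 l @[y --> x] --> G x 0 l by exact: cG.
apply: cvg_trans h.
have FF : Filter (nbhs x) by exact: nbhs_filter.
apply: near_eq_cvg; apply: (@filterS _ _ FF U _ _ nU) => y Uy; by rewrite E1.
Qed.

Let mdpsi l : measurable_on setT (dpsi l).
Proof.
by apply: measurable_on_patch => //; apply: continuous_measurable_on => // x; exact: cG.
Qed.

Let mpsi : measurable_on setT psi.
Proof. exact: continuous_measurable. Qed.

Let psi_support x : bK < `|x| -> psi x = 0.
Proof. by move=> h; apply: psi0 => /hbK; rewrite leNgt h. Qed.

(** Outside [P] the function [psi] vanishes in a neighbourhood, so its derivative there is the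
    default value 0 of [dpsi]. Only points of the null set between [U] and [P] are left out. *)
Let quot_dpsi l x : U x \/ ~ P x -> quot psi l x t @[t --> 0^'] --> dpsi l x.
Proof.
case=> [Ux|Px].
  rewrite /dpsi patchE mem_set //.
  by have [dx <-] := sd_partial l (hG Ux); exact: derivable_quot.
have Ux : ~ U x by move=> /UP.
rewrite /dpsi patchE memNset //.
have : sd psi x 0.
  have nK : nbhs x (~` K).
    apply: open_nbhs_nbhs; split; last by move=> /KP.
    by rewrite openC; exact: compactE_closed.
  have [s s0 hs] := (nbhs_normP_lt x _).1 nK.
  by apply: (sd_local s0 _ (sd_cst 0 x)) => y /hs /psi0 ->.
by move=> /(sd_partial l)[/derivable_quot h pE]; rewrite pE mxE in h.
Qed.

Let L0 : 0 <= L.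
Proof.
have := le_trans (normr_ge0 _) (Lpsi 0 0 (_ : `|t0 / 2| < t0)).
rewrite gtr0_norm ?divr_gt0 // ltr_pdivrMr // ltr_pMr // ltr1n => /(_ isT).
by rewrite pmulr_lge0 ?divr_gt0.
Qed.

Let dpsi_bound l x : `|dpsi l x| <= L.
Proof.
have [Ux|Ux] := pselect (U x); last by rewrite /dpsi patchE memNset // normr0.
have := @cvg_step _ _ _ 1 _ t00 (oner_neq0 R) (@quot_dpsi l x (or_introl Ux)).
move=> /cvg_norm; apply: (closed_cvg (fun t : R => t <= L) (@closed_le R L)).
apply: nearW => m; apply: quot_bound; first by rewrite mul1r gt_eqF ?step_gt0.
by rewrite mul1r; apply: Lpsi; rewrite gtr0_norm ?step_gt0 // step_lt.
Qed.

Let dpsi_support l x : bP < `|x| -> dpsi l x = 0.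
Proof.
move=> h; rewrite /dpsi patchE memNset // => /UP /hbP; by rewrite leNgt h.
Qed.

Let test_bounds theta : test_fun P theta ->
  smooth theta /\ forall x, ~ P x -> theta x = 0.
Proof.
move=> [stheta _ sP]; split=> // x Px; apply: contrapT => /eqP tx.
by apply: Px; apply: sP; apply: subset_closure.
Qed.

Let itheta l theta : test_fun P theta ->
  mu3.-integrable PT (EFin \o (fun p => d (pt3 p) 0 l * partial l theta (pt3 p))).
Proof.
move=> /test_bounds[st tP]; have t0' x : bP < `|x| -> theta x = 0.
  by move=> h; apply: tP => /hbP; rewrite leNgt h.
have [B B0 [_ hB _]] := smooth_support_bounds st t0'.
apply: (@integrable_mul_bounded _ _ _ _ _ _ _ B) => //.
- exact: L2_integrable (hd l).
- apply: continuous_measurable_on => // x _.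
  by apply: smooth_continuous; exact: smooth_partial.
Qed.

Let igtheta theta : test_fun P theta ->
  mu3.-integrable PT (EFin \o (fun p => g (pt3 p) * theta (pt3 p))).
Proof.
move=> /test_bounds[st tP]; have t0' x : bP < `|x| -> theta x = 0.
  by move=> h; apply: tP => /hbP; rewrite leNgt h.
have [B B0 [hB _ _]] := smooth_support_bounds st t0'.
apply: (@integrable_mul_bounded _ _ _ _ _ _ _ B) => //.
- exact: L2_integrable (hg.1).
- by apply: continuous_measurable_on => // x _; exact: smooth_continuous.
Qed.

Let Rintegral_test theta : test_fun P theta ->
  \int[mu3]_p (\sum_l F l p * partial l theta (pt3 p) + Gp p * theta (pt3 p)) = 0.
Proof.
move=> tt; have [_ /(_ _ tt)] := hg; rewrite !integral3E => hdiv.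
have i1 : mu3.-integrable PT (EFin \o (fun p =>
    \sum_l d (pt3 p) 0 l * partial l theta (pt3 p))).
  by apply: integrable_sumR => // l; exact: itheta.
have i2 := igtheta tt.
transitivity (\int[mu3]_(p in UT) (\sum_l d (pt3 p) 0 l * partial l theta (pt3 p) +
    g (pt3 p) * theta (pt3 p))).
  rewrite [RHS]Rintegral_mkcond; apply: eq_Rintegral => p _.
  rewrite /F /Gp !patchE; case: ifPn => pU.
    by congr (_ + _); apply: eq_bigr => l _; rewrite patchE pU.
  by rewrite mul0r addr0 big1 // => l _; rewrite patchE (negPf pU) mul0r.
have UTPT : UT `<=` PT by move=> p; exact: UP.
rewrite -(Rintegral_null_diff mUT mPT UTPT PU0); last exact: integrableDR.
by rewrite RintegralD // hdiv addNr.
Qed.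

Let mrho : measurable_on setT rho.
Proof. exact: smooth_measurable. Qed.

Let irho : mu3.-integrable setT (EFin \o (rho \o pt3)).
Proof.
have [B B0 [hB _ _]] := smooth_support_bounds srho rho0.
apply: (@integrable_bounded_support _ _ B r) => [|p|p]; last exact: rho0; last exact: hB.
by move: mrho; rewrite /measurable_on preimage_setT.
Qed.

Let Bpsi : exists2 B, 0 <= B & forall x, `|psi x| <= B.
Proof. exact: continuous_bounded_support psi_support. Qed.

(** The integrand of the wanted identity with [psi] and its gradient displaced by [a] times z and
    weighted by [rho] at z. At a = 0 the variables separate. *)
Let h (a : R) (pz : T3 * T3) : R :=
  \sum_l (F l pz.1 * rho (pt3 pz.2)) * dpsi l (pt3 pz.1 + a *: pt3 pz.2) +
  (Gp pz.1 * rho (pt3 pz.2)) * psi (pt3 pz.1 + a *: pt3 pz.2).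

Let ih a : mu33.-integrable setT (EFin \o h a).
Proof.
have [B B0 hB] := Bpsi.
apply: integrableDR => //.
  apply: integrable_sumR => // l; apply: (@integrable_mul_bounded _ _ _ _ _ _ _ L) => //.
    exact: (integrable_prod (iF l) irho).
  exact: measurable_comb.
apply: (@integrable_mul_bounded _ _ _ _ _ _ _ B) => //.
  exact: (integrable_prod iG irho).
exact: measurable_comb.
Qed.

Let mslice f (a : R) (p : T3) : measurable_on setT f ->
  measurable_fun setT (fun z : T3 => f (pt3 p + a *: pt3 z)).
Proof.
move=> /(measurable_comb a) mf.
exact: (measurableT_comp mf (pair1_measurable p)).
Qed.

Let irho_mul (a : R) (p : T3) f (B : R) : measurable_on setT f -> (forall x, `|f x| <= B) ->
  mu3.-integrable setT (EFin \o (fun z : T3 => rho (pt3 z) * f (pt3 p + a *: pt3 z))).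
Proof.
move=> mf hB; apply: (@integrable_mul_bounded _ _ _ _ _ _ _ B) => //; exact: mslice.
Qed.

Let hslice a p : mu3.-integrable setT (EFin \o (fun z : T3 => h a (p, z))).
Proof.
have [B B0 hB] := Bpsi; apply: integrableDR => //=.
  apply: integrable_sumR => // l.
  under eq_fun do rewrite /= -mulrA.
  by apply: integrableZR => //; exact: irho_mul.
under eq_fun do rewrite /= -mulrA.
by apply: integrableZR => //; exact: irho_mul.
Qed.

(** The substitution z = c * (p - q) in the convolution. *)
Let conv_affine (c : R) f (B b : R) (p : T3) : 0 < c -> measurable_on setT f -> (forall x, `|f x| <= B) ->
  (forall x, b < `|x| -> f x = 0) ->
  \int[mu3]_q (f (pt3 q) * rho (c *: (pt3 p - pt3 q))) =
  c^-1 ^+ 3 * \int[mu3]_z (rho (pt3 z) * f (pt3 p + (- c^-1) *: pt3 z)).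
Proof.
move=> c0 mf hB f0; have cn0 : c != 0 by rewrite gt_eqF.
have [Br Br0 [hBr _ _]] := smooth_support_bounds srho rho0.
pose A : 'M[R]_3 := (- c^-1)%:M.
have dA : `|\det A| = c^-1 ^+ 3.
  by rewrite det_scalar normrX normrN ger0_norm // invr_ge0 ltW.
have uA : A \in unitmx.
  by rewrite unitmxE unitfE -normr_eq0 dA expf_neq0 // invr_eq0.
have i1 : mu3.-integrable setT (EFin \o (fun q => f (pt3 q) * rho (c *: (pt3 p - pt3 q)))).
  apply: (@integrable_bounded_support _ _ (B * Br) b).
  - apply: measurable_funM; first by move: mf; rewrite /measurable_on preimage_setT.
    have mr : measurable_on setT (fun x => rho (c *: (x - 0))).
      by apply: smooth_measurable; exact: smooth_affine.
    have := mslice (- 1) p mr; congr measurable_fun; apply/funext => z.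
    by rewrite subr0 scaleN1r.
  - by move=> q; rewrite normrM ler_pM.
  - by move=> q /f0 ->; rewrite mul0r.
have [_ ->] := Rintegral_affT (- (c *: pt3 p)) uA i1.
rewrite dA; congr (_ * _); apply: eq_Rintegral => z _.
rewrite /affT unpt3K mul_mx_scalar mulrC.
have -> : - c^-1 *: (pt3 z - c *: pt3 p) = pt3 p + - c^-1 *: pt3 z.
  by rewrite scalerBr addrC scalerA mulNr mulVf // scaleN1r opprK.
by congr (rho _ * _); rewrite opprD addrA subrr sub0r scaleNr opprK scalerA mulfV // scale1r.
Qed.

(** The derivative passes from the kernel to [psi]. The kernel is a function of p - q, so its
    derivative in q carries a minus sign, which cancels the one from integration by parts. *)
Let conv_parts (c : R) l (p : T3) : 0 < c ->
  \int[mu3]_q (psi (pt3 q) * (c * partial l rho (c *: (pt3 p - pt3 q)))) =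
  \int[mu3]_q (dpsi l (pt3 q) * rho (c *: (pt3 p - pt3 q))).
Proof.
move=> c0; have [B B0 hB] := Bpsi.
have [Br Br0 [hBr hBr' hLr]] := smooth_support_bounds srho rho0.
pose theta x := rho (- c *: (x - pt3 p)).
pose dtheta x := - c * partial l rho (- c *: (x - pt3 p)).
have tE q : c *: (pt3 p - pt3 q) = - c *: (pt3 q - pt3 p) by rewrite scaleNr -scalerN opprB.
have ct x : {for x, continuous dtheta}.
  rewrite (_ : dtheta = partial l theta).
    by apply: smooth_continuous; apply: smooth_partial; exact: smooth_affine.
  by apply/funext => y; rewrite /theta partial_affine.
have := @integral_by_parts R psi theta dtheta (dpsi l \o pt3) l B Br L (Br * c) bK t0.
move=> /(_ t00 mpsi) h1.
have mt : measurable_on setT theta.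
  by apply: smooth_measurable; exact: smooth_affine.
have mdt : measurable_on setT dtheta by exact: continuous_measurable.
have mdp : measurable_fun setT (dpsi l \o pt3).
  by have := mdpsi l; rewrite /measurable_on preimage_setT.
have Lt x t : `|theta (x + t *: dir l) - theta x| <= Br * c * `|t|.
  rewrite (le_trans (hLr _ _)) // -mulrA ler_wpM2l // -scalerBr.
  by rewrite opprB addrA subrK addrAC subrr add0r normrZ normrN gtr0_norm // normrZ norm_dir mulr1.
have aeq : {ae mu3, forall p, quot psi l (pt3 p) @ 0^' --> (dpsi l \o pt3) p}.
  exists (pt3 @^-1` (P `\` U)); split=> //; first exact: measurableD.
  move=> q; apply: contra_notP => /= /not_andP hq; apply: quot_dpsi.
  by case: hq => [|/contrapT]; [right|left].
have dq x : quot theta l x @ 0^' --> dtheta x.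
  rewrite /dtheta -(partial_affine (- c) (pt3 p)) //.
  by apply: derivable_quot; apply: smooth_derivable; exact: smooth_affine.
have := h1 mt mdt mdp hB psi_support (fun x => hBr _) (fun x t => @Lpsi l x t) Lt aeq dq.
move=> /eqP; rewrite -eqr_oppLR => /eqP h2.
have ipd : mu3.-integrable setT (EFin \o (fun q => psi (pt3 q) * dtheta (pt3 q))).
  apply: (@integrable_bounded_support _ _ (B * (c * Br)) bK).
  - by apply: measurable_funM; [move: mpsi|move: mdt]; rewrite /measurable_on preimage_setT.
  - move=> q; rewrite normrM ler_pM //.
    by rewrite /dtheta normrM normrN (gtr0_norm c0) (ler_wpM2l (ltW c0)).
  - by move=> q /psi_support ->; rewrite mul0r.
transitivity (- (\int[mu3]_q (psi (pt3 q) * dtheta (pt3 q)))).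
  rewrite -mulN1r -RintegralZl //; apply: eq_Rintegral => q _.
  by rewrite /dtheta -tE; ring.
by rewrite h2; apply: eq_Rintegral => q _; rewrite /theta tE.
Qed.

(** The divergence identity tested with x -> rho (c * (x - q)) and weighted with [psi] at q.
    Integrated over p first it vanishes; integrated over q first it is the identity tested with the
    mollified [psi]. Fubini equates the two. *)
Let H (c : R) (pq : T3 * T3) : R :=
  \sum_l (F l pq.1 * psi (pt3 pq.2)) * (c * partial l rho (c *: (pt3 pq.1 - pt3 pq.2))) +
  (Gp pq.1 * psi (pt3 pq.2)) * rho (c *: (pt3 pq.1 - pt3 pq.2)).

Let ipsi : mu3.-integrable setT (EFin \o (psi \o pt3)).
Proof.
have [B B0 hB] := Bpsi.
apply: (@integrable_bounded_support _ _ B bK) => [|p|p]; last exact: psi_support; last exact: hB.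
by move: mpsi; rewrite /measurable_on preimage_setT.
Qed.

Let mker f (c : R) : smooth f ->
  measurable_fun setT (fun pq : T3 * T3 => f (c *: (pt3 pq.1 - pt3 pq.2))).
Proof.
move=> sf; have mr : measurable_on setT (fun x => f (c *: (x - 0))).
  by apply: smooth_measurable; exact: smooth_affine.
have := measurable_comb (- 1) mr; congr measurable_fun; apply/funext => z.
by rewrite subr0 scaleN1r.
Qed.

Let iH c : mu33.-integrable setT (EFin \o H c).
Proof.
have [Br Br0 [hBr hBr' _]] := smooth_support_bounds srho rho0.
apply: integrableDR => //.
  apply: integrable_sumR => // l.
  apply: (@integrable_mul_bounded _ _ _ _ _ _ _ (`|c| * Br)) => //.
  - exact: (integrable_prod (iF l) ipsi).
  - by apply: measurable_funM => //; apply: mker; exact: smooth_partial.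
  - by move=> x _; rewrite normrM ler_wpM2l.
apply: (@integrable_mul_bounded _ _ _ _ _ _ _ Br) => //.
  exact: (integrable_prod iG ipsi).
exact: mker.
Qed.

Let iker1 f (c B : R) (u : T3 -> R) (q : T3) : mu3.-integrable setT (EFin \o u) ->
  smooth f -> (forall x, `|f x| <= B) ->
  mu3.-integrable setT (EFin \o (fun p : T3 => u p * f (c *: (pt3 p - pt3 q)))).
Proof.
move=> iu sf hB; apply: (@integrable_mul_bounded _ _ _ _ _ _ _ B) => //.
exact: (measurableT_comp (mker c sf) (pair2_measurable q)).
Qed.

Let iker2 f (c B : R) (u : T3 -> R) (p : T3) : mu3.-integrable setT (EFin \o u) ->
  smooth f -> (forall x, `|f x| <= B) ->
  mu3.-integrable setT (EFin \o (fun q : T3 => u q * f (c *: (pt3 p - pt3 q)))).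
Proof.
move=> iu sf hB; apply: (@integrable_mul_bounded _ _ _ _ _ _ _ B) => //.
exact: (measurableT_comp (mker c sf) (pair1_measurable p)).
Qed.

Let H1E c (q : T3) : (fun p => H c (p, q)) = (fun p : T3 =>
  \sum_l (c * psi (pt3 q)) * (F l p * partial l rho (c *: (pt3 p - pt3 q))) +
  psi (pt3 q) * (Gp p * rho (c *: (pt3 p - pt3 q)))).
Proof.
by apply/funext => p; congr (_ + _); [apply: eq_bigr => l _|] => /=; ring.
Qed.

Let H2E c (p : T3) : (fun q => H c (p, q)) = (fun q : T3 =>
  \sum_l F l p * (psi (pt3 q) * (c * partial l rho (c *: (pt3 p - pt3 q)))) +
  Gp p * (psi (pt3 q) * rho (c *: (pt3 p - pt3 q)))).
Proof.
by apply/funext => q; congr (_ + _); [apply: eq_bigr => l _|] => /=; ring.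
Qed.

Let iH1 c (q : T3) : mu3.-integrable setT (EFin \o (fun p => H c (p, q))).
Proof.
have [Br Br0 [hBr hBr' _]] := smooth_support_bounds srho rho0.
rewrite H1E; apply: integrableDR => //; last by apply: integrableZR => //; exact: iker1.
apply: integrable_sumR => // l; apply: integrableZR => //.
by apply: (iker1 _ _ (iF l) (smooth_partial l srho)) => x; exact: hBr'.
Qed.

Let iH2' c l (p : T3) : mu3.-integrable setT
  (EFin \o (fun q => psi (pt3 q) * (c * partial l rho (c *: (pt3 p - pt3 q))))).
Proof.
have [Br Br0 [hBr hBr' _]] := smooth_support_bounds srho rho0.
under eq_fun do rewrite /= mulrCA.
apply: integrableZR => //.
by apply: (iker2 _ _ ipsi (smooth_partial l srho)) => x; exact: hBr'.
Qed.

Let iH2'' c (p : T3) : mu3.-integrable setT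
  (EFin \o (fun q => psi (pt3 q) * rho (c *: (pt3 p - pt3 q)))).
Proof.
have [Br Br0 [hBr _ _]] := smooth_support_bounds srho rho0.
by apply: (iker2 _ _ ipsi srho) => x; exact: hBr.
Qed.

Let iH2 c (p : T3) : mu3.-integrable setT (EFin \o (fun q => H c (p, q))).
Proof.
rewrite H2E; apply: integrableDR => //; last exact: integrableZR.
by apply: integrable_sumR => // l; exact: integrableZR.
Qed.

(** For q in [K] the scaled kernel about q is an admissible test function on [P]; for other q the
    weight [psi] is zero. *)
Let inner_p c (q : T3) : 0 < c -> (forall y x, K y -> `|x - y| <= r / c -> P x) ->
  \int[mu3]_p H c (p, q) = 0.
Proof.
move=> c0 hP; have [Kq|Kq] := pselect (K (pt3 q)); last first.
  have -> : (fun p => H c (p, q)) = cst 0.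
    apply/funext => p; rewrite /H /= psi0 // !mulr0 mul0r addr0.
    by apply: big1 => l _; rewrite mulr0 mul0r.
  by rewrite Rintegral_cst // mul0r.
pose theta x := rho (c *: (x - pt3 q)).
have tt : test_fun P theta by apply: (test_fun_bump srho rho0 c0) => x; exact: hP.
have := Rintegral_test tt => h0.
transitivity (psi (pt3 q) * \int[mu3]_p
    (\sum_l F l p * partial l theta (pt3 p) + Gp p * theta (pt3 p))); last first.
  by rewrite h0 mulr0.
have [Br Br0 [hBr hBr' _]] := smooth_support_bounds srho rho0.
rewrite -RintegralZl //.
  apply: eq_Rintegral => p _; rewrite /H /= mulrDr mulr_sumr; congr (_ + _).
    by apply: eq_bigr => l _; rewrite partial_affine //; ring.
  by rewrite /theta; ring.
apply: integrableDR => //; last exact: (iker1 _ _ iG srho hBr).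
apply: integrable_sumR => // l.
under eq_fun do rewrite /= partial_affine // mulrCA.
apply: integrableZR => //.
by apply: (iker1 _ _ (iF l) (smooth_partial l srho)) => x; exact: hBr'.
Qed.

Let inner_q c (p : T3) : 0 < c ->
  \int[mu3]_q H c (p, q) = c^-1 ^+ 3 * \int[mu3]_z h (- c^-1) (p, z).
Proof.
move=> c0; have [B B0 hB] := Bpsi.
have ir1 l : mu3.-integrable setT
    (EFin \o (fun z : T3 => rho (pt3 z) * dpsi l (pt3 p + - c^-1 *: pt3 z))).
  exact: irho_mul.
have ir2 : mu3.-integrable setT
    (EFin \o (fun z : T3 => rho (pt3 z) * psi (pt3 p + - c^-1 *: pt3 z))).
  exact: irho_mul.
have -> : (fun z : T3 => h (- c^-1) (p, z)) = (fun z : T3 =>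
    \sum_l F l p * (rho (pt3 z) * dpsi l (pt3 p + - c^-1 *: pt3 z)) +
    Gp p * (rho (pt3 z) * psi (pt3 p + - c^-1 *: pt3 z))).
  apply/funext => z; rewrite /h /= mulrA; congr (_ + _).
  by apply: eq_bigr => l _; rewrite mulrA.
rewrite H2E !RintegralD //; first last.
- exact: integrableZR.
- by apply: integrable_sumR => // l; exact: integrableZR.
- exact: integrableZR.
- by apply: integrable_sumR => // l; exact: integrableZR.
rewrite !Rintegral_sum //; first last.
- by move=> l; exact: integrableZR.
- by move=> l; exact: integrableZR.
rewrite mulrDr mulr_sumr; congr (_ + _); last first.
  rewrite !RintegralZl // mulrCA; congr (_ * _).
  exact: (conv_affine p c0 mpsi hB psi_support).
apply: eq_bigr => l _; rewrite !RintegralZl // mulrCA; congr (_ * _).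
rewrite conv_parts //.
exact: (conv_affine p c0 (mdpsi l) (dpsi_bound l) (@dpsi_support l)).
Qed.

Let int_h0 c : 0 < c -> (forall y x, K y -> `|x - y| <= r / c -> P x) ->
  \int[mu33]_pz h (- c^-1) pz = 0.
Proof.
move=> c0 hP; rewrite -Rintegral12 //.
have : \int[mu3]_p \int[mu3]_q H c (p, q) = 0.
  rewrite Rintegral12 // -Rintegral21 //.
  rewrite (_ : (fun q => _) = cst 0) ?Rintegral_cst ?mul0r //.
  by apply/funext => q; exact: inner_p.
rewrite (_ : (fun p => _) = (fun p => c^-1 ^+ 3 * \int[mu3]_z h (- c^-1) (p, z))); last first.
  by apply/funext => p; exact: inner_q.
rewrite RintegralZl //; last first.
  have := integrable_fubini_F (ih (- c^-1)).
  congr (integrable _ _); apply/funext => p; rewrite /fubini_F /= /Rintegral fineK //.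
  exact: (integrable_fin_num measurableT (hslice (- c^-1) p)).
by move/eqP; rewrite mulf_eq0 expf_eq0 invr_eq0 (gt_eqF c0) /= => /eqP.
Qed.

(** The limit of [int_h0] as the kernels concentrate, by dominated convergence. *)
Let int_h00 : \int[mu33]_pz h 0 pz = 0.
Proof.
have [e e0 hP] := compact_margin cK oP KP.
(* Starting the scales at [m0] makes the kernel radius r / c smaller than the margin [e] around
   [K]. *)
have [m0 hm0] : exists m0 : nat, `|r| / e < m0%:R.
  by exists (Num.Def.archi_bound (`|r| / e)); apply: archi_boundP; rewrite divr_ge0 // ltW.
pose c m : R := (m + m0).+1%:R.
have c0 m : 0 < c m by rewrite ltr0n.
have cP m y x : K y -> `|x - y| <= r / c m -> P x.
  move=> Ky xy; apply: (hP y x Ky); rewrite (le_trans xy) // ler_pdivrMr //.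
  rewrite (le_trans (ler_norm r)) // mulrC -ler_pdivrMr // (le_trans (ltW hm0)) //.
  by rewrite ler_nat leqW // leq_addl.
have ca : (fun m => - (c m)^-1) @ \oo --> (0 : R).
  rewrite -[X in _ --> X]oppr0; apply: cvgN.
  apply: (@cvg_comp _ _ _ (fun m => (m + m0)%N) (fun n : nat => n.+1%:R^-1)); last exact: cvg_harmonic.
  by move=> A [n _ hA]; exists n => // m nm; apply: hA => /=; exact: leq_trans nm (leq_addr _ _).
have [B B0 hB] := Bpsi.
pose D (pz : T3 * T3) := (\sum_l `|F l pz.1| * L + `|Gp pz.1| * B) * `|rho (pt3 pz.2)|.
have iD : mu33.-integrable setT (EFin \o D).
  have iS : mu3.-integrable setT (EFin \o (fun p : T3 => \sum_l `|F l p| * L + `|Gp p| * B)).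
    apply: integrableDR => //.
      apply: integrable_sumR => // l; under eq_fun do rewrite /= mulrC.
      apply: integrableZR => //; exact: (integrable_norm (iF l)).
    under eq_fun do rewrite /= mulrC.
    apply: integrableZR => //; exact: (integrable_norm iG).
  exact: (integrable_prod iS (integrable_norm irho)).
have mh a : measurable_fun setT (h a).
  by apply/measurable_EFinP; exact: measurable_int (ih a).
have hlim : {ae mu33, forall pz, (fun m => h (- (c m)^-1) pz) @ \oo --> h 0 pz}.
  apply: aeW => -[p z].
  have cx : pt3 p + - (c m)^-1 *: pt3 z @[m --> \oo] --> pt3 p + 0 *: pt3 z.
    by apply: cvgD; [exact: cvg_cst|apply: cvgZr_tmp; exact: ca].
  (* Pointwise convergence: on [U] the gradient of [psi] is continuous, and off [U] every [h a] is
     zero because [F] and [Gp] are. *)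
  have [Up|Up] := pselect (U (pt3 p)); last first.
    have h0 a : h a (p, z) = 0.
      rewrite /h /Gp /= patchE memNset // !mul0r addr0 big1 // => l _.
      by rewrite /F patchE memNset // !mul0r.
    by rewrite h0 (_ : (fun m => _) = cst 0) ?funeqE //; exact: cvg_cst.
  have cl l : F l p * rho (pt3 z) * dpsi l (pt3 p + - (c m)^-1 *: pt3 z) @[m --> \oo] -->
      F l p * rho (pt3 z) * dpsi l (pt3 p + 0 *: pt3 z).
    apply: cvgM; first exact: cvg_cst.
    by apply: (continuous_cvg _ _ cx); rewrite scale0r addr0; exact: cdpsi.
  rewrite /h /= sum_ord3; under eq_fun do rewrite sum_ord3.
  apply: cvgD; first by apply: cvgD; first apply: cvgD.
  apply: cvgM; first exact: cvg_cst.
  by apply: continuous_cvg => //; exact: cpsi.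
have hD : {ae mu33, forall pz m, `|h (- (c m)^-1) pz| <= D pz}.
  apply: aeW => -[p z] m; rewrite /h /D /= mulrDl (le_trans (ler_normD _ _)) //.
  apply: lerD; last first.
    by rewrite normrM normrM mulrAC ler_wpM2r // ler_wpM2l.
  rewrite (le_trans (ler_norm_sum _ _ _)) // mulr_suml; apply: ler_sum => l _.
  by rewrite normrM normrM mulrAC ler_wpM2r // ler_wpM2l.
have [_] := @Rdct _ _ _ mu33 (fun m => h (- (c m)^-1)) (h 0) D (fun m => mh _) (mh 0) hlim iD hD.
rewrite (_ : (fun m => _) = cst 0); last first.
  by apply/funext => m; exact: (int_h0 (c0 m) (cP m)).
by move=> lim; rewrite -(cvg_lim (@Rhausdorff R) lim) lim_cst.
Qed.

(** At a = 0 the double integral is the product of the wanted expression and the mass of [rho]. It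
    is zero by [int_h00], and the mass is not. *)
Lemma weak_div_lipschitz : \int[mu3]_p rho (pt3 p) != 0 ->
  \int[mu3]_(p in pt3 @^-1` U) (\sum_l d (pt3 p) 0 l * G (pt3 p) 0 l) =
  - \int[mu3]_(p in pt3 @^-1` U) (g (pt3 p) * psi (pt3 p)).
Proof.
move=> rho1; have [B B0 hB] := Bpsi; have mdp l := mdpsi l.
pose S1 (p : T3) := \sum_l F l p * dpsi l (pt3 p).
pose S2 (p : T3) := Gp p * psi (pt3 p).
have i1 : mu3.-integrable setT (EFin \o S1).
  apply: integrable_sumR => // l; apply: (@integrable_mul_bounded _ _ _ _ _ _ _ L) => //.
  by have := mdp l; rewrite /measurable_on preimage_setT.
have i2 : mu3.-integrable setT (EFin \o S2).
  by apply: (@integrable_mul_bounded _ _ _ _ _ _ _ B).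
have hE (p z : T3) : h 0 (p, z) = (S1 p + S2 p) * rho (pt3 z).
  rewrite /h /S1 /S2 /= scale0r addr0 mulrDl mulr_suml; congr (_ + _); last by ring.
  by apply: eq_bigr => l _; ring.
have : (\int[mu3]_p (S1 p + S2 p)) * \int[mu3]_z rho (pt3 z) = 0.
  rewrite -RintegralZr //; last exact: integrableDR.
  have := Rintegral12 (ih 0) (hslice 0); rewrite int_h00 => <-.
  by apply: eq_Rintegral => p _; under [RHS]eq_Rintegral do rewrite hE; rewrite RintegralZl.
move=> /eqP; rewrite mulf_eq0 (negPf rho1) orbF RintegralD // addr_eq0 => /eqP hS.
have e1 : \int[mu3]_(p in UT) (\sum_l d (pt3 p) 0 l * G (pt3 p) 0 l) = \int[mu3]_p S1 p.
  rewrite Rintegral_mkcond; apply: eq_Rintegral => p _.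
  rewrite patchE /S1; case: ifPn => pU.
    apply: eq_bigr => l _; rewrite /F patchE pU /dpsi patchE.
    by rewrite (_ : (pt3 p \in U) = true) //.
  by rewrite big1 // => l _; rewrite /F patchE (negPf pU) mul0r.
have e2 : \int[mu3]_(p in UT) (g (pt3 p) * psi (pt3 p)) = \int[mu3]_p S2 p.
  rewrite Rintegral_mkcond; apply: eq_Rintegral => p _.
  by rewrite patchE /S2 /Gp patchE; case: ifP; rewrite ?mul0r.
by rewrite -/UT e1 e2.
Qed.

End LipschitzTest.

(** * Lipschitz bounds along chains of closed sets and for functions on balls *)

(*@@P19*)
Section Chain.
Context {R : realType}.

(* The covering set X shrinks: once the last point of [a, b] in a closed set
   containing a is reached, that set is no longer needed. *)
Lemma lipschitz_chain (V : normedModType R) n (A : 'I_n -> set R) (F : R -> V) (L : R) :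
  (forall j, closed (A j)) ->
  (forall j s t, A j s -> A j t -> `|F s - F t| <= L * `|s - t|) ->
  forall (X : {set 'I_n}) a b, a <= b ->
  (forall t, a <= t -> t <= b -> exists2 j, j \in X & A j t) ->
  `|F b - F a| <= L * (b - a).
Proof.
move=> cA LF X; have [m] := ubnP #|X|; elim: m X => // m IH X cX a b ab cov.
have [j jX Aja] := cov a (lexx a) ab.
pose B := A j `&` [set t | a <= t <= b].
have cB : closed B.
  apply: closedI => //; rewrite (_ : [set t | _] = [set t | a <= t] `&` [set t | t <= b]).
    by apply: closedI; [exact: closed_ge|exact: closed_le].
  by apply/seteqP; split=> t /= => [/andP[]|[-> ->]].
have Ba : B a by split => //=; rewrite lexx.
have uB : ubound B b by move=> t [_ /= /andP[]].
have [Ajc /= /andP[ac cb]] : B (sup B).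
  rewrite [X in X _](closure_id _).1 //; apply: closure_sup; first by exists a.
  by exists b.
set c := sup B in Ajc ac cb *.
have h1 : `|F c - F a| <= L * (c - a) by rewrite (le_trans (LF j _ _ Ajc Aja)) // ger0_norm // subr_ge0.
have [bc|cb'] := leP b c; first by rewrite (_ : b = c) //; apply/le_anti; rewrite bc.
have cov' t : c < t -> t <= b -> exists2 i, i \in X :\ j & A i t.
  move=> ct tb; have [i iX Ait] := cov t (le_trans ac (ltW ct)) tb.
  exists i => //; rewrite !inE iX andbT; apply/eqP => ij; rewrite {}ij in Ait.
  have : t <= c by apply: ub_le_sup; [exists b|split=> //=; rewrite tb (le_trans ac (ltW ct))].
  by rewrite leNgt ct.
(* The remaining sets cover [c] as well, because their finite union is closed and contains points
   just to the right of [c]. *)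
have Xc : exists2 i, i \in X :\ j & A i c.
  pose D := \big[setU/set0]_(i <- enum (X :\ j)) A i.
  have DP t : D t <-> exists2 i, i \in X :\ j & A i t.
    rewrite /D -bigcup_seq; split=> [[i /= iX Ait]|[i iX Ait]].
      by exists i => //; rewrite mem_enum in iX.
    by exists i => //=; rewrite mem_enum.
  have cD : closed D by apply: closed_bigsetU.
  apply/DP; rewrite [D](closure_id _).1 // => O /nbhs_normP_lt[r r0 hr].
  pose t := c + Num.min (r / 2) (b - c).
  have m0 : 0 < Num.min (r / 2) (b - c) by rewrite lt_min divr_gt0 //= subr_gt0.
  exists t; split.
    apply/DP/cov'; first by rewrite ltrDl.
    by rewrite /t -lerBrDl ge_min lexx orbT.
  apply: hr; rewrite /t addrAC subrr add0r gtr0_norm // gt_min; apply/orP; left.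
  by rewrite ltr_pdivrMr // ltr_pMr // ltr1n.
have h2 : `|F b - F c| <= L * (b - c).
  apply: (IH (X :\ j)) => //.
    by move: cX; rewrite (cardsD1 j X) jX add1n ltnS.
  move=> t; rewrite le_eqVlt => /orP[/eqP <- _|]; [exact: Xc|exact: cov'].
rewrite -[F b](subrK (F c)) -addrA (le_trans (ler_normD _ _)) //.
by rewrite (le_trans (lerD h2 h1)) // -mulrDr addrA subrK.
Qed.

End Chain.

Section Poly.
Context {R : realType}.
Local Notation E := 'rV[R]_3.

Lemma sd_grad_continuous (U : set E) (f : E -> R) (G : E -> E) (l : 'I_3) x : open U ->
  (forall x, U x -> sd f x (G x)) -> U x -> {for x, continuous (fun y => G y 0 l)}.
Proof.
move=> oU hG Ux A /nbhs_normP_lt[e e0 hA]; have e20 : 0 < e / 2 by rewrite divr_gt0.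
have nU : nbhs x U by exact: open_nbhs_nbhs.
have near_sd : \near x, sd f x (G x) by apply: filterS nU => y; exact: hG.
have := sd_grad_near e20 (hG _ Ux) near_sd; apply: filterS => y h; apply: hA.
have := le_coord_norm (G y - G x) l; rewrite !mxE => h'.
by rewrite (le_lt_trans h') // (le_lt_trans h) // ltr_pdivrMr // ltr_pMr // ltr1n.
Qed.

(** The gradient is continuous, hence bounded on the slightly larger closed ball; the radius B + 1
    puts the closed ball of radius [B] inside an open one. *)
Lemma sd_bounded_lip (f : E -> R) (B : R) : (forall x, exists g, sd f x g) ->
  exists2 L, 0 <= L & forall y z, `|y| <= B -> `|z| <= B -> `|f y - f z| <= L * `|y - z|.
Proof.
move=> hf; have hg x : sd f x (grad f x) by have [g h] := hf x; rewrite (sd_grad h).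
have hB l : exists2 C, 0 <= C & forall x, `|x| <= B + 1 -> `|grad f x 0 l| <= C.
  have : compact ((fun x => grad f x 0 l) @` [set x : E | `|x| <= B + 1]).
    apply: continuous_compact; last by apply: (compactE (B := B + 1)) => //; exact: closed_ball0.
    apply: continuous_subspaceT => x; apply: (@sd_grad_continuous setT) => //; exact: openT.
  move=> /compact_bounded[C [_ hC]]; exists (`|C| + 1); first by rewrite addr_ge0.
  move=> x xB; apply: (hC (`|C| + 1)); last by exists x.
  by rewrite (le_lt_trans (ler_norm C)) // ltrDl.
have [C0 p0 h0] := hB 0; have [C1 p1 h1] := hB 1; have [C2 p2 h2] := hB 2.
pose e := C0 + C1 + C2; have e0 : 0 <= e by rewrite !addr_ge0.
have he x l : `|x| <= B + 1 -> `|grad f x 0 l| <= e.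
  move=> xB; move: l; apply: ord3P.
  - by rewrite (le_trans (h0 _ xB)) // /e -addrA lerDl addr_ge0.
  - by rewrite (le_trans (h1 _ xB)) // /e addrAC lerDr addr_ge0.
  - by rewrite (le_trans (h2 _ xB)) // /e lerDr addr_ge0.
exists (3 * e) => [|y z yB zB]; first by rewrite mulr_ge0.
have H w l : `|w - 0| < B + 1 -> derivable f w (dir l) /\ `|partial l f w - (0 : E) 0 l| <= e.
  rewrite subr0 => /ltW wB; have [dw pw] := sd_partial l (hg w); split=> //.
  by have := he w l wB; rewrite !mxE subr0.
have lt1 w : `|w| <= B -> `|w - 0 : E| < B + 1 by move=> wB; rewrite subr0 (le_lt_trans wB) // ltrDl.
by have := partial_bound e0 H (lt1 _ yB) (lt1 _ zB); rewrite dot0r subr0.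
Qed.

End Poly.

(** * The mesh, its skeleton and the regularity of the mesh map *)

(*@@P20*)
Section FiniteUnion.
Context d (T : measurableType d) (R : realType) (mu : {measure set T -> \bar R}).

Lemma null_bigcup_ord n (A : 'I_n -> set T) (B : set T) : measurable B ->
  (forall j, measurable (A j)) -> (forall j, mu (A j) = 0%E) ->
  B `<=` [set x | exists j, A j x] -> mu B = 0%E.
Proof.
move=> mB mA A0 BA; apply: measure_negligible => //.
apply: (negligibleS (A := \bigcup_k (if insub k is Some j then A j else set0))).
  by move=> x /BA[j Ajx]; exists (val j) => //; rewrite valK.
apply: negligible_bigcup => k; case: (insub k) => [j|]; last exact: negligible_set0.
by apply/negligibleP; [exact: mA|exact: A0].
Qed.

End FiniteUnion.

Section Mesh.
Context {R : realType}.
Local Notation E := 'rV[R]_3.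
Local Notation R' := (measurableTypeR R).
Local Notation T3 := (R' * R' * R')%type.
Local Notation mu3 := (@mu3 R).
Variables (T : tetmesh R) (M : E -> E) (k : nat) (C delta : R).
Hypotheses (nd : forall j, Defs.nondegenerate (@vtx _ T j)) (hM : mesh_map k C delta T M).
Hypothesis delta0 : 0 < delta.

Local Notation K := (closed_polyhedron T).
Local Notation P := (polyhedron T).

(** The open set on which [M] is differentiable; it misses only the skeleton, a null set. *)
Definition ocells : set E := [set x | exists j : 'I_(ncells T), ocell j x].
Local Notation U := ocells.

Lemma cell_closed (j : 'I_(ncells T)) : closed (cell j).
Proof. exact: simplex_closed (nd j). Qed.

Lemma ocell_open (j : 'I_(ncells T)) : open (ocell j).
Proof. exact: open_interior. Qed.

Lemma polyhedron_bounded : exists B, forall x, K x -> `|x| <= B.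
Proof.
have [B hB] := choice (fun j => simplex_bounded (@vtx _ T j)).
exists (\sum_j `|B j|) => x [j /hB /le_trans]; apply.
by rewrite (le_trans (ler_norm _)) // (bigD1 j) //= lerDl sumr_ge0.
Qed.

Lemma polyhedron_compact : compact K.
Proof.
have [B hB] := polyhedron_bounded; apply: (@compactE R K B) => //.
rewrite (_ : K = \bigcup_(j in setT) @cell R T j).
  by apply: closed_bigcup => [|j _]; [exact: finite_finset|exact: cell_closed].
by apply/seteqP; split=> [x [j]|x [j _]]; exists j.
Qed.

Lemma polyhedron_open : open P. Proof. exact: open_interior. Qed.

Lemma polyhedron_sub : P `<=` K. Proof. exact: interior_subset. Qed.

Lemma ocells_open : open U.
Proof.
rewrite (_ : U = \bigcup_(j in setT) @ocell R T j).
  by apply: bigcup_open => j _; exact: ocell_open.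
by apply/seteqP; split=> [x [j]|x [j _]]; exists j.
Qed.

Lemma ocells_sub : U `<=` P.
Proof. by move=> x [j]; apply: interiorS => y; exists j. Qed.

Local Notation skel j := (cell j `\` ocell j).

Lemma skel_closed (j : 'I_(ncells T)) : closed (skel j).
Proof.
rewrite setDE; apply: closedI; first exact: cell_closed.
by rewrite closedC; exact: ocell_open.
Qed.

Lemma skel_null (j : 'I_(ncells T)) : mu3 (pt3 @^-1` (skel j)) = 0%E.
Proof. exact: simplex_boundary_null (nd j). Qed.

Lemma polyhedron_skel : P `\` U `<=` [set x | exists j : 'I_(ncells T), (skel j) x].
Proof.
move=> x [/polyhedron_sub[j cx] Ux]; exists j; split=> // ox; apply: Ux; by exists j.
Qed.

Let mP : measurable (pt3 @^-1` P : set T3). Proof. by apply: measurable_open; exact: polyhedron_open. Qed.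
Let mU : measurable (pt3 @^-1` U : set T3). Proof. by apply: measurable_open; exact: ocells_open. Qed.

Lemma polyhedron_ocells_null : mu3 (pt3 @^-1` (P `\` U)) = 0%E.
Proof.
apply: (@null_bigcup_ord _ _ _ _ _ (fun j : 'I_(ncells T) => pt3 @^-1` (skel j))).
- exact: (measurableD mP mU).
- by move=> j; apply: measurable_closed; exact: skel_closed.
- exact: skel_null.
- by move=> p /polyhedron_skel.
Qed.

Lemma mesh_map_poly_cell (j : 'I_(ncells T)) : exists q : 'I_3 -> mpoly.mpoly 3 R,
  forall x, cell j x -> forall l, M x 0 l = mpoly.meval (fun l => x 0 l) (q l).
Proof.
have [q hq] := choice (fun l => mesh_map_poly hM j l).
by exists q => x cx l; rewrite (hq l).2.
Qed.

Lemma mesh_map_sdm x : U x -> sdm M x ('J M x).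
Proof.
move=> [j ox]; have [q hq] := mesh_map_poly_cell j.
have hg l : exists g, sd (fun y => M y 0 l) x g.
  have [g hg] := sd_meval (q l) x; exists g.
  have [r r0 hr] := (nbhs_normP_lt x _).1 (open_nbhs_nbhs (conj (@ocell_open j) ox)).
  apply: (sd_local r0 _ hg) => y /hr /interior_subset cy.
  by rewrite hq.
have [g hg'] := choice hg.
have h : sdm M x (\matrix_(i, l) g l 0 i).
  move=> l; rewrite (_ : \row_i _ = g l) //.
  by apply/rowP => i; rewrite !mxE.
by rewrite (sdm_jacobian h).
Qed.

Lemma mesh_map_det_gt0 x : U x -> 0 < \det ('J M x).
Proof. by move=> [j /(mesh_map_det hM)]; exact: lt_le_trans. Qed.

Lemma mesh_map_lip : exists2 L, 0 < L &
  forall (j : 'I_(ncells T)) y z, cell j y -> cell j z -> `|M y - M z| <= L * `|y - z|.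
Proof.
have [B hB] := polyhedron_bounded.
have hL (jl : 'I_(ncells T) * 'I_3) : exists L, 0 <= L /\
    forall y z, cell jl.1 y -> cell jl.1 z -> `|M y 0 jl.2 - M z 0 jl.2| <= L * `|y - z|.
  case: jl => j l /=; have [q hq] := mesh_map_poly_cell j.
  have [L L0 h] := sd_bounded_lip B (sd_meval (q l)).
  exists L; split=> // y z cy cz; rewrite !hq //.
  by apply: h; apply: hB; exists j.
have [L hL'] := choice hL.
have S0 : 0 <= \sum_jl L jl by apply: sumr_ge0 => jl _; exact: (hL' jl).1.
exists (\sum_jl L jl + 1) => [|j y z cy cz]; first by rewrite ltr_wpDl.
apply/normr_rV_le; first by rewrite mulr_ge0 // addr_ge0.
move=> l; rewrite !mxE; apply: (le_trans ((hL' (j, l)).2 y z cy cz)).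
rewrite ler_wpM2r // (bigD1 (j, l)) //= -addrA lerDl addr_ge0 // sumr_ge0 // => jl _.
exact: (hL' jl).1.
Qed.

Lemma mesh_map_inj_on x y : K x -> K y -> M x = M y -> x = y.
Proof. by move=> Kx Ky; apply: (mesh_map_inj hM); rewrite inE. Qed.

Lemma inv_mapK x : P x -> inv_map T M (M x) = x.
Proof.
move=> Px; rewrite /inv_map pinvKV ?inE // => y z; rewrite !inE => Py Pz.
by apply: mesh_map_inj_on; exact: polyhedron_sub.
Qed.

Lemma image_open_bounded : exists B, forall y, (M @` K) y -> `|y| <= B.
Proof.
have : compact (M @` K).
  by apply: continuous_compact polyhedron_compact; exact: mesh_map_cont hM.
by move=> /compactE_bounded[B _ hB]; exists B.
Qed.

(** By injectivity the image is the difference of two compact sets, the images of the closed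
    polyhedron and of its part outside [O]. *)
Lemma measurable_image_open (O : set E) : open O -> O `<=` K ->
  measurable (pt3 @^-1` (M @` O) : set T3).
Proof.
move=> oO OK; rewrite (_ : M @` O = M @` (K `&` setT) `\` M @` (K `&` ~` O)).
  have m1 : measurable (pt3 @^-1` (M @` (K `&` setT)) : set T3).
    apply: measurable_compact; apply: compact_image; last exact: closedT.
      exact: polyhedron_compact.
    exact: mesh_map_cont hM.
  have m2 : measurable (pt3 @^-1` (M @` (K `&` ~` O)) : set T3).
    apply: measurable_compact; apply: compact_image; last by rewrite closedC.
      exact: polyhedron_compact.
    exact: mesh_map_cont hM.
  exact: (measurableD m1 m2).
apply/seteqP; split=> [_ [x Ox <-]|_ [[x [Kx _] <-] h]].
  split; first by exists x => //; split=> //; exact: OK.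
  by move=> [z [Kz Oz] zx]; apply: Oz; rewrite (mesh_map_inj_on Kz (OK _ Ox) zx).
exists x => //; apply: contrapT => Ox; apply: h; exists x => //; by split.
Qed.

(** What is missing lies in the images of the boundaries of the cells; these are null, and [M] is
    Lipschitz on each of them. *)
Lemma image_skel_null :
  mu3 (pt3 @^-1` (image_domain T M) `\` pt3 @^-1` (M @` U)) = 0%E.
Proof.
have [L L0 hL] := mesh_map_lip.
have skelK (j : 'I_(ncells T)) : skel j `<=` K by move=> x [cx _]; exists j.
apply: (@null_bigcup_ord _ _ _ _ _ (fun j : 'I_(ncells T) => pt3 @^-1` (M @` (skel j)))).
- apply: measurableD; apply: measurable_image_open.
  + exact: polyhedron_open.
  + exact: polyhedron_sub.
  + exact: ocells_open.
  + by move=> x /ocells_sub /polyhedron_sub.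
- move=> j; apply: measurable_compact.
  rewrite -(setIidr (@skelK j)); apply: compact_image; first exact: polyhedron_compact.
    exact: mesh_map_cont hM.
  exact: skel_closed.
- move=> j; apply: (lipschitz_image_null polyhedron_compact (mesh_map_cont hM)
    (mesh_map_inj hM) (@skelK j) (@skel_closed j) (@skel_null j) L0) => y z [cy _] [cz _].
  exact: hL cy cz.
- move=> p [[x Px Mx] h]; have [j sx] : exists j : 'I_(ncells T), (skel j) x.
    by apply: polyhedron_skel; split=> // Ux; apply: h; exists x.
  by exists j; exists x.
Qed.

(** A segment inside the closed polyhedron may cross many cells; [lipschitz_chain] joins the bounds
    valid on the single cells. Segments are required to stay inside, as the polyhedron need not be
    convex. *)
Lemma mesh_map_segment : exists2 L, 0 < L & forall x (u : E) t,
  `|u| <= 1 -> (forall s, `|s| <= `|t| -> K (x + s *: u)) ->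
  `|M (x + t *: u) - M x| <= L * `|t|.
Proof.
have [L L0 hL] := mesh_map_lip; exists L => // x.
suff pos u t : `|u| <= 1 -> 0 <= t -> (forall s, `|s| <= `|t| -> K (x + s *: u)) ->
    `|M (x + t *: u) - M x| <= L * `|t|.
  move=> u t u1 h; have [/pos/(_ h)|t0] := leP 0 t; first exact.
  have := pos (- u) (- t); rewrite scalerN scaleNr opprK !normrN oppr_ge0; apply=> //.
    exact: ltW.
  by move=> s st; rewrite scalerN -scaleNr; apply: h; rewrite normrN.
move=> u1 t0 h; pose F s := M (x + s *: u).
have -> : M x = F 0 by rewrite /F scale0r addr0.
have := @lipschitz_chain R _ _ (fun j : 'I_(ncells T) => [set s | cell j (x + s *: u)]) F L.
rewrite -[t in `|t|]subr0 ger0_norm ?subr0 // -[t in L * t]subr0.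
move=> /(_ _ _ [set: _]%SET 0 t t0); apply.
- move=> j; have cF : continuous (fun s : R => x + s *: u).
    move=> s; suff : x + t *: u @[t --> s] --> x + s *: u by [].
    by apply: cvgD; [exact: cvg_cst|apply: cvgZr_tmp; exact: cvg_id].
  exact: (@closed_comp _ _ (fun s : R => x + s *: u) (cell j) (fun s _ => cF s) (@cell_closed j)).
- move=> j s s' cs cs'; rewrite (le_trans (hL _ _ _ cs cs')) // ler_wpM2l ?(ltW L0) //.
  by rewrite opprD addrACA subrr add0r -scalerBl normrZ ler_piMr.
- move=> s s0 st; have [|j cj] := h s; first by rewrite !ger0_norm // (le_trans s0).
  by exists j => //; rewrite inE.
Qed.

End Mesh.

(** * Transport of functions and integrals to the curved domain *)

(*@@P21*)
Section Mass.
Context {R : realType}.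
Local Notation E := 'rV[R]_3.
Local Notation R' := (measurableTypeR R).
Local Notation T3 := (R' * R' * R')%type.
Local Notation mu3 := (@mu3 R).

(** By continuity the function exceeds half of its value at [x0] on a small cube. *)
Lemma continuous_mass_neq0 (f : E -> R) x0 r : continuous f -> (forall x, 0 <= f x) ->
  (forall x, r < `|x| -> f x = 0) -> f x0 != 0 -> \int[mu3]_p f (pt3 p) != 0.
Proof.
move=> cf f0 fr fx0; have c0 : 0 < f x0 by rewrite lt_neqAle eq_sym fx0 f0.
have mf : measurable_fun setT (f \o pt3).
  by have := continuous_measurable cf; rewrite /measurable_on preimage_setT.
have [B B0 hB] := continuous_bounded_support cf fr.
have fi : mu3.-integrable setT (EFin \o (f \o pt3)).
  by apply: (@integrable_bounded_support _ _ B r) => // p; [exact: hB|exact: fr].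
have [s s0 hs] : exists2 s, 0 < s & forall y, `|y - x0| < s -> f x0 / 2 < f y.
  apply/(nbhs_normP_lt x0); apply: (cf x0 [set t | f x0 / 2 < t]); apply/nbhs_normP_lt.
  exists (f x0 / 2); first by rewrite divr_gt0.
  by move=> y; rewrite /= ltr_distl => /andP[h _]; lra.
pose Q := box (x0 - const_mx (s / 2)) (x0 + const_mx (s / 2)).
have mQ : measurable Q by exact: measurable_box.
have muQ : mu3 Q = (s ^+ 3)%:E.
  rewrite mu3_box => [|j]; last by rewrite !mxE; lra.
  have dE j : (x0 + const_mx (s / 2)) 0 j - (x0 - const_mx (s / 2)) 0 j = s by rewrite !mxE; lra.
  by rewrite prod_ord3 !dE !exprS expr0 mulr1 mulrA.
have hQ p : Q p -> f x0 / 2 <= f (pt3 p).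
  move=> Qp; apply/ltW/hs/(normr_rV_lt _ s0).2 => j; have := Qp j; move: (pt3 p) => x.
  by rewrite !mxE ltr_norml => /andP[h1 h2]; apply/andP; split; lra.
have h : (0 < \int[mu3]_p (f (pt3 p))%:E)%E.
  apply: (@lt_le_trans _ _ (\int[mu3]_(p in Q) (f x0 / 2)%:E)%E).
    by rewrite integral_cst // [X in (_ * X)%E]muQ -EFinM lte_fin !mulr_gt0 ?exprn_gt0 ?invr_gt0.
  apply: (@le_trans _ _ (\int[mu3]_(p in Q) (f (pt3 p))%:E)%E).
    apply: ge0_le_integral => //.
    - by move=> p _; rewrite lee_fin divr_ge0.
    - by apply/measurable_EFinP; exact: measurable_funTS.
  by apply: ge0_subset_integral => // [|p _]; [exact/measurable_EFinP|rewrite lee_fin].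
rewrite /Rintegral gt_eqF // fine_gt0 // h /= ltey_eq.
by rewrite (integrable_fin_num measurableT fi).
Qed.

End Mass.

Section Transport.
Context {R : realType}.
Local Notation E := 'rV[R]_3.
Local Notation R' := (measurableTypeR R).
Local Notation T3 := (R' * R' * R')%type.
Local Notation mu3 := (@mu3 R).
Variables (T : tetmesh R) (M : E -> E) (k : nat) (C delta : R).
Hypotheses (nd : forall j, Defs.nondegenerate (@vtx _ T j)) (hM : mesh_map k C delta T M).
Hypothesis delta0 : 0 < delta.

Local Notation K := (closed_polyhedron T).
Local Notation P := (polyhedron T).
Local Notation U := (ocells T).
Local Notation D := (image_domain T M).
Let UT : set T3 := pt3 @^-1` U.
Let PT : set T3 := pt3 @^-1` P.
Let V : set T3 := pt3 @^-1` (M @` U).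
Let DT : set T3 := pt3 @^-1` D.
Let G : T3 -> T3 := invT K M.

Let oU : open U. Proof. exact: ocells_open. Qed.
Let mUT : measurable UT. Proof. exact: measurable_open. Qed.
Let UK : U `<=` K. Proof. by move=> x /ocells_sub /polyhedron_sub. Qed.
Let mV : measurable V. Proof. exact: (measurable_image_open nd hM oU UK). Qed.

Lemma measurable_image_domain : measurable (pt3 @^-1` (image_domain T M) : set T3).
Proof. exact: (measurable_image_open nd hM (@polyhedron_open _ T) (@polyhedron_sub _ T)). Qed.
Let mDT : measurable DT. Proof. exact: measurable_image_domain. Qed.

Let VD : V `<=` DT.
Proof. by move=> p [x Ux Mx]; exists x => //; exact: ocells_sub. Qed.

Let Vfin : (mu3 V < +oo)%E.
Proof.
have [B hB] := image_open_bounded nd hM; apply: (mu3_bounded (B := B)) => // y [x Ux <-].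
by apply: hB; exists x => //; exact: UK.
Qed.

Let mG : measurable_fun setT G.
Proof. exact: measurable_invT (polyhedron_compact nd) (mesh_map_cont hM) (mesh_map_inj hM). Qed.

Let GM x : U x -> G (unpt3 (M x)) = unpt3 x.
Proof. by move=> /UK Kx; exact: (@invTK R K M (mesh_map_inj hM) x Kx). Qed.

Let sdU x : U x -> sdm M x ('J M x). Proof. by move=> Ux; exact: (mesh_map_sdm hM Ux). Qed.
Let detU x : U x -> 0 < \det ('J M x). Proof. exact: (mesh_map_det_gt0 hM delta0). Qed.

Lemma measurable_jacobian a b : measurable_on U (fun x => 'J M x a b).
Proof.
apply: continuous_measurable_on => // x Ux.
exact: (@sdm_entry_continuous _ U M (fun x => 'J M x) oU sdU).
Qed.

Lemma measurable_det : measurable_on U (fun x => \det ('J M x)).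
Proof.
apply: continuous_measurable_on => // x Ux; apply: det_continuous_at => i j.
exact: (@sdm_entry_continuous _ U M (fun x => 'J M x) oU sdU).
Qed.

(* Transport of a function to the image domain, by zero outside the image of the
   open cells. *)
Definition push (f : E -> R) : E -> R := (f \o inv_map T M) \_ (M @` U).

Lemma pushE f x : U x -> push f (M x) = f x.
Proof.
move=> Ux; rewrite /push patchE mem_set; last by exists x.
by rewrite /= (inv_mapK hM) //; exact: ocells_sub.
Qed.

Lemma push0 f y : ~ (M @` U) y -> push f y = 0.
Proof. by move=> h; rewrite /push patchE memNset. Qed.

Lemma measurable_push f A : measurable_on U f -> measurable_on A (push f).
Proof.
move=> mf; apply: measurable_funTS.
rewrite (_ : _ \o _ = ((f \o pt3) \o G) \_ V).
  apply/(measurable_restrictT _ mV).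
  apply: (measurable_comp (F := UT)) => //; last exact: measurable_funTS.
  by move=> _ [p [x Ux Mx] <-]; rewrite /UT /= -(pt3K p) -Mx GM // unpt3K.
apply/funext => p; rewrite /= patchE; case: ifPn => [|]; rewrite ?inE ?notin_setE.
  by move=> [x Ux Mx]; rewrite -Mx pushE //= -(pt3K p) -Mx GM // unpt3K.
by move=> h; rewrite push0.
Qed.

(** The change of variables on the open cells; since [F] vanishes off their image, the integral over
    the whole curved domain is the one over that image. *)
Lemma ge0_integral_pull (F f : E -> R) : measurable_on U f ->
  (forall x, U x -> 0 <= f x) -> (forall x, U x -> F (M x) = f x) ->
  (forall y, ~ (M @` U) y -> F y = 0) ->
  (\int[mu3]_(p in DT) (F (pt3 p))%:E =
   \int[mu3]_(p in UT) (f (pt3 p) * \det ('J M (pt3 p)))%:E)%E.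
Proof.
move=> mf f0 FM F0; transitivity (\int[mu3]_(p in V) (F (pt3 p))%:E)%E.
  rewrite integral_mkcond [RHS]integral_mkcond; apply: eq_integral => p _; rewrite !patchE.
  have [pV|pV] := boolP (p \in V); first by rewrite mem_set //; apply: VD; rewrite inE in pV.
  by case: ifP => // _; rewrite F0 //; rewrite notin_setE in pV.
transitivity (\int[mu3]_(p in V) (EFin \o (f \o pt3)) (G p))%E.
  apply: eq_integral => p; rewrite inE => -[x Ux Mx].
  by rewrite /= -Mx FM // -(pt3K p) -Mx GM // unpt3K.
rewrite (@ge0_integral_change _ U M (fun x => 'J M x) G oU sdU detU mG GM mV Vfin) //; first last.
- by move=> p Up; rewrite lee_fin; exact: f0.
- exact/measurable_EFinP.
by apply: eq_integral => p; rewrite inE => Up; rewrite /jacT patchE mem_set // EFinM.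
Qed.

Lemma Rintegral_pull (F f : E -> R) : measurable_on U f ->
  (forall x, U x -> F (M x) = f x) -> (forall y, ~ (M @` U) y -> F y = 0) ->
  integral3 D F = \int[mu3]_(p in UT) (f (pt3 p) * \det ('J M (pt3 p))).
Proof.
move=> mf FM F0; rewrite integral3E -/DT.
transitivity (\int[mu3]_(p in V) F (pt3 p)).
  rewrite Rintegral_mkcond [RHS]Rintegral_mkcond; apply: eq_Rintegral => p _; rewrite !patchE.
  have [pV|pV] := boolP (p \in V); first by rewrite mem_set //; apply: VD; rewrite inE in pV.
  by case: ifP => // _; rewrite F0 //; rewrite notin_setE in pV.
transitivity (\int[mu3]_(p in V) (f \o pt3) (G p)).
  apply: eq_Rintegral => p; rewrite inE => -[x Ux Mx].
  by rewrite /= -Mx FM // -(pt3K p) -Mx GM // unpt3K.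
rewrite (@Rintegral_change _ U M (fun x => 'J M x) G oU sdU detU mG GM mV Vfin) //.
by apply: eq_Rintegral => p; rewrite inE => Up; rewrite /jacT patchE mem_set.
Qed.

Lemma ae_push (f F : E -> R) : ae_on D (fun y => F y = f (inv_map T M y)) ->
  ae_on D (fun y => F y = push f y).
Proof.
rewrite !ae_onE; have N0 : \forall p \ae mu3, ~ (DT `\` V) p.
  exists (DT `\` V); split; [exact: measurableD|exact: (image_skel_null nd hM)|].
  by move=> p /contrapT.
apply: filterS2 N0 => p N0 h Dp; rewrite h // /push patchE mem_set //.
by apply: contrapT => Vp; apply: N0.
Qed.

End Transport.

(** * The divergence identity for pulled-back test functions *)

(*@@P22*)
Section PullDiv.
Context {R : realType}.
Local Notation E := 'rV[R]_3.
Local Notation R' := (measurableTypeR R).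
Local Notation T3 := (R' * R' * R')%type.
Local Notation mu3 := (@mu3 R).
Variables (T : tetmesh R) (M : E -> E) (k : nat) (C delta : R).
Hypotheses (nd : forall j, Defs.nondegenerate (@vtx _ T j)) (hM : mesh_map k C delta T M).

Local Notation K := (closed_polyhedron T).
Local Notation P := (polyhedron T).
Local Notation U := (ocells T).
Local Notation D := (image_domain T M).

Section Test.
Variable phi : E -> R.
Hypothesis tphi : test_fun D phi.

Let S := closure [set x | phi x != 0].
(** The preimage of the support of [phi] in the closed polyhedron; being closed there, it is
    compact. *)
Let Kpsi : set E := [set x | K x /\ S (M x)].
Let psi : E -> R := (phi \o M) \_ P.

Let sphi : smooth phi. Proof. by have [] := tphi. Qed.

Let phi0 y : ~ S y -> phi y = 0.
Proof. by move=> h; apply: contrapT => /eqP h'; apply: h; exact: subset_closure. Qed.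

Let cKpsi : compact Kpsi.
Proof.
have [B hB] := polyhedron_bounded T.
apply: (@compactE R Kpsi B) => [x [Kx _]|]; first exact: hB.
have cK : closed K by apply: compactE_closed; exact: polyhedron_compact.
have /continuous_closedP/(_ S (@closed_closure _ _)) := mesh_map_cont hM.
by rewrite -(closed_setSI _ cK).
Qed.

(** The support of [phi] lies in the image of the open polyhedron, and [M] is injective up to the
    boundary, so no boundary point is mapped into the support. *)
Let KpsiP : Kpsi `<=` P.
Proof.
move=> x [Kx]; have [_ _ SD] := tphi => /SD [x' Px' Mx'].
by rewrite -(mesh_map_inj_on hM (polyhedron_sub Px') Kx Mx').
Qed.

Let psi0 x : ~ Kpsi x -> psi x = 0.
Proof.
move=> h; rewrite /psi patchE; case: ifPn => //; rewrite inE => Px.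
by apply: phi0 => Sx; apply: h; split=> //; exact: polyhedron_sub.
Qed.

Let psiE x : P x -> psi x = phi (M x).
Proof. by move=> Px; rewrite /psi patchE mem_set. Qed.

Let near_out x : ~ P x -> \forall y \near x, psi y = 0.
Proof.
move=> Px; have nK : nbhs x (~` Kpsi).
  apply: open_nbhs_nbhs; split; last by move=> /KpsiP.
  by rewrite openC; exact: compactE_closed.
have FF : Filter (nbhs x) by exact: nbhs_filter.
by apply: (@filterS _ _ FF _ _ _ nK) => y; exact: psi0.
Qed.

Let cpsi : continuous psi.
Proof.
move=> x; have FF : Filter (nbhs x) by exact: nbhs_filter.
have [Px|Px] := pselect (P x); last first.
  have e0 := near_out Px; suff : psi y @[y --> x] --> psi x by [].
  rewrite (nbhs_singleton e0).
  have c0 : (fun _ : E => 0 : R) y @[y --> x] --> (0 : R) by exact: cvg_cst.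
  apply: cvg_trans c0.
  by apply: near_eq_cvg; apply: (@filterS _ _ FF _ _ _ e0) => y ->.
have nP : nbhs x P by apply: open_nbhs_nbhs; split=> //; exact: polyhedron_open.
suff : psi y @[y --> x] --> psi x by [].
rewrite psiE //; have cM : {for x, continuous M}.
  have := continuous_subspaceW (@polyhedron_sub _ T) (mesh_map_cont hM).
  by rewrite (continuous_open_subspace _ (@polyhedron_open _ T)); apply; rewrite inE.
have cphi : (phi \o M) y @[y --> x] --> phi (M x).
  by apply: (@continuous_comp _ _ _ M phi) => //; exact: smooth_continuous.
apply: cvg_trans cphi.
by apply: near_eq_cvg; apply: (@filterS _ _ FF _ _ _ nP) => y Py; rewrite psiE.
Qed.

Let phi_support : exists r, forall x, r < `|x| -> phi x = 0.
Proof.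
have [_ cS _] := tphi; have [r r0 hr] := compactE_bounded cS; exists r => x rx.
by apply: phi0 => /hr; rewrite leNgt rx.
Qed.

(** A step shorter than the margin around [Kpsi] stays in the polyhedron, where [M] is Lipschitz
    along segments and [phi] is globally Lipschitz. *)
Let Lpsi : exists2 t0, 0 < t0 & exists L, forall l x t, `|t| < t0 ->
  `|psi (x + t *: dir l) - psi x| <= L * `|t|.
Proof.
have [r hr] := phi_support; have [B B0 [_ _ hB]] := smooth_support_bounds sphi hr.
have [L L0 hL] := mesh_map_segment nd hM.
have [e e0 he] := compact_margin cKpsi (@polyhedron_open _ T) KpsiP.
have key x (u : E) t : Kpsi x -> `|u| <= 1 -> `|t| < e ->
    `|psi (x + t *: u) - psi x| <= B * L * `|t|.
  move=> Kx u1 te; have hP s : `|s| <= `|t| -> P (x + s *: u).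
    move=> st; apply: (he x) => //; rewrite addrAC subrr add0r normrZ.
    by rewrite (le_trans (ler_piMr _ u1)) // (le_trans st) // ltW.
  rewrite !psiE; [|exact: KpsiP|exact: hP].
  rewrite (le_trans (hB _ _)) // -mulrA ler_wpM2l // hL // => s st.
  by apply: polyhedron_sub; exact: hP.
exists e => //; exists (B * L) => l x t te.
have [Kx|Kx] := pselect (Kpsi x); first by apply: key; rewrite ?norm_dir.
have [Kxt|Kxt] := pselect (Kpsi (x + t *: dir l)); last first.
  by rewrite !psi0 // subrr normr0 !mulr_ge0 // ltW.
(* When only the far end lies in [Kpsi], the segment is walked backwards from there. *)
have := @key _ (- dir l) t Kxt; rewrite normrN norm_dir scalerN addrK distrC.
by move=> /(_ (lexx 1) te).
Qed.

(** This is [weak_div_lipschitz] for the pull-back of [phi], whose gradient on the open cells is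
    given by the chain rule. A vanishing [phi] is treated apart, as the mollifier is built from
    [phi]. *)
Lemma pull_div (dhat : E -> E) (ghat : E -> R) : L2v P dhat -> is_div P dhat ghat ->
  \int[mu3]_(p in pt3 @^-1` U) (\sum_l dhat (pt3 p) 0 l *
     (grad phi (M (pt3 p)) *m ('J M (pt3 p))^T) 0 l) =
  - \int[mu3]_(p in pt3 @^-1` U) (ghat (pt3 p) * phi (M (pt3 p))).
Proof.
move=> hd hg.
have [[x0 hx0]|phi00] := pselect (exists x0, phi x0 != 0); last first.
  have phiE x : phi x = 0 by apply: contrapT => /eqP h; apply: phi00; exists x.
  have gE x : grad phi x = 0.
    apply: sd_grad; rewrite (_ : phi = cst 0); last exact/funext.
    exact: sd_cst.
  rewrite (_ : (fun p => \sum_l _) = cst 0); last first.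
    by apply/funext => p; rewrite big1 // => l _; rewrite gE mul0mx mxE mulr0.
  rewrite (_ : (fun p => ghat _ * _) = cst 0); last first.
    by apply/funext => p; rewrite phiE mulr0.
  have mU : measurable (pt3 @^-1` U : set T3) by apply: measurable_open; exact: ocells_open.
  by rewrite Rintegral_cst // mul0r oppr0.
have [B hB] := polyhedron_bounded T; have [r hr] := phi_support.
have [t0 t00 [L hL]] := Lpsi.
have hG x : U x -> sd psi x (grad phi (M x) *m ('J M x)^T).
  move=> Ux; have nP : nbhs x P.
    by apply: open_nbhs_nbhs; split; [exact: polyhedron_open|exact: ocells_sub].
  have [s s0 hs] := (nbhs_normP_lt x _).1 nP.
  apply: (sd_local s0 _ (sd_comp (mesh_map_sdm hM Ux) (smooth_sd (M x) sphi))).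
  by move=> y /hs Py; rewrite psiE.
(* The mollifier is [phi * phi]: smooth, of bounded support, nonnegative and not identically zero,
   hence of nonzero mass. *)
have := @weak_div_lipschitz R P U Kpsi B B dhat ghat psi _ t0 L (fun x => phi x * phi x) r
  (@polyhedron_open _ T) (fun x Px => hB x (polyhedron_sub Px)) (@ocells_open _ T)
  (@ocells_sub _ T) (polyhedron_ocells_null nd) hd hg cKpsi (fun x Kx => hB x Kx.1) KpsiP
  cpsi psi0 t00 hL hG (smoothM sphi sphi).
have hr2 x : r < `|x| -> phi x * phi x = 0 by move=> /hr ->; rewrite mul0r.
move=> /(_ hr2) h; rewrite h.
  congr (- _); apply: eq_Rintegral => p; rewrite inE => Up.
  by rewrite psiE //; exact: ocells_sub.
apply: (@continuous_mass_neq0 R (fun x => phi x * phi x) x0 r) => //.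
- by move=> x; apply: smooth_continuous; exact: smoothM.
- by move=> x; rewrite -expr2 sqr_ge0.
- by rewrite mulf_neq0.
Qed.

End Test.

End PullDiv.

(** * Norm bounds and divergence of the Piola transform *)

(*@@P23*)
Section Bounds.
Context {R : realType}.
Local Notation E := 'rV[R]_3.
Implicit Types (x : E) (A : 'M[R]_3) (c : R).

Lemma enormE x : enorm x ^+ 2 = \sum_l x 0 l ^+ 2.
Proof. by rewrite sqr_sqrtr // sumr_ge0 // => l _; exact: sqr_ge0. Qed.

Lemma enormZ (a : R) x : enorm (a *: x) ^+ 2 = a ^+ 2 * enorm x ^+ 2.
Proof. by rewrite !enormE mulr_sumr; apply: eq_bigr => l _; rewrite mxE exprMn. Qed.

Lemma enorm_eq0 x : enorm x ^+ 2 = 0 -> x = 0.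
Proof.
rewrite enormE => /eqP; rewrite psumr_eq0 => [/allP h|l _]; last exact: sqr_ge0.
apply/rowP => l; rewrite mxE; apply/eqP.
by have := h l (mem_index_enum _); rewrite sqrf_eq0.
Qed.

(** Cauchy-Schwarz gives the factor 3 * c ^ 2 for each component, and there are three components. *)
Lemma enorm_mulmx_le x A c : (forall i j, `|A i j| <= c) ->
  enorm (x *m A) ^+ 2 <= 9 * c ^+ 2 * enorm x ^+ 2.
Proof.
move=> hA; have A2 i j : A i j ^+ 2 <= c ^+ 2.
  rewrite -(real_normK (num_real (A i j))) lerXn2r ?nnegrE //.
  exact: le_trans (normr_ge0 _) (hA i j).
have H j : (x *m A) 0 j ^+ 2 <= 3 * c ^+ 2 * (x 0 0 ^+ 2 + x 0 1 ^+ 2 + x 0 2 ^+ 2).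
  rewrite mxE sum_ord3.
  have := ler_wpM2l (sqr_ge0 (x 0 0)) (A2 0 j).
  have := ler_wpM2l (sqr_ge0 (x 0 1)) (A2 1 j).
  have := ler_wpM2l (sqr_ge0 (x 0 2)) (A2 2 j).
  have := sqr_ge0 (x 0 0 * A 0 j - x 0 1 * A 1 j).
  have := sqr_ge0 (x 0 0 * A 0 j - x 0 2 * A 2 j).
  have := sqr_ge0 (x 0 1 * A 1 j - x 0 2 * A 2 j).
  by rewrite !expr2; nra.
rewrite !enormE !sum_ord3 (le_trans (lerD (lerD (H 0) (H 1)) (H 2))) //.
by rewrite le_eqVlt; apply/orP; left; apply/eqP; ring.
Qed.

Lemma det_le A c : (forall i j, `|A i j| <= c) -> \det A <= 6 * c ^+ 3.
Proof.
move=> hA; rewrite (le_trans (ler_norm _)) // /determinant (le_trans (ler_norm_sum _ _ _)) //.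
apply: (@le_trans _ _ (\sum_(s : 'S_3) c ^+ 3)).
  apply: ler_sum => s _; rewrite normrM normr_sign mul1r prod_ord3 !normrM.
  by rewrite !exprS expr0 mulr1 mulrA !ler_pM ?mulr_ge0.
by rewrite sumr_const card_Sn -[X in X <= _]mulr_natl.
Qed.

End Bounds.

Section Transfer.
Context {R : realType}.
Local Notation E := 'rV[R]_3.
Local Notation R' := (measurableTypeR R).
Local Notation T3 := (R' * R' * R')%type.
Local Notation mu3 := (@mu3 R).
Variables (T : tetmesh R) (M : E -> E) (k : nat) (C delta : R).
Hypotheses (nd : forall j, Defs.nondegenerate (@vtx _ T j)) (hM : mesh_map k C delta T M).
Hypothesis delta0 : 0 < delta.

Local Notation P := (polyhedron T).
Local Notation U := (ocells T).
Local Notation D := (image_domain T M).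
Let UT : set T3 := pt3 @^-1` U.
Let PT : set T3 := pt3 @^-1` P.
Let DT : set T3 := pt3 @^-1` D.

Let mUT : measurable UT. Proof. by apply: measurable_open; exact: ocells_open. Qed.
Let mPT : measurable PT. Proof. by apply: measurable_open; exact: polyhedron_open. Qed.
Let mDT : measurable DT. Proof. exact: (measurable_image_domain nd hM). Qed.
Let UPT : UT `<=` PT. Proof. by move=> p; exact: ocells_sub. Qed.

Let measurable_onU f : measurable_on P f -> measurable_on U f.
Proof. by apply: measurable_funS. Qed.

Lemma ae_jacobian : \forall p \ae mu3, U (pt3 p) -> forall a b, `|'J M (pt3 p) a b| <= `|C|.
Proof.
have h (jab : 'I_(ncells T) * 'I_3 * 'I_3) : \forall p \ae mu3,
    ocell jab.1.1 (pt3 p) -> `|'J M (pt3 p) jab.1.2 jab.2| <= `|C|.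
  have : ae_on (ocell jab.1.1) (fun x => `|'J M x jab.1.2 jab.2| <= C).
    by have := mesh_map_jac hM jab.1.1 jab.1.2 jab.2; case: (k) => [|k'] [].
  by rewrite ae_onE; apply: filterS => p hp /hp /le_trans; apply; exact: ler_norm.
by apply: filterS (filter_forall _ h) => p hp [j oj] a b; exact: (hp (j, a, b)).
Qed.

Let ae_image : \forall p \ae mu3, DT p -> (M @` U) (pt3 p).
Proof.
exists (DT `\` pt3 @^-1` (M @` U)); split.
- apply: measurableD => //; apply: (measurable_image_open nd hM); first exact: ocells_open.
  by move=> x /ocells_sub /polyhedron_sub.
- exact: (image_skel_null nd hM).
- by move=> p /not_implyP.
Qed.

(** The common form of the norm bounds: a pointwise bound on integrand times Jacobian, valid almost
    everywhere on the open cells, becomes a bound between integrals over the curved and the straight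
    domain. *)
Let ge0_pull_le (F f h : E -> R) (a : R) : 0 <= a -> measurable_on U f ->
  (forall x, U x -> 0 <= f x) -> (forall x, U x -> F (M x) = f x) ->
  (forall y, ~ (M @` U) y -> F y = 0) -> measurable_on P h -> (forall x, P x -> 0 <= h x) ->
  (\forall p \ae mu3, U (pt3 p) -> f (pt3 p) * \det ('J M (pt3 p)) <= a * h (pt3 p)) ->
  (\int[mu3]_(p in DT) (F (pt3 p))%:E <= a%:E * \int[mu3]_(p in PT) (h (pt3 p))%:E)%E.
Proof.
move=> a0 mf f0 FM F0 mh h0 hf; rewrite (ge0_integral_pull nd hM delta0 mf f0 FM F0).
rewrite -ge0_integralZl //; [|exact/measurable_EFinP|by move=> p Pp; rewrite lee_fin; exact: h0].
have mah : measurable_fun PT (fun p => (a%:E * (h (pt3 p))%:E)%E).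
  by apply: measurable_funeM; exact/measurable_EFinP.
apply: (@le_trans _ _ (\int[mu3]_(p in UT) (a%:E * (h (pt3 p))%:E))%E); last first.
  apply: ge0_subset_integral => // p Pp; rewrite -EFinM lee_fin mulr_ge0 //; exact: h0.
apply: ae_ge0_le_integral => //.
- move=> p Up; rewrite lee_fin mulr_ge0 ?f0 // ltW //.
  exact: (mesh_map_det_gt0 hM delta0 Up).
- apply/measurable_EFinP; apply: measurable_funM => //.
  exact: (measurable_det hM).
- move=> p Up; rewrite -EFinM lee_fin mulr_ge0 // h0 //; exact: UPT.
- exact: measurable_funS mah.
Qed.

Lemma L2norm_pull_le phi phihat : measurable_on D phi -> L2 P phihat ->
  ae_on D (fun y => phi y = phihat (inv_map T M y)) ->
  L2norm D phi <= Num.sqrt (6 * `|C| ^+ 3) * L2norm P phihat.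
Proof.
move=> mphi [mph fin] aephi; have c0 : 0 <= 6 * `|C| ^+ 3 by rewrite mulr_ge0 // exprn_ge0.
rewrite /L2norm -sqrtrM //; apply: ler_wsqrtr; rewrite !integral3E /Rintegral.
have fin' : (\int[mu3]_(p in PT) ((phihat (pt3 p) ^+ 2)%:E))%E \is a fin_num.
  by rewrite ge0_fin_numE //; apply: integral_ge0 => p _; rewrite lee_fin sqr_ge0.
have mpush : measurable_on D (push T M phihat).
  by apply: (measurable_push nd hM); exact: measurable_onU.
have -> : (\int[mu3]_(p in DT) ((phi (pt3 p) ^+ 2)%:E) =
    \int[mu3]_(p in DT) ((push T M phihat (pt3 p) ^+ 2)%:E))%E.
  apply: ge0_ae_eq_integral => //.
  - by apply/measurable_EFinP; exact: measurable_funX.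
  - by apply/measurable_EFinP; exact: measurable_funX.
  - by move=> p _; rewrite lee_fin sqr_ge0.
  - by move=> p _; rewrite lee_fin sqr_ge0.
  - have := ae_push nd hM aephi; rewrite ae_onE; apply: filterS => p hp Dp.
    by rewrite hp.
have le : (\int[mu3]_(p in DT) ((push T M phihat (pt3 p) ^+ 2)%:E) <=
    (6 * `|C| ^+ 3)%:E * \int[mu3]_(p in PT) ((phihat (pt3 p) ^+ 2)%:E))%E.
  apply: (@ge0_pull_le (fun y => push T M phihat y ^+ 2) (fun x => phihat x ^+ 2)
    (fun x => phihat x ^+ 2)) => //.
  - by apply: measurable_funX; exact: measurable_onU.
  - by move=> x _; exact: sqr_ge0.
  - by move=> x Ux; rewrite (pushE hM).
  - by move=> y Uy; rewrite push0 // expr0n.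
  - exact: measurable_funX.
  - by move=> x _; exact: sqr_ge0.
  - apply: filterS ae_jacobian => p hp Up; rewrite mulrC ler_wpM2r ?sqr_ge0 //.
    by apply: det_le => i j; exact: hp.
rewrite -[6 * _]/(fine (6 * `|C| ^+ 3)%:E) -fineM //; apply: fine_le => //.
  rewrite ge0_fin_numE; last by apply: integral_ge0 => p _; rewrite lee_fin sqr_ge0.
  by apply: (le_lt_trans le); rewrite ltey_eq fin_numM.
by rewrite fin_numM.
Qed.

Section Field.
Variables (dhat : E -> E) (ghat : E -> R).
Hypotheses (hd : L2v P dhat) (hg : is_div P dhat ghat).
Hypothesis hd0 : ~ ae_on P (fun x => dhat x = 0).

Definition pushv : E -> E := fun y => \row_l push T M (fun x => piola M dhat x 0 l) y.
(** The expected divergence of [pushv]: the Piola transform divides divergences by the Jacobian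
    determinant. *)
Definition pushdiv : E -> R := push T M (fun x => ghat x / \det ('J M x)).

Let kappa : R := (9 * `|C| ^+ 2 + 1) / delta.

Let measurable_inv_det : measurable_on U (fun x => (\det ('J M x))^-1).
Proof.
have oU := @ocells_open _ T.
apply: continuous_measurable_on => // x Ux.
have cd : {for x, continuous (fun x => \det ('J M x))}.
  apply: (@det_continuous_at _ (fun x => 'J M x)) => i j.
  exact: (@sdm_entry_continuous _ U M (fun x => 'J M x) oU (fun x Ux => mesh_map_sdm hM Ux)).
have d0 : \det ('J M x) != 0 by rewrite gt_eqF // (mesh_map_det_gt0 hM delta0 Ux).
apply: (@continuous_comp _ _ _ (fun x => \det ('J M x)) (fun t : R => t^-1)) => //.
exact: inv_continuous.
Qed.

Let mdhat l : measurable_on U (fun x => dhat x 0 l).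
Proof. by apply: measurable_onU; have [] := hd l. Qed.

Let mghat : measurable_on U ghat.
Proof. by apply: measurable_onU; have [[]] := hg. Qed.

Let mpiola l : measurable_on U (fun x => piola M dhat x 0 l).
Proof.
rewrite (_ : (fun x => _) = (fun x => (\det ('J M x))^-1 *
    (\sum_i dhat x 0 i * 'J M x i l))); last first.
  by apply/funext => x; rewrite /piola !mxE.
apply: measurable_funM => //.
rewrite [X in measurable_fun _ X](_ : _ = (fun p : T3 =>
    \sum_i dhat (pt3 p) 0 i * 'J M (pt3 p) i l)) //.
apply: measurable_sum => i; apply: measurable_funM; first exact: mdhat.
exact: (measurable_jacobian hM).
Qed.

Let mpushdiv : measurable_on U (fun x => ghat x / \det ('J M x)).
Proof. exact: measurable_funM. Qed.

Let pushvE x : U x -> pushv (M x) = piola M dhat x.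
Proof. by move=> Ux; apply/rowP => l; rewrite mxE (pushE hM). Qed.

Let pushv0 y : ~ (M @` U) y -> pushv y = 0.
Proof. by move=> Uy; apply/rowP => l; rewrite !mxE push0. Qed.

Let measurable_enorm (A : set E) (d : E -> E) : (forall l, measurable_on A (fun x => d x 0 l)) ->
  measurable_on A (fun x => enorm (d x) ^+ 2).
Proof.
move=> md; rewrite (_ : (fun x => _) = (fun x => \sum_l d x 0 l ^+ 2)); last first.
  by apply/funext => x; rewrite enormE.
rewrite /measurable_on [X in measurable_fun _ X](_ : _ = (fun p : T3 =>
    \sum_l d (pt3 p) 0 l ^+ 2)) //.
by apply: measurable_sum => l; apply: measurable_funX; exact: md.
Qed.

Let det_ge x : U x -> delta <= \det ('J M x).
Proof. by move=> [j /(mesh_map_det hM)]. Qed.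

(** The squared factor 1 / det of the Piola transform and the Jacobian of the substitution leave a
    single 1 / det, at most 1 / delta. *)
Let piola_enorm x : U x -> (forall a b, `|'J M x a b| <= `|C|) ->
  enorm (piola M dhat x) ^+ 2 * \det ('J M x) <= 9 * `|C| ^+ 2 / delta * enorm (dhat x) ^+ 2.
Proof.
move=> Ux hJ; have d0 := mesh_map_det_gt0 hM delta0 Ux; have dn0 := lt0r_neq0 d0.
rewrite /piola enormZ.
have -> : (\det ('J M x))^-1 ^+ 2 * enorm (dhat x *m 'J M x) ^+ 2 * \det ('J M x) =
    (\det ('J M x))^-1 * enorm (dhat x *m 'J M x) ^+ 2 by field.
rewrite [leRHS]mulrAC [leRHS]mulrC ler_pM ?invr_ge0 ?sqr_ge0 ?(ltW d0) //.
  by rewrite lef_pV2 ?posrE // det_ge.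
exact: enorm_mulmx_le.
Qed.

Let I2 (A : set E) (d : E -> E) : \bar R := \int[mu3]_(p in pt3 @^-1` A) (enorm (d (pt3 p)) ^+ 2)%:E.
Let J2 (A : set E) (g : E -> R) : \bar R := \int[mu3]_(p in pt3 @^-1` A) (g (pt3 p) ^+ 2)%:E.

Let I2_ge0 A d : (0 <= I2 A d)%E.
Proof. by apply: integral_ge0 => p _; rewrite lee_fin sqr_ge0. Qed.

Let J2_ge0 A g : (0 <= J2 A g)%E.
Proof. by apply: integral_ge0 => p _; rewrite lee_fin sqr_ge0. Qed.

Let I2_fin : I2 P dhat \is a fin_num.
Proof.
rewrite ge0_fin_numE //; have h l : (\int[mu3]_(p in PT) (dhat (pt3 p) 0 l ^+ 2)%:E < +oo)%E.
  by have [_] := hd l.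
rewrite /I2 (eq_integral (fun p => \sum_l (dhat (pt3 p) 0 l ^+ 2)%:E)%E); last first.
  by move=> p _; rewrite enormE sumEFin.
rewrite ge0_integral_sum //; first by apply: lte_sum_pinfty => l _; exact: h.
  move=> l; apply/measurable_EFinP; apply: measurable_funX; by have [] := hd l.
by move=> l p _; rewrite lee_fin sqr_ge0.
Qed.

Let J2_fin : J2 P ghat \is a fin_num.
Proof. by rewrite ge0_fin_numE //; have [[_]] := hg. Qed.

Let mpushv l : measurable_on D (fun y => pushv y 0 l).
Proof.
rewrite (_ : (fun y => _) = push T M (fun x => piola M dhat x 0 l)).
  by apply: (measurable_push nd hM).
by apply/funext => y; rewrite mxE.
Qed.

Let I2_le : (I2 D pushv <= (9 * `|C| ^+ 2 / delta)%:E * I2 P dhat)%E.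
Proof.
apply: (@ge0_pull_le (fun y => enorm (pushv y) ^+ 2) (fun x => enorm (piola M dhat x) ^+ 2)
  (fun x => enorm (dhat x) ^+ 2)).
- by rewrite divr_ge0 ?(ltW delta0) // mulr_ge0 // exprn_ge0.
- exact: measurable_enorm.
- by move=> x _; exact: sqr_ge0.
- by move=> x Ux; rewrite pushvE.
- by move=> y Uy; rewrite pushv0 // enormE big1 // => l _; rewrite mxE expr0n.
- by apply: measurable_enorm => l; have [] := hd l.
- by move=> x _; exact: sqr_ge0.
- by apply: filterS ae_jacobian => p hp Up; apply: piola_enorm => //; exact: hp.
Qed.

Let J2_le : (J2 D pushdiv <= delta^-1%:E * J2 P ghat)%E.
Proof.
apply: (@ge0_pull_le (fun y => pushdiv y ^+ 2) (fun x => (ghat x / \det ('J M x)) ^+ 2)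
  (fun x => ghat x ^+ 2)).
- by rewrite invr_ge0 ltW.
- exact: measurable_funX.
- by move=> x _; exact: sqr_ge0.
- by move=> x Ux; rewrite /pushdiv (pushE hM).
- by move=> y Uy; rewrite /pushdiv push0 // expr0n.
- by apply: measurable_funX; have [[]] := hg.
- by move=> x _; exact: sqr_ge0.
- apply: aeW => p Up; have d0 := mesh_map_det_gt0 hM delta0 Up; have dn0 := lt0r_neq0 d0.
  have -> : (ghat (pt3 p) / \det ('J M (pt3 p))) ^+ 2 * \det ('J M (pt3 p)) =
    (\det ('J M (pt3 p)))^-1 * ghat (pt3 p) ^+ 2 by field.
  by rewrite ler_wpM2r ?sqr_ge0 // lef_pV2 ?posrE // det_ge.
Qed.

Let I2D_fin : I2 D pushv \is a fin_num.
Proof.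
by rewrite ge0_fin_numE // (le_lt_trans I2_le) // ltey_eq fin_numM.
Qed.

Let J2D_fin : J2 D pushdiv \is a fin_num.
Proof.
by rewrite ge0_fin_numE // (le_lt_trans J2_le) // ltey_eq fin_numM.
Qed.

(** If the norm vanished, dhat J would vanish almost everywhere on the open cells, and so would
    [dhat], because J is invertible there. *)
Let I2D_neq0 : I2 D pushv != 0%E.
Proof.
apply/eqP => I0; apply: hd0.
have mF : measurable_on U (fun x => enorm (piola M dhat x) ^+ 2) by exact: measurable_enorm.
have mFd : measurable_fun UT (fun p : T3 =>
    (enorm (piola M dhat (pt3 p)) ^+ 2 * \det ('J M (pt3 p)))%:E).
  by apply/measurable_EFinP; apply: measurable_funM => //; exact: (measurable_det hM).
have F0 x : U x -> 0 <= enorm (piola M dhat x) ^+ 2 * \det ('J M x).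
  by move=> Ux; rewrite mulr_ge0 ?sqr_ge0 // ltW // (mesh_map_det_gt0 hM delta0 Ux).
have : (\int[mu3]_(p in UT) `|(enorm (piola M dhat (pt3 p)) ^+ 2 * \det ('J M (pt3 p)))%:E|)%E = 0%E.
  rewrite -I0 /I2 (@ge0_integral_pull _ T M k C delta nd hM delta0 (fun y => enorm (pushv y) ^+ 2)
    (fun x => enorm (piola M dhat x) ^+ 2)) //.
  - by apply: eq_integral => p; rewrite inE => Up; rewrite gee0_abs // lee_fin F0.
  - by move=> x _; exact: sqr_ge0.
  - by move=> x Ux; rewrite pushvE.
  - by move=> y Uy; rewrite pushv0 // enormE big1 // => l _; rewrite mxE expr0n.
move=> /(ae_eq_integral_abs mu3 mUT mFd) ae0.
rewrite ae_onE; have aeU : \forall p \ae mu3, PT p -> UT p.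
  exists (PT `\` UT); split; [exact: measurableD|exact: (polyhedron_ocells_null nd)|].
  by move=> p /not_implyP.
apply: filterS2 aeU ae0 => p PU h Pp; have Up := PU Pp.
have d0 := mesh_map_det_gt0 hM delta0 Up; have dn0 := lt0r_neq0 d0.
have /eqP := h Up; rewrite eqe mulf_eq0 (negPf dn0) orbF => /eqP /enorm_eq0.
move=> /eqP; rewrite scaler_eq0 invr_eq0 (negPf dn0) /= => /eqP h0.
have uJ : 'J M (pt3 p) \in unitmx by rewrite unitmxE unitfE.
by rewrite -[LHS](mulmxK uJ) h0 mul0mx.
Qed.

Let norm_fine (A : set E) d g :
  Hdiv_norm A d g = Num.sqrt (fine (I2 A d) + fine (J2 A g)).
Proof.
have J0 : 0 <= integral3 A (fun x => g x ^+ 2) by exact: (fine_ge0 (J2_ge0 A g)).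
by rewrite /Hdiv_norm (sqr_sqrtr J0).
Qed.

Lemma pushv_norm_gt0 : 0 < Hdiv_norm D pushv pushdiv.
Proof.
rewrite norm_fine sqrtr_gt0 ltr_pwDl ?fine_ge0 //; rewrite fine_gt0 //.
by rewrite lt0e I2D_neq0 I2_ge0 /= ltey_eq I2D_fin.
Qed.

Lemma pushv_norm_le : Hdiv_norm D pushv pushdiv <=
  Num.sqrt ((9 * `|C| ^+ 2 + 1) / delta) * Hdiv_norm P dhat ghat.
Proof.
have k0 : 0 <= kappa by rewrite divr_ge0 ?(ltW delta0) // addr_ge0 // mulr_ge0 // exprn_ge0.
have c0 : 0 <= 9 * `|C| ^+ 2 / delta by rewrite divr_ge0 ?(ltW delta0) // mulr_ge0 // exprn_ge0.
rewrite !norm_fine -sqrtrM //; apply: ler_wsqrtr; rewrite -/kappa mulrDr.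
apply: lerD.
  apply: (@le_trans _ _ (9 * `|C| ^+ 2 / delta * fine (I2 P dhat))).
    rewrite -[9 * _ / _]/(fine (9 * `|C| ^+ 2 / delta)%:E) -fineM //.
    by apply: fine_le => //; rewrite fin_numM.
  by rewrite ler_wpM2r ?fine_ge0 // ler_pM2r ?invr_gt0 // lerDl.
apply: (@le_trans _ _ (delta^-1 * fine (J2 P ghat))).
  rewrite -[delta^-1]/(fine delta^-1%:E) -fineM //.
  by apply: fine_le => //; rewrite fin_numM.
rewrite ler_wpM2r ?fine_ge0 // -[leLHS]mul1r ler_pM2r ?invr_gt0 // lerDr.
by rewrite mulr_ge0 // exprn_ge0.
Qed.

Lemma pushv_not_ae0 : ~ ae_on D (fun y => pushv y = 0).
Proof.
rewrite ae_onE => h; move/eqP: I2D_neq0; apply.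
have : (\int[mu3]_(p in DT) `|(enorm (pushv (pt3 p)) ^+ 2)%:E|)%E = 0%E.
  apply/(ae_eq_integral_abs mu3 mDT).
    by apply/measurable_EFinP; exact: (@measurable_enorm D pushv mpushv).
  apply: filterS h => p hp Dp; rewrite hp // enormE big1 // => l _; by rewrite mxE expr0n.
move=> <-; apply: eq_integral => p _; rewrite gee0_abs // lee_fin; exact: sqr_ge0.
Qed.

(** After the change of variables the determinant cancels, and dhat J paired with the gradient of
    [phi] is [dhat] paired with the gradient of [phi] composed with [M]; [pull_div] finishes. *)
Lemma is_div_pushv : is_div D pushv pushdiv.
Proof.
split.
  split; first by apply: (measurable_push nd hM).
  by have := J2D_fin; rewrite ge0_fin_numE //; exact: J2_ge0.
move=> phi tphi; have [sphi _ _] := tphi.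
have mphiM f : smooth f -> measurable_on U (fun x => f (M x)).
  move=> sf; apply: continuous_measurable_on; first exact: ocells_open.
  move=> x Ux; apply: (@continuous_comp _ _ _ M f); last exact: smooth_continuous.
  exact: sdm_continuous (mesh_map_sdm hM Ux).
rewrite (@Rintegral_pull _ T M k C delta nd hM delta0 _
  (fun x => \sum_l piola M dhat x 0 l * partial l phi (M x))); first last.
- by move=> y Uy; rewrite big1 // => l _; rewrite pushv0 // mxE mul0r.
- by move=> x Ux; apply: eq_bigr => l _; rewrite pushvE.
- rewrite /measurable_on [X in measurable_fun _ X](_ : _ = (fun p : T3 =>
    \sum_l piola M dhat (pt3 p) 0 l * partial l phi (M (pt3 p)))) //.
  apply: measurable_sum => l; apply: measurable_funM; first exact: mpiola.
  by apply: mphiM; exact: smooth_partial.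
rewrite (@Rintegral_pull _ T M k C delta nd hM delta0 _
  (fun x => ghat x / \det ('J M x) * phi (M x))); first last.
- by move=> y Uy; rewrite /pushdiv push0 // mul0r.
- by move=> x Ux; rewrite /pushdiv (pushE hM).
- by apply: measurable_funM => //; exact: mphiM.
transitivity (\int[mu3]_(p in UT) (\sum_l dhat (pt3 p) 0 l *
     (grad phi (M (pt3 p)) *m ('J M (pt3 p))^T) 0 l)).
  apply: eq_Rintegral => p; rewrite inE => Up.
  have dn0 := lt0r_neq0 (mesh_map_det_gt0 hM delta0 Up).
  move: dn0; move: (pt3 p) => x dn0.
  rewrite mulr_suml; under eq_bigr => l _ do
    rewrite /piola !mxE mulrAC -mulrA mulrACA mulVf // mul1r mulr_suml.
  rewrite exchange_big; apply: eq_bigr => l _; rewrite mxE mulr_sumr.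
  by apply: eq_bigr => i _; rewrite !mxE mulrA mulrAC.
rewrite (pull_div nd hM tphi hd hg); congr (- _); apply: eq_Rintegral => p; rewrite inE => Up.
have dn0 := lt0r_neq0 (mesh_map_det_gt0 hM delta0 Up).
by rewrite /=; field.
Qed.

Lemma pushv_Dh m : Dhat m T dhat -> Dh m T M pushv.
Proof.
move=> hD; split=> //; exists dhat => //; rewrite ae_onE.
apply: filterS ae_image => p hp /hp [x Ux <-].
by rewrite (inv_mapK hM); [rewrite (pushvE Ux)|exact: ocells_sub].
Qed.

(** The factor 1 / det in the divergence cancels the Jacobian, and the skeleton contributes
    nothing. *)
Lemma pushdiv_pairing phi phihat : measurable_on D phi -> L2 P phihat ->
  ae_on D (fun y => phi y = phihat (inv_map T M y)) ->
  integral3 D (fun y => phi y * pushdiv y) = integral3 P (fun x => phihat x * ghat x).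
Proof.
move=> mphi hphi aephi; have [mph fin] := hphi.
have mpd : measurable_on D pushdiv by exact: (measurable_push nd hM).
have mpp : measurable_on D (push T M phihat).
  by apply: (measurable_push nd hM); exact: measurable_onU.
transitivity (integral3 D (fun y => push T M phihat y * pushdiv y)).
  rewrite !integral3E /Rintegral; congr fine; apply: ae_eq_integral => //.
  - by apply/measurable_EFinP; exact: measurable_funM.
  - by apply/measurable_EFinP; exact: measurable_funM.
  - by have := ae_push nd hM aephi; rewrite ae_onE; apply: filterS => p hp Dp; rewrite hp.
rewrite (@Rintegral_pull _ T M k C delta nd hM delta0 _
  (fun x => phihat x * (ghat x / \det ('J M x)))); first last.
- by move=> y Uy; rewrite push0 // mul0r.
- by move=> x Ux; rewrite /pushdiv !(pushE hM).
- by apply: measurable_funM => //; exact: measurable_onU.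
transitivity (\int[mu3]_(p in UT) (phihat (pt3 p) * ghat (pt3 p))).
  apply: eq_Rintegral => p; rewrite inE => Up.
  have dn0 := lt0r_neq0 (mesh_map_det_gt0 hM delta0 Up).
  by rewrite /=; field.
rewrite integral3E; apply/esym/Rintegral_null_diff => //; first exact: (polyhedron_ocells_null nd).
have [mg _] := hg.1.
have i1 : mu3.-integrable PT (EFin \o (fun p => phihat (pt3 p) ^+ 2)).
  apply/integrableP; split; first by apply/measurable_EFinP; exact: measurable_funX.
  by under eq_integral do rewrite /= ger0_norm ?sqr_ge0 //.
have i2 : mu3.-integrable PT (EFin \o (fun p => ghat (pt3 p) ^+ 2)).
  apply/integrableP; split; first by apply/measurable_EFinP; exact: measurable_funX.
  under eq_integral do rewrite /= ger0_norm ?sqr_ge0 //.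
  by have := J2_fin; rewrite ge0_fin_numE //; exact: J2_ge0.
(* The product is dominated by the sum of the two squares. *)
apply: (le_integrable mPT _ _ (integrableDR mPT i1 i2)).
  by apply/measurable_EFinP; exact: measurable_funM.
move=> p _; rewrite /= lee_fin [leRHS]ger0_norm ?addr_ge0 ?sqr_ge0 // ler_norml.
have := sqr_ge0 (phihat (pt3 p) + ghat (pt3 p)); have := sqr_ge0 (phihat (pt3 p) - ghat (pt3 p)).
by rewrite !expr2 => h1 h2; apply/andP; split; nra.
Qed.

End Field.

End Transfer.

(** * Transfer of the inf-sup condition *)

(*@@P24*)
Lemma inf_sup_transfer (R : realType) (T : tetmesh R) (M : 'rV[R]_3 -> 'rV[R]_3) (k m n : nat)
    (C delta beta : R) : (forall j, Defs.nondegenerate (@vtx _ T j)) ->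
  mesh_map k C delta T M -> 0 < delta -> 0 < beta ->
  inf_sup (polyhedron T) (Dhat m T) (Shat n T) beta ->
  inf_sup (image_domain T M) (Dh m T M) (Sh n T M)
    (beta / (2 * Num.sqrt ((9 * `|C| ^+ 2 + 1) / delta) * Num.sqrt (6 * `|C| ^+ 3 + 1))).
Proof.
move=> nd hM delta0 beta0 hinf phi [mphi [phihat hS aephi]].
(* In [s1] the summand 1 accounts for the divergence term of the norm; in [s2] it keeps the constant
   positive when [C] is zero. *)
set s1 := Num.sqrt _; set s2 := Num.sqrt (_ + 1).
have s10 : 0 < s1 by rewrite sqrtr_gt0 divr_gt0 // ltr_wpDl // mulr_ge0 // exprn_ge0.
have s20 : 0 < s2 by rewrite sqrtr_gt0 ltr_wpDl // mulr_ge0 // exprn_ge0.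
have [hphi _] := hS; have sup := hinf _ hS.
set nh := L2norm (polyhedron T) phihat in sup *.
have nh0 : 0 <= nh by exact: sqrtr_ge0.
have le_phi : L2norm (image_domain T M) phi <= s2 * nh.
  rewrite (le_trans (L2norm_pull_le nd hM delta0 mphi hphi aephi)) // ler_wpM2r //.
  by rewrite ler_wsqrtr // lerDl.
have transfer dhat ghat : Dhat m T dhat -> ~ ae_on (polyhedron T) (fun x => dhat x = 0) ->
    is_div (polyhedron T) dhat ghat ->
    let I := integral3 (polyhedron T) (fun x => phihat x * ghat x) in
    exists2 N, 0 < N <= s1 * Hdiv_norm (polyhedron T) dhat ghat &
      ((I / N)%:E <= sup_quotient (image_domain T M) (Dh m T M) phi)%E.
  move=> hD hd0 hg I; have [[hd _] _] := hD.
  exists (Hdiv_norm (image_domain T M) (pushv T M dhat) (pushdiv T M ghat)).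
    rewrite (pushv_norm_gt0 nd hM delta0 ghat hd hd0) /=.
    exact: (pushv_norm_le nd hM delta0 hd hg).
  apply: ereal_sup_ubound; exists (pushv T M dhat), (pushdiv T M ghat); split.
  - exact: (pushv_Dh nd hM delta0 hd hD).
  - exact: (pushv_not_ae0 nd hM delta0 hd hd0).
  - exact: (is_div_pushv nd hM delta0 hd hg).
  - by rewrite (pushdiv_pairing nd hM delta0 hg mphi hphi aephi).
have [nh_gt0|nh_le0] := ltP 0 nh.
  (* A value strictly below the supremum, so that some admissible field exceeds it. *)
  have : ((beta * nh / 2)%:E < sup_quotient (polyhedron T) (Dhat m T) phihat)%E.
    by apply: lt_le_trans sup; rewrite lte_fin ltr_pdivrMr // ltr_pMr ?ltr1n ?mulr_gt0.
  move=> /ereal_sup_gt[_ [dhat [ghat [hD hd0 hg ->]]]]; rewrite lte_fin.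
  have [N /andP[N0 NN]] := transfer dhat ghat hD hd0 hg.
  set I := integral3 _ _; set Nh := Hdiv_norm _ _ _ in NN * => hsup lt.
  apply: le_trans hsup; rewrite lee_fin.
  have Nh0 : 0 < Nh by rewrite -(pmulr_rgt0 _ s10) (lt_le_trans N0).
  have lt' : beta * nh / 2 * Nh < I by rewrite -ltr_pdivlMr.
  have I0 : 0 <= I.
    by apply: ltW; apply: le_lt_trans lt'; rewrite !mulr_ge0 // ltW.
  apply: (@le_trans _ _ (I / (s1 * Nh))); last by rewrite ler_wpM2l // lef_pV2 ?posrE ?mulr_gt0.
  rewrite ler_pdivlMr ?mulr_gt0 //; apply: le_trans (ltW lt').
  apply: (@le_trans _ _ (beta / (2 * s1 * s2) * (s2 * nh) * (s1 * Nh))).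
    rewrite ler_wpM2r ?mulr_ge0 ?(ltW s10) ?(ltW Nh0) // ler_wpM2l //.
    by rewrite divr_ge0 ?mulr_ge0 // ltW.
  rewrite le_eqVlt; apply/orP; left; apply/eqP; field.
  by rewrite !gt_eqF.
(* In the remaining case [phihat] vanishes almost everywhere and [phi] has norm zero; it suffices to
   exhibit one field, whose quotient is then 0. *)
have nhE : nh = 0 by apply/le_anti; rewrite nh_le0 nh0.
have -> : L2norm (image_domain T M) phi = 0.
  by apply/le_anti; rewrite (le_trans le_phi) ?nhE ?mulr0 //= sqrtr_ge0.
(* A nonzero field exists, because the supremum is at least 0 and hence not that of an empty set;
   any negative number would do in place of -1. *)
rewrite mulr0; have : (((-1) : R)%:E < sup_quotient (polyhedron T) (Dhat m T) phihat)%E.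
  by apply: lt_le_trans sup; rewrite nhE mulr0 lte_fin ltrN10.
move=> /ereal_sup_gt[_ [dhat [ghat [hD hd0 hg _]]] _].
have [N _] := transfer dhat ghat hD hd0 hg.
rewrite (_ : integral3 _ _ = 0) ?mul0r //.
have [mph fin] := hphi; have [[mg _] _] := hg.
have mP : measurable (pt3 @^-1` (polyhedron T)
    : set (measurableTypeR R * measurableTypeR R * measurableTypeR R)).
  by apply: measurable_open; exact: polyhedron_open.
have f2 : (\int[@mu3 R]_(p in pt3 @^-1` polyhedron T) `|(phihat (pt3 p) ^+ 2)%:E|)%E = 0%E.
  rewrite (eq_integral (fun p => (phihat (pt3 p) ^+ 2)%:E)); last first.
    by move=> p _; rewrite gee0_abs // lee_fin sqr_ge0.
  have J0 : (0 <= \int[@mu3 R]_(p in pt3 @^-1` polyhedron T) (phihat (pt3 p) ^+ 2)%:E)%E.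
    by apply: integral_ge0 => p _; rewrite lee_fin sqr_ge0.
  have Jf : (\int[@mu3 R]_(p in pt3 @^-1` polyhedron T) (phihat (pt3 p) ^+ 2)%:E)%E \is a fin_num.
    by rewrite ge0_fin_numE.
  have := fine_ge0 J0; rewrite -(fineK Jf) => J0'; congr EFin.
  by move: nhE => /eqP; rewrite sqrtr_eq0 => h; apply/le_anti; rewrite J0' andbT.
have mphi2 : measurable_fun (pt3 @^-1` polyhedron T) (fun p => (phihat (pt3 p) ^+ 2)%:E).
  by apply/measurable_EFinP; exact: measurable_funX.
have aeq := (ae_eq_integral_abs (@mu3 R) mP mphi2).1 f2.
rewrite integral3E /Rintegral.
have -> : (\int[@mu3 R]_(p in pt3 @^-1` polyhedron T) (phihat (pt3 p) * ghat (pt3 p))%:E =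
    \int[@mu3 R]_(p in pt3 @^-1` polyhedron T) 0)%E.
  apply: ae_eq_integral => //; first by apply/measurable_EFinP; exact: measurable_funM.
  apply: filterS aeq => p h Pp; have /eqP := h Pp.
  by rewrite eqe sqrf_eq0 => /eqP ->; rewrite mul0r.
by rewrite integral0.
Qed.

Theorem lemma3p4 (R : realType) (k : nat) (hk : (2 <= k)%N)
    (Omega : set 'rV[R]_3)
    (hOmega : bounded_lipschitz_domain Omega)
    (hbdry : piecewise_Ck_bdry k.+1 Omega)
    (I : Type) (T : I -> tetmesh R) (M : I -> 'rV[R]_3 -> 'rV[R]_3)
    (sigma tau C delta beta4 : R)
    (hmesh : forall i, is_mesh (T i))
    (hshape : forall i, shape_regular sigma (T i))
    (hunif : forall i, quasi_uniform tau (T i))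
    (happrox : forall i, approximates C (T i) Omega)
    (hdelta : 0 < delta)
    (hM : forall i, mesh_map k C delta (T i) (M i))
    (hbeta4 : 0 < beta4)
    (hinfsup : forall i,
      inf_sup (polyhedron (T i)) (Dhat (k - 1) (T i)) (Shat (k - 2) (T i)) beta4) :
  exists beta6 : R, 0 < beta6 /\
    forall i,
      inf_sup (image_domain (T i) (M i))
        (Dh (k - 1) (T i) (M i)) (Sh (k - 2) (T i) (M i)) beta6.
Proof.
(* The constant of [inf_sup_transfer], which depends on [beta4], [C] and [delta] only and hence is
   the same for all meshes of the family. *)
exists (beta4 / (2 * Num.sqrt ((9 * `|C| ^+ 2 + 1) / delta) * Num.sqrt (6 * `|C| ^+ 3 + 1))).
have s10 : 0 < Num.sqrt ((9 * `|C| ^+ 2 + 1) / delta).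
  by rewrite sqrtr_gt0 divr_gt0 // ltr_wpDl // mulr_ge0 // exprn_ge0.
have s20 : 0 < Num.sqrt (6 * `|C| ^+ 3 + 1).
  by rewrite sqrtr_gt0 ltr_wpDl // mulr_ge0 // exprn_ge0.
split; first by rewrite divr_gt0 // !mulr_gt0.
move=> i; have [_ nd _ _] := hmesh i.
exact: (inf_sup_transfer nd (hM i) hdelta hbeta4 (hinfsup i)).
Qed.
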